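(* Let $s>\frac12$, $\phi\in\Sigma_s(\mathbf R^d)\setminus 0$, and let $f\in\mathcal S_{1/2}'(\mathbf R^d)$. Then the following conditions are equivalent: (1) $f\in\Gamma_{0,s}^\infty(\mathbf R^d)$ (resp. $f\in\Gamma_{1,s}^\infty(\mathbf R^d)$); (2) there exists a constant $h>0$ such that $$|V_\phi f(x,\xi)|\lesssim e^{h|x|^{1/s}-\varepsilon|\xi|^{1/s}}$$ for every $\varepsilon>0$ (resp. for some $\varepsilon>0$).
   Context: $g_1\lesssim g_2$ means $g_1\le Cg_2$ with a constant $C>0$ independent of the variables and of the multi-indices involved (but allowed to depend on $\varepsilon$, $h$). **Gelfand-Shilov spaces.** For $s>0$, $\mathcal S_s(\mathbf R^d)$ (resp. $\Sigma_s(\mathbf R^d)$) consists of all $f\in C^\infty(\mathbf R^d)$ with $|x^\beta\partial^\alpha f(x)|\lesssim h^{|\alpha+\beta|}(\alpha!\beta!)^s$ for some (resp. every) $h>0$, with the inductive (resp. projective) limit topology over $h$; $\mathcal S_s'$ is the dual of $\mathcal S_s$. **Symbol classes.** For $f\in C^\infty(\mathbf R^d)$ consider $( * )$: $|\partial^\alpha f(x)|\lesssim\varepsilon^{|\alpha|}(\alpha!)^se^{h|x|^{1/s}}$ for all $\alpha\in \mathbf N^d$, $x\in \mathbf R^d$. $\Gamma_{0,s}^\infty(\mathbf R^d)$: there is $h>0$ such that $( * )$ holds for every $\varepsilon>0$. $\Gamma_{1,s}^\infty(\mathbf R^d)$: $( * )$ holds for some $\varepsilon,h>0$. **Short-time Fourier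 transform.** $V_\phi f(x,\xi)=(2\pi)^{-d/2}\int f(y)\overline{\phi(y-x)}e^{-i\langle y,\xi\rangle}\,dy$ when the integral makes sense. For $f\in\mathcal S_{1/2}'(\mathbf R^d)$ and $\phi\in\mathcal S_{1/2}(\mathbf R^d)$ it is $(2\pi)^{-d/2}(f,\phi(\cdot-x)e^{i\langle\cdot,\xi\rangle})$ with $(\cdot,\cdot)$ the extension of the $L^2$ scalar product. In general, for $f\in\mathcal S_{1/2}'$ and $\phi\in\Sigma_s$, $V_\phi f\in\mathcal S_{1/2}'(\mathbf R^{2d})$ is the partial Fourier transform with respect to $y$ (with normalization $(2\pi)^{-d/2}\int\cdot\,e^{-i\langle y,\xi\rangle}dy$) of the distribution $f(y)\overline{\phi(y-x)}$, and the estimate in (2) means that this distribution is a function satisfying the bound. *)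

(* Defs.v *)
From HB Require Import structures.
From mathcomp Require Import all_boot all_order all_algebra.
From mathcomp Require Import all_classical all_reals all_analysis.
From mathcomp Require Import complex.

Set Implicit Arguments.
Unset Strict Implicit.
Unset Printing Implicit Defensive.

Import Order.TTheory GRing.Theory Num.Theory.
Import numFieldNormedType.Exports.
Import ComplexField.Normc.

Local Open Scope classical_set_scope.
Local Open Scope complex_scope.
Local Open Scope ring_scope.

Section lebesgue_tuple.
Context {R : realType}.
Local Notation T := (measurableTypeR R).
Local Open Scope ereal_scope.

Definition cons_pair n (p : T * n.-tuple T) : n.+1.-tuple T :=
  [the n.+1.-tuple T of p.1 :: p.2].

Lemma measurable_cons_pair n : measurable_fun setT (@cons_pair n).
Proof. exact: measurable_cons. Qed.

Section step.
Variables (n : nat) (mu : {sigma_finite_measure set (n.-tuple T) -> \bar R}).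

Definition lebesgue_cons : set (n.+1.-tuple T) -> \bar R :=
  pushforward (@lebesgue_measure R \x mu) (@cons_pair n).

Let mcons (A : set (n.+1.-tuple T)) :
  measurable A -> measurable (@cons_pair n @^-1` A).
Proof. by move=> mA; rewrite -[X in measurable X]setTI; exact: measurable_cons_pair. Qed.

Let lebesgue_cons0 : lebesgue_cons set0 = 0.
Proof. by rewrite /lebesgue_cons /pushforward preimage_set0 measure0. Qed.

Let lebesgue_cons_ge0 A : 0 <= lebesgue_cons A.
Proof. by rewrite /lebesgue_cons /pushforward; exact: measure_ge0. Qed.

Let lebesgue_cons_sigma_additive : semi_sigma_additive lebesgue_cons.
Proof.
move=> F mF tF mUF; rewrite /lebesgue_cons /pushforward preimage_bigcup.
apply: measure_semi_sigma_additive.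
- by move=> k; exact: mcons.
- apply/trivIsetP => /= i j _ _ ij; rewrite -preimage_setI.
  by move/trivIsetP : tF => /(_ _ _ _ _ ij) ->//; rewrite preimage_set0.
- by rewrite -preimage_bigcup; exact: mcons.
Qed.

HB.instance Definition _ := isMeasure.Build _ _ _ lebesgue_cons
  lebesgue_cons0 lebesgue_cons_ge0 lebesgue_cons_sigma_additive.

Let lebesgue_cons_sigma_finite : sigma_finite setT lebesgue_cons.
Proof.
have /sigma_finiteP[F [TF ndF Foo]] := sigma_finiteT (@lebesgue_measure R).
have /sigma_finiteP[G [TG ndG Goo]] := sigma_finiteT mu.
pose g (t : n.+1.-tuple T) : T * n.-tuple T := (thead t, [tuple of behead t]).
have mg : measurable_fun setT g.
  by apply: measurable_fun_pair; [exact: measurable_tnth|exact: measurable_behead].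
have gK p : g (cons_pair p) = p.
  by case: p => x t; rewrite /g /cons_pair /=; congr pair; exact: val_inj.
exists (fun k => g @^-1` (F k `*` G k)).
  rewrite -preimage_bigcup; apply/esym; rewrite -subTset => t _.
  have [i _ Fi] : (\bigcup_k F k) (g t).1 by rewrite -TF.
  have [j _ Gj] : (\bigcup_k G k) (g t).2 by rewrite -TG.
  exists (maxn i j) => //; split.
  - by move: Fi; apply/subsetPset/ndF/leq_maxl.
  - by move: Gj; apply/subsetPset/ndG/leq_maxr.
move=> k; have [mF ltF] := Foo k; have [mG ltG] := Goo k; split.
  by rewrite -[X in measurable X]setTI; apply: mg => //; exact: measurableX.
rewrite /lebesgue_cons /pushforward -comp_preimage.
rewrite (_ : g \o _ = id) ?preimage_id; last by apply/funext => p /=; exact: gK.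
by rewrite product_measure1E// lte_mul_pinfty// ge0_fin_numE.
Qed.

HB.instance Definition _ := Measure_isSigmaFinite.Build _ _ _ lebesgue_cons
  lebesgue_cons_sigma_finite.

End step.

(* Lebesgue measure on R^n as the n-fold product of [lebesgue_measure];
   R^0 carries the unit mass. *)
Fixpoint lebesgue_tuple n :
    {sigma_finite_measure set (n.-tuple T) -> \bar R} :=
  if n is n'.+1 then lebesgue_cons (lebesgue_tuple n')
  else \d_ [tuple].

End lebesgue_tuple.

Section real_space.
Variables (R : realType) (d : nat).
Local Notation C := R[i].
Implicit Types (f : 'rV[R]_d -> C) (x y : 'rV[R]_d).

Definition dotp x y : R := \sum_i x 0 i * y 0 i.

(* The library norm on ['rV[R]_d] is the sup norm; this is the Euclidean one. *)
Definition enorm x : R := Num.sqrt (dotp x x).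

Definition row_of_tuple (t : d.-tuple (measurableTypeR R)) : 'rV[R]_d :=
  \row_i tnth t i.

Definition cmeasurable f :=
  measurable_fun setT (fun t => complex.Re (f (row_of_tuple t)) : R) /\
  measurable_fun setT (fun t => complex.Im (f (row_of_tuple t)) : R).

Definition cintegrable f :=
  (lebesgue_tuple d).-integrable setT
    (fun t => (complex.Re (f (row_of_tuple t)))%:E) /\
  (lebesgue_tuple d).-integrable setT
    (fun t => (complex.Im (f (row_of_tuple t)))%:E).

Definition cintegral f : C :=
  (\int[lebesgue_tuple d]_t complex.Re (f (row_of_tuple t))) +i*
  (\int[lebesgue_tuple d]_t complex.Im (f (row_of_tuple t))).

Definition dir (i : 'I_d) : 'rV[R]_d := delta_mx 0 i.

Definition partial (i : 'I_d) f : 'rV[R]_d -> C := fun x =>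
  ('D_(dir i) (fun y => complex.Re (f y) : R^o) x) +i*
  ('D_(dir i) (fun y => complex.Im (f y) : R^o) x).

Definition smooth f := forall l : seq 'I_d,
  let g := foldr partial f l in
  [/\ continuous (fun x => complex.Re (g x)),
      continuous (fun x => complex.Im (g x)) &
      forall i x, derivable (fun y => complex.Re (g y) : R^o) x (dir i) /\
                  derivable (fun y => complex.Im (g y) : R^o) x (dir i)].

Definition multi_index := {ffun 'I_d -> nat}.
Implicit Types a b : multi_index.

Definition mlen a : nat := (\sum_i a i)%N.
Definition mfact a : nat := (\prod_i (a i)`!)%N.
Definition mpow x a : R := \prod_i x 0 i ^+ a i.
Definition mderiv a f : 'rV[R]_d -> C :=
  foldr (fun i g => iter (a i) (partial i) g) f (enum 'I_d).

(* Closed ball of radius [r] of the Banach space S_{s,h}. *)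
Definition gs_ball (s h r : R) : set ('rV[R]_d -> C) := [set f | smooth f /\
  forall a b x, normc ((mpow x b)%:C * mderiv a f x) <=
    r * (h ^+ (mlen a + mlen b)%N * (mfact a * mfact b)%N%:R `^ s)].

(* S_s is [gelfand_shilov s] and Sigma_s is [gelfand_shilov_proj s]. *)
Definition gelfand_shilov (s : R) : set ('rV[R]_d -> C) :=
  [set f | exists2 h, 0 < h & exists2 r, 0 < r & gs_ball s h r f].

Definition gelfand_shilov_proj (s : R) : set ('rV[R]_d -> C) :=
  [set f | forall h, 0 < h -> exists2 r, 0 < r & gs_ball s h r f].

Definition abs_convex (V : set ('rV[R]_d -> C)) := forall f g (k l : C),
  V f -> V g -> normc k + normc l <= 1 -> V (fun x => k * f x + l * g x).

(* Neighbourhoods of 0 for the locally convex inductive limit topology of S_s: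
   the finest locally convex topology making each inclusion of S_{s,h}
   continuous. *)
Definition gs_nbhs0 (s : R) (U : set ('rV[R]_d -> C)) :=
  exists V, [/\ V `<=` gelfand_shilov s, V `<=` U, abs_convex V &
    forall h, 0 < h -> exists2 r, 0 < r & gs_ball s h r `<=` V].

(* The dual S_s'. A distribution is a functional on all functions whose values
   outside S_s are irrelevant; the duality is bilinear, so the extension (f, g)
   of the L^2 product is [f (conj g)]. *)
Definition gs_dual (s : R) (u : ('rV[R]_d -> C) -> C) :=
  (forall f g (k : C), gelfand_shilov s f -> gelfand_shilov s g ->
    u (fun x => k * f x + g x) = k * u f + u g) /\
  (forall e : R, 0 < e -> gs_nbhs0 s [set f | normc (u f) < e]).

(* The element [u] of S_s' is the function [g]. *)
Definition is_function (s : R) (u : ('rV[R]_d -> C) -> C) (g : 'rV[R]_d -> C) :=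
  cmeasurable g /\ forall psi, gelfand_shilov s psi ->
    cintegrable (fun x => g x * psi x) /\
    u psi = cintegral (fun x => g x * psi x).

Definition symbol_bound (s e h c : R) f := forall a x,
  normc (mderiv a f x) <=
  c * (e ^+ mlen a * (mfact a)%:R `^ s * expR (h * enorm x `^ s^-1)).

(* The classes Gamma_{0,s}^infty and Gamma_{1,s}^infty. *)
Definition Gamma0 (s : R) : set ('rV[R]_d -> C) := [set f | smooth f /\
  exists2 h, 0 < h & forall e, 0 < e ->
    exists2 c, 0 < c & symbol_bound s e h c f].

Definition Gamma1 (s : R) : set ('rV[R]_d -> C) := [set f | smooth f /\
  exists2 h, 0 < h & exists2 e, 0 < e &
    exists2 c, 0 < c & symbol_bound s e h c f].

(* e^{it} *)
Definition cis (t : R) : C := cos t +i* sin t.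

End real_space.

Section stft.
Variables (R : realType) (d : nat).
Local Notation C := R[i].

(* A point (x, y) of R^{2d} is [row_mx x y]. *)

Definition partial_fourier (Phi : 'rV[R]_(d + d) -> C) : 'rV[R]_(d + d) -> C :=
  fun z => ((2 * pi) `^ (- (d%:R / 2)))%:C *
    cintegral (fun xi : 'rV[R]_d =>
      Phi (row_mx (lsubmx z) xi) * cis (- dotp (rsubmx z) xi)).

(* The distribution f(y) conj(phi(y - x)) in the variables (x, y). For [f] in
   S_{1/2}' and [phi] in Sigma_s, the argument of [f] is in S_{1/2} whenever
   [Psi] is, as the substitution x -> y - x shows. *)
Definition window (f : ('rV[R]_d -> C) -> C) (phi : 'rV[R]_d -> C) :
    ('rV[R]_(d + d) -> C) -> C :=
  fun Psi => f (fun y =>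
    cintegral (fun x => conjc (phi (y - x)) * Psi (row_mx x y))).

(* Fourier transform of a distribution in the second variable, by duality. *)
Definition stft (f : ('rV[R]_d -> C) -> C) (phi : 'rV[R]_d -> C) :
    ('rV[R]_(d + d) -> C) -> C :=
  fun Psi => window f phi (partial_fourier Psi).

Definition stft_bound (s h e c : R) (F : 'rV[R]_(d + d) -> C) :=
  forall x xi : 'rV[R]_d, normc (F (row_mx x xi)) <=
    c * expR (h * enorm x `^ s^-1 - e * enorm xi `^ s^-1).

End stft.

(* Main.v *)
Require Import Defs.
From HB Require Import structures.
From mathcomp Require Import all_boot all_order all_algebra.
From mathcomp Require Import all_classical all_reals all_analysis.
From mathcomp Require Import complex measurable_realfun.
From mathcomp Require Import ring lra.

Set Implicit Arguments.
Unset Strict Implicit.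
Unset Printing Implicit Defensive.

Import Order.TTheory GRing.Theory Num.Theory.
Import numFieldNormedType.Exports.
Import ComplexField.Normc.

Local Open Scope classical_set_scope.
Local Open Scope complex_scope.
Local Open Scope ring_scope.

(* If f is a function g in Gamma, then V_phi f is an absolutely convergent integral;
   n integrations by parts bound |xi_j|^n |V_phi f| by C e^n n!^s e^{h'|x|^(1/s)}, and
   optimising over n gives the decay in xi, with h' depending only on h and s.

   Conversely, take a Gaussian window chi with (chi, phi) <> 0. For psi in S_{1/2}, the
   function chi(y - x) psi(y) is the partial Fourier transform of some Psi in
   S_{1/2}(R^{2d}), and V_phi f tested against Psi equals (chi, phi) f(psi). By Fubini, f
   is then the function
     g(t) = C \int\int V_phi f(x, xi) chi(t - x) e^{i<t, xi>} dx dxi,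
   whose derivatives are estimated under the integral sign. Only the homogeneity of f is
   used, not its continuity. *)

(** * Lebesgue integration on R^n *)

(** The order of the quantifiers shapes the estimates: one h must serve for every epsilon. Growth
    e^{h|y|^{1/s}} is therefore paid for by the window alone, which decays at every rate in |y -
    x|^{1/s}. The power |.|^{1/s} being only quasi-subadditive, the new rate is (h + 1) 2^{1/s},
    where the extra 1 leaves an integrable factor. Epsilon enters only through the geometric factors
    of the factorial bounds. The hypothesis s > 1/2 acts through k!^{s - 1/2}, which dominates every
    geometric sequence: functions of S_{1/2} satisfy the estimates of Sigma_s. The other obstacle is
    that f acts on S_{1/2} while phi lies only in Sigma_s: the function of y to which f is applied
    must be shown to lie in S_{1/2}. The substitution x -> y - x frees phi from y, so that phi is
    never differentiated and only its boundedness counts. What remains is a partial Fourier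
    transform, a shear and an integration in x, each turning x_i and d/dx_i into combinations of
    such operators. Dominations use a product weight, so they pass to blocks of variables and to
    every section in Fubini's theorem. *)

Section affine_line.
Context {R : realType}.
Local Notation T := (measurableTypeR R).
Local Notation mu := (@lebesgue_measure R).
Implicit Types a b : R.

Definition affine a b : T -> T := fun x => a * x + b.

Lemma measurable_affine a b : measurable_fun setT (affine a b).
Proof.
apply: (measurable_funD (f := fun x : T => a * x) (g := cst b)) => //.
by apply: measurable_funM.
Qed.

HB.instance Definition _ a b := isMeasurableFun.Build _ _ _ _ _ (measurable_affine a b).

(** A negative slope exchanges the open and the closed end, hence two shapes of half-open
    interval. *)
Lemma affine_preimage_itv a b x y : a != 0 -> affine a b @^-1` `]x, y] =
  if 0 < a then `](x - b) / a, (y - b) / a]%classic else `[(y - b) / a, (x - b) / a[%classic.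
Proof.
move=> a0; apply/seteqP; rewrite /affine; case: ifPn => [ap|an]; split=> t /=; rewrite !in_itv/=.
- by rewrite ltr_pdivrMr// ler_pdivlMr// ltrBlDr lerBrDr (mulrC t).
- by rewrite ltr_pdivrMr// ler_pdivlMr// ltrBlDr lerBrDr (mulrC t).
- have {an}an : a < 0 by rewrite lt_neqAle a0 leNgt.
  by rewrite ltr_ndivlMr// ler_ndivrMr// ltrBlDr lerBrDr (mulrC t) andbC.
- have {an}an : a < 0 by rewrite lt_neqAle a0 leNgt.
  by rewrite ltr_ndivlMr// ler_ndivrMr// ltrBlDr lerBrDr (mulrC t) andbC.
Qed.

(** The right-hand side is a measure in A that agrees with Lebesgue measure on half-open intervals,
    so uniqueness of Lebesgue measure applies. *)
Lemma lebesgue_measure_affine a b (A : set T) : a != 0 -> measurable A ->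
  (mu A = (`|a|)%:E * mu (affine a b @^-1` A))%E.
Proof.
move=> a0 mA.
have := @lebesgue_measure_unique R (mscale (NngNum (normr_ge0 a)) (pushforward mu (affine a b))) _ A mA.
rewrite /mscale/= => -> //.
move=> _ [[x y]] _ <-; rewrite /mscale/= /pushforward affine_preimage_itv//.
have [ap|an] := ltP 0 a.
  rewrite !lebesgue_measure_itv/= !lte_fin ltr_pM2r ?invr_gt0// ltrD2r.
  case: ifP => _; last by rewrite mule0.
  rewrite -EFinD -EFinM gtr0_norm//; congr EFin; field.
  by rewrite gt_eqF.
have {}an : a < 0 by rewrite lt_neqAle a0.
rewrite !lebesgue_measure_itv/= !lte_fin ltr_nM2r ?invr_lt0// ltrD2r.
case: ifP => _; last by rewrite mule0.
rewrite -EFinD -EFinM ltr0_norm//; congr EFin; field.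
by rewrite lt_eqF.
Qed.

Lemma ge0_integral_affine a b (f : T -> \bar R) : a != 0 ->
  measurable_fun setT f -> (forall x, 0 <= f x)%E ->
  (\int[mu]_x f x = (`|a|)%:E * \int[mu]_x f (a * x + b)%R)%E.
Proof.
move=> a0 mf f0.
rewrite [RHS](_ : _ = (`|a|)%:E * \int[mu]_(x in affine a b @^-1` setT) (f \o affine a b) x)%E//.
rewrite -ge0_integral_pushforward//.
rewrite -(@ge0_integral_mscale _ _ _ _ _ _ (NngNum (normr_ge0 a)))//.
apply: eq_measure_integral => A mA _.
by rewrite /mscale/= (@lebesgue_measure_affine a b).
Qed.

End affine_line.

Section tonelli_tuple.
Context {R : realType}.
Local Notation T := (measurableTypeR R).
Local Notation mu := (@lebesgue_measure R).
Local Open Scope ereal_scope.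

Definition cat_pair m n (p : m.-tuple T * n.-tuple T) : (m + n).-tuple T :=
  [the (m + n).-tuple T of p.1 ++ p.2].

Lemma measurable_cat_pair m n : measurable_fun setT (@cat_pair m n).
Proof.
apply/measurable_fun_tnthP => i; case: (split_ordP i) => j ->.
  rewrite (_ : _ \o _ = fun p => tnth p.1 j); last first.
    by apply/funext => -[p r] /=; rewrite tnth_lshift.
  exact: (measurableT_comp (measurable_tnth j) measurable_fst).
rewrite (_ : _ \o _ = fun p => tnth p.2 j); last first.
  by apply/funext => -[p r] /=; rewrite tnth_rshift.
exact: (measurableT_comp (measurable_tnth j) measurable_snd).
Qed.

Lemma ge0_integral_cons n (u : n.+1.-tuple T -> \bar R) :
  measurable_fun setT u -> (forall t, 0 <= u t) ->
  \int[lebesgue_tuple n.+1]_t u t =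
  \int[mu]_x \int[lebesgue_tuple n]_t u (cons_pair (x, t)).
Proof.
move=> mu_ u0.
rewrite [LHS](@ge0_integral_pushforward _ _ _ _ _ _ (@measurable_cons_pair R n))//.
rewrite preimage_setT fubini_tonelli1//; last by move=> ?; exact: u0.
by apply: measurableT_comp => //; exact: measurable_cons_pair.
Qed.

Lemma measurable_integral_cat m n (u : (m + n).-tuple T -> \bar R) :
  measurable_fun setT u -> (forall t, 0 <= u t) ->
  measurable_fun setT (fun t : m.-tuple T => \int[lebesgue_tuple n]_r u (cat_pair (t, r))).
Proof.
move=> mu_ u0; apply: (@measurable_fun_fubini_tonelli_F _ _ _ _ _ (lebesgue_tuple n) (u \o @cat_pair m n)) => //; last by move=> ?; exact: u0.
by apply: measurableT_comp => //; exact: measurable_cat_pair.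
Qed.

(** Induction on m, one coordinate at a time; for m = 0 the outer integral is against the unit mass
    at the empty tuple. *)
Lemma ge0_integral_cat m n (u : (m + n).-tuple T -> \bar R) :
  measurable_fun setT u -> (forall t, 0 <= u t) ->
  \int[lebesgue_tuple (m + n)]_t u t =
  \int[lebesgue_tuple m]_t \int[lebesgue_tuple n]_r u (cat_pair (t, r)).
Proof.
elim: m u => [|m IH] u mu_ u0.
  rewrite [RHS]/= integral_dirac//; last exact: measurable_integral_cat.
  rewrite diracE in_setT mul1e; apply: eq_integral => t _; congr u.
  exact: val_inj.
rewrite (ge0_integral_cons (n := m + n)) // (ge0_integral_cons (n := m)) //; last 2 first.
- exact: measurable_integral_cat.
- by move=> t; exact: integral_ge0.
apply: eq_integral => x _; rewrite IH; last by move=> ?; exact: u0.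
  apply: eq_integral => t _; apply: eq_integral => r _; congr u.
  exact: val_inj.
apply: measurableT_comp => //.
apply: (measurableT_comp (@measurable_cons_pair R _)).
by apply: measurable_fun_pair => //; exact: measurable_cst.
Qed.

(** Concatenation carries the product of the two measures to the measure on longer tuples, which
    makes Fubini's theorem for product measures available on blocks of coordinates. *)
Lemma lebesgue_tuple_cat m n (A : set ((m + n).-tuple T)) : measurable A ->
  lebesgue_tuple (m + n) A =
  (lebesgue_tuple m \x lebesgue_tuple n)%E (@cat_pair m n @^-1` A).
Proof.
move=> mA.
have mA' : measurable (@cat_pair m n @^-1` A).
  by rewrite -[X in measurable X]setTI; exact: measurable_cat_pair.
rewrite -(setIT A) -integral_indic// ge0_integral_cat//; last first.
  by apply/measurable_EFinP; exact: measurable_indic.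
rewrite setIT -(setIT (_ @^-1` _)) -integral_indic// fubini_tonelli1//.
  by apply/measurable_EFinP; exact: measurable_indic.
Qed.

End tonelli_tuple.

Section tuple_measure.
Context {R : realType}.
Local Notation T := (measurableTypeR R).
Local Notation mu := (@lebesgue_measure R).
Local Open Scope ereal_scope.

Definition affine_tuple n (a : R) (b : 'I_n -> R) (t : n.-tuple T) : n.-tuple T :=
  [tuple (a * tnth t i + b i)%R | i < n].

Lemma measurable_affine_tuple n a (b : 'I_n -> R) :
  measurable_fun setT (affine_tuple a b).
Proof.
apply/measurable_fun_tnthP => i.
rewrite (_ : _ \o _ = affine a (b i) \o (@tnth _ T)^~ i).
  exact: (measurableT_comp (measurable_affine a (b i)) (measurable_tnth i)).
by apply/funext => t; rewrite /= tnth_mktuple.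
Qed.

Lemma affine_tuple_cons n a (b : 'I_n.+1 -> R) x t :
  affine_tuple a b (cons_pair (x, t)) =
  cons_pair (affine a (b ord0) x, affine_tuple a (fun i => b (lift ord0 i)) t).
Proof.
apply: eq_from_tnth => i; rewrite tnth_mktuple.
case: (unliftP ord0 i) => [j ->|->]; last by rewrite !tnth0.
by rewrite /cons_pair/= !tnthS tnth_mktuple.
Qed.

Lemma measurable_section_cons n (u : n.+1.-tuple T -> \bar R) x :
  measurable_fun setT u -> measurable_fun setT (fun t => u (cons_pair (x, t))).
Proof.
move=> mu_; apply: measurableT_comp => //.
apply: (measurableT_comp (@measurable_cons_pair R _)).
by apply: measurable_fun_pair => //; exact: measurable_cst.
Qed.

(** Each coordinate contributes one factor |a| by the change of variable on the line. The absolute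
    value lets one statement serve for dilations and for the reflection x -> y - x. *)
Lemma ge0_integral_affine_tuple n a (b : 'I_n -> R) (u : n.-tuple T -> \bar R) :
  a != 0%R -> measurable_fun setT u -> (forall t, 0 <= u t) ->
  \int[lebesgue_tuple n]_t u t =
  (`|a| ^+ n)%:E * \int[lebesgue_tuple n]_t u (affine_tuple a b t).
Proof.
move=> a0; elim: n b u => [|n IH] b u mu_ u0.
  rewrite expr0 mul1e; apply: eq_integral => t _; congr u.
  by rewrite [t]tuple0 [RHS]tuple0.
rewrite ge0_integral_cons // (ge0_integral_cons (u := u \o affine_tuple a b)) //; last 2 first.
- by apply: measurableT_comp => //; exact: measurable_affine_tuple.
- by move=> t; exact: u0.
under [in RHS]eq_integral do under eq_integral do rewrite /= affine_tuple_cons.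
have mS x : measurable_fun setT (fun t => u (cons_pair (x, t))).
  exact: measurable_section_cons.
pose G x := \int[lebesgue_tuple n]_t u (cons_pair (x, affine_tuple a (fun i => b (lift ord0 i)) t)).
have mG : measurable_fun setT G.
  apply: (@measurable_fun_fubini_tonelli_F _ _ _ _ _ (lebesgue_tuple n)
    (fun p => u (cons_pair (p.1, affine_tuple a (fun i => b (lift ord0 i)) p.2)))) => [|p]; last exact: u0.
  apply: (measurableT_comp mu_); apply: (measurableT_comp (@measurable_cons_pair R n)).
  apply: measurable_fun_pair; first exact: measurable_fst.
  exact: (measurableT_comp (measurable_affine_tuple a (fun i => b (lift ord0 i))) measurable_snd).
have GE x : \int[lebesgue_tuple n]_t u (cons_pair (x, t)) = (`|a| ^+ n)%:E * G x.
  by rewrite /G -(IH (fun i => b (lift ord0 i)) (fun t => u (cons_pair (x, t)))).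
have G0 x : 0 <= G x by exact: integral_ge0.
transitivity ((`|a| ^+ n.+1)%:E * \int[mu]_x G (affine a (b ord0) x)); last by [].
transitivity (\int[mu]_x ((`|a| ^+ n)%:E * G x)).
  by apply: eq_integral => x _; exact: GE.
clearbody G; rewrite ge0_integralZl//.
rewrite (ge0_integral_affine (b ord0) a0 mG G0).
by rewrite muleA -EFinM -exprSr.
Qed.

End tuple_measure.

Section weight.
Context {R : realType}.
Local Notation T := (measurableTypeR R).
Local Notation mu := (@lebesgue_measure R).

(* The integrable majorant in which dominations on R^n are expressed. *)
Definition weight n (x : 'rV[R]_n) : R := \prod_i (1 + x 0 i ^+ 2)^-1.

Lemma onesqr_gt0 (t : R) : 0 < 1 + t ^+ 2.
Proof. by rewrite ltr_pwDl// sqr_ge0. Qed.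

Lemma weight_gt0 n (x : 'rV[R]_n) : 0 < weight x.
Proof. by apply: prodr_gt0 => i _; rewrite invr_gt0 onesqr_gt0. Qed.

Lemma weight_ge0 n (x : 'rV[R]_n) : 0 <= weight x.
Proof. exact/ltW/weight_gt0. Qed.

Lemma onesqrV_le1 (t : R) : (1 + t ^+ 2)^-1 <= 1.
Proof. by rewrite invf_le1 ?onesqr_gt0// lerDl sqr_ge0. Qed.

Lemma weight_le1 n (x : 'rV[R]_n) : weight x <= 1.
Proof.
by apply: prodr_ile1 => i _; rewrite invr_ge0 (ltW (onesqr_gt0 _)) onesqrV_le1.
Qed.

Lemma weight_row_mx m n (x : 'rV[R]_m) (y : 'rV[R]_n) :
  weight (row_mx x y) = weight x * weight y.
Proof.
rewrite /weight big_split_ord/=; congr (_ * _); apply: eq_bigr => i _.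
  by rewrite row_mxEl.
by rewrite row_mxEr.
Qed.

Lemma row_of_tuple_cat m n (t : m.-tuple T) (r : n.-tuple T) :
  row_of_tuple (cat_pair (t, r)) = row_mx (row_of_tuple t) (row_of_tuple r).
Proof.
apply/rowP => i; rewrite mxE; case: (split_ordP i) => j ->.
  by rewrite row_mxEl mxE tnth_lshift.
by rewrite row_mxEr mxE tnth_rshift.
Qed.

Lemma measurable_coord n (i : 'I_n) :
  measurable_fun setT (fun t : n.-tuple T => row_of_tuple t 0 i : R).
Proof.
rewrite (_ : (fun t => _) = (@tnth _ T)^~ i); first exact: measurable_tnth.
by apply/funext => t; rewrite mxE.
Qed.

Lemma measurable_prod d (X : measurableType d) (I : Type) (s : seq I) (f : I -> X -> R) :
  (forall i, measurable_fun setT (f i)) -> measurable_fun setT (fun x => \prod_(i <- s) f i x).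
Proof.
move=> mf; elim: s => [|i s IH].
  by under eq_fun do rewrite big_nil; exact: measurable_cst.
by under eq_fun do rewrite big_cons; exact: measurable_funM.
Qed.

Lemma measurable_onesqrV : measurable_fun setT (fun x : T => (1 + x ^+ 2)^-1 : R).
Proof. by apply: continuous_measurable_fun; exact: continuous_oneDsqrV. Qed.

Lemma measurable_weight n : measurable_fun setT (fun t : n.-tuple T => weight (row_of_tuple t)).
Proof.
apply: measurable_prod => i.
exact: (measurableT_comp measurable_onesqrV (measurable_coord i)).
Qed.

Lemma weight_cons n x (t : n.-tuple T) :
  weight (row_of_tuple (cons_pair (x, t))) = (1 + x ^+ 2)^-1 * weight (row_of_tuple t).
Proof.
rewrite /weight big_ord_recl mxE tnth0; congr (_ * _).
by apply: eq_bigr => i _; rewrite !mxE tnthS.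
Qed.

Lemma integral_onesqrV_lty : (\int[mu]_x ((1 + x ^+ 2)^-1)%:E < +oo)%E.
Proof.
rewrite ge0_symfun_integralT//=.
- rewrite (_ : [set x | _] = `[0, +oo[%classic); last first.
    by apply/seteqP; split => x/=; rewrite in_itv/= andbT.
  by rewrite [X in (_ * X)%E]integral0y_oneDsqr -EFinM ltry.
- by move=> x; rewrite invr_ge0 ltW// onesqr_gt0.
- exact: continuous_oneDsqrV.
- by move=> x/=; rewrite sqrrN.
Qed.

Lemma weight_integral_lty n :
  (\int[lebesgue_tuple n]_t (weight (row_of_tuple t))%:E < +oo)%E.
Proof.
elim: n => [|n IH].
  rewrite integral_dirac//; last by apply/measurable_EFinP; exact: measurable_weight.
  by rewrite diracE in_setT mul1e ltry.
rewrite ge0_integral_cons; last 2 first.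
- by apply/measurable_EFinP; exact: measurable_weight.
- by move=> t; rewrite lee_fin weight_ge0.
set K := (\int[lebesgue_tuple n]_t (weight (row_of_tuple t))%:E)%E in IH.
have K0 : (0 <= K)%E by apply: integral_ge0 => t _; rewrite lee_fin weight_ge0.
have e x : (\int[lebesgue_tuple n]_t (weight (row_of_tuple (cons_pair (x, t))))%:E =
    ((1 + x ^+ 2)^-1)%:E * K)%E.
  under eq_integral do rewrite weight_cons EFinM.
  rewrite ge0_integralZl//.
  - by apply/measurable_EFinP; exact: measurable_weight.
  - by move=> t _; rewrite lee_fin weight_ge0.
  - by rewrite lee_fin invr_ge0 ltW// onesqr_gt0.
under eq_integral do rewrite e.
rewrite ge0_integralZr//; last 2 first.
- by apply/measurable_EFinP; exact: measurable_onesqrV.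
- by move=> x _; rewrite lee_fin invr_ge0 ltW// onesqr_gt0.
have i0 : (0 <= \int[mu]_x ((1 + x ^+ 2)^-1)%:E)%E.
  by apply: integral_ge0 => x _; rewrite lee_fin invr_ge0 ltW// onesqr_gt0.
rewrite -(@fineK _ K) ?ge0_fin_numE// -(@fineK _ (\int[mu]_x _)%E); last first.
  by rewrite ge0_fin_numE// integral_onesqrV_lty.
by rewrite -EFinM ltry.
Qed.

Lemma integrable_weight n :
  (lebesgue_tuple n).-integrable setT (fun t => (weight (row_of_tuple t))%:E).
Proof.
apply/integrableP; split; first by apply/measurable_EFinP; exact: measurable_weight.
under eq_integral do rewrite gee0_abs ?lee_fin ?weight_ge0//.
exact: weight_integral_lty.
Qed.

End weight.

Section real_integral.
Context {R : realType}.
Local Notation T := (measurableTypeR R).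

Definition rmeas n (u : 'rV[R]_n -> R) :=
  measurable_fun setT (fun t : n.-tuple T => u (row_of_tuple t) : R).

Definition rint n (u : 'rV[R]_n -> R) : R :=
  \int[lebesgue_tuple n]_t u (row_of_tuple t).

Definition rintegrable n (u : 'rV[R]_n -> R) :=
  (lebesgue_tuple n).-integrable setT (fun t => (u (row_of_tuple t))%:E).

Lemma dominated_rintegrable n (u : 'rV[R]_n -> R) c : rmeas u ->
  (forall x, `|u x| <= c * weight x) -> rintegrable u.
Proof.
move=> mu_ uc.
apply: (le_integrable measurableT (g := fun t => (c%:E * (weight (row_of_tuple t))%:E)%E)).
- exact/measurable_EFinP.
- by move=> t _ /=; rewrite lee_fin (le_trans (uc _))// ler_norm.
- by apply: integrableZl => //; exact: integrable_weight.
Qed.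

Lemma rint_dominated n (u : 'rV[R]_n -> R) c : rmeas u ->
  (forall x, `|u x| <= c * weight x) -> `|rint u| <= c * rint (@weight R n).
Proof.
move=> mu_ uc; have iu := dominated_rintegrable mu_ uc.
rewrite /rint -RintegralZl//; last exact: integrable_weight.
apply: le_trans (le_normr_Rintegral _ _) _ => //.
apply: le_Rintegral => //.
- exact: integrable_norm iu.
- exact: (integrableZl measurableT c (integrable_weight n)).
Qed.

Lemma rint_ge0 n (u : 'rV[R]_n -> R) : (forall x, 0 <= u x) -> 0 <= rint u.
Proof. by move=> u0; apply: Rintegral_ge0. Qed.

Lemma rintD n (u v : 'rV[R]_n -> R) : rintegrable u -> rintegrable v ->
  rint (fun x => u x + v x) = rint u + rint v.
Proof. by move=> iu iv; exact: RintegralD. Qed.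

Lemma rintB n (u v : 'rV[R]_n -> R) : rintegrable u -> rintegrable v ->
  rint (fun x => u x - v x) = rint u - rint v.
Proof. by move=> iu iv; exact: RintegralB. Qed.

Lemma rintZ n (u : 'rV[R]_n -> R) k : rintegrable u ->
  rint (fun x => k * u x) = k * rint u.
Proof. by move=> iu; exact: RintegralZl. Qed.

Section fubini.
Variables (m n : nat) (u : 'rV[R]_(m + n) -> R) (c : R).
Hypotheses (mu_ : rmeas u) (uc : forall z, `|u z| <= c * weight z).

Let f (p : m.-tuple T * n.-tuple T) := (u (row_mx (row_of_tuple p.1) (row_of_tuple p.2)))%:E.

Let fE p : f p = (u (row_of_tuple (cat_pair p)))%:E.
Proof. by case: p => t r; rewrite row_of_tuple_cat. Qed.

Let mf : measurable_fun setT f.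
Proof.
rewrite (_ : f = (fun t => (u (row_of_tuple t))%:E) \o @cat_pair R m n); last by apply/funext => p; rewrite fE.
by apply: measurableT_comp; [exact/measurable_EFinP|exact: measurable_cat_pair].
Qed.

Let intf : (lebesgue_tuple m \x lebesgue_tuple n)%E.-integrable setT f.
Proof.
apply/integrable12ltyP => //=.
have /integrableP[_] := dominated_rintegrable mu_ uc.
rewrite ge0_integral_cat; last by move=> t; exact: abse_ge0.
  2: by apply: measurableT_comp => //; exact/measurable_EFinP.
under eq_integral do under eq_integral do rewrite -fE; exact.
Qed.

(** The weight factors over the two blocks, so every section is integrable, not almost every one,
    and the iterated integrals involve no null sets. *)
Let sec1 (t : m.-tuple T) : rintegrable (fun y => u (row_mx (row_of_tuple t) y)).
Proof.
apply: (@dominated_rintegrable _ _ (c * weight (row_of_tuple t))).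
  by apply/measurable_EFinP; exact: (measurableT_comp mf (measurable_fun_pair (measurable_cst t) (@measurable_id _ _ setT))).
by move=> y; rewrite -mulrA -weight_row_mx.
Qed.

Let sec2 (r : n.-tuple T) : rintegrable (fun x => u (row_mx x (row_of_tuple r))).
Proof.
apply: (@dominated_rintegrable _ _ (c * weight (row_of_tuple r))).
  by apply/measurable_EFinP; exact: (measurableT_comp mf (measurable_fun_pair (@measurable_id _ _ setT) (measurable_cst r))).
by move=> x; rewrite -mulrA [weight _ * _]mulrC -weight_row_mx.
Qed.

Let rintE : (rint u)%:E = (\int[(lebesgue_tuple m \x lebesgue_tuple n)%E]_p f p)%E.
Proof.
have iu := dominated_rintegrable mu_ uc.
rewrite /rint /Rintegral fineK; last exact: integrable_fin_num.
under [RHS]eq_integral do rewrite fE.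
rewrite -[RHS](@integral_pushforward _ _ _ _ _ _ (@measurable_cat_pair R m n) _ setT (fun t => (u (row_of_tuple t))%:E))//; last 2 first.
- exact/measurable_EFinP.
- by rewrite preimage_setT; apply: eq_integrable intf => // p _; rewrite fE.
apply: eq_measure_integral; first exact: measurable_cat_pair.
by move=> mphi A mA _; exact: lebesgue_tuple_cat.
Qed.

Lemma rmeas_rint1 : rmeas (fun x => rint (fun y => u (row_mx x y))).
Proof.
apply: (measurableT_comp (f := fine)); first exact: fine_measurable.
exact: measurable_fubini_F intf.
Qed.

Lemma rmeas_rint2 : rmeas (fun y => rint (fun x => u (row_mx x y))).
Proof.
apply: (measurableT_comp (f := fine)); first exact: fine_measurable.
exact: measurable_fubini_G intf.
Qed.

Lemma rint_fubini1 : rint u = rint (fun x => rint (fun y => u (row_mx x y))).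
Proof.
apply: EFin_inj; rewrite rintE -(integral12_prod_meas1 intf).
rewrite [in RHS]/rint [in RHS]/Rintegral fineK.
  apply: eq_integral => t _; rewrite /rint /Rintegral fineK//.
  exact: integrable_fin_num (sec1 t).
rewrite (_ : (fun t => _) = fubini_F (lebesgue_tuple n) f).
  by apply: integrable_fin_num => //; exact: integrable_fubini_F.
apply/funext => t; rewrite /rint /Rintegral fineK//.
exact: integrable_fin_num (sec1 t).
Qed.

Lemma rint_fubini2 : rint u = rint (fun y => rint (fun x => u (row_mx x y))).
Proof.
apply: EFin_inj; rewrite rintE -(integral21_prod_meas1 intf).
have e t : (rint (fun x => u (row_mx x (row_of_tuple t))))%:E = fubini_G (lebesgue_tuple m) f t.
  by rewrite /rint /Rintegral fineK//; exact: integrable_fin_num (sec2 t).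
rewrite [in RHS]/rint [in RHS]/Rintegral fineK.
  by apply: eq_integral => t _; rewrite e.
under eq_integral do rewrite e.
by rewrite (integral21_prod_meas1 intf) integrable_fin_num.
Qed.

End fubini.

Lemma rint_affine n (a : R) (b : 'rV[R]_n) (u : 'rV[R]_n -> R) : a != 0 ->
  rintegrable u -> rint u = `|a| ^+ n * rint (fun x => u (a *: x + b)).
Proof.
move=> a0 iu.
have mu_ : measurable_fun setT (fun t : n.-tuple T => (u (row_of_tuple t))%:E) by apply: measurable_int iu.
pose b' := fun i => b 0 i.
have rowE t : row_of_tuple (affine_tuple a b' t) = a *: row_of_tuple t + b.
  by apply/rowP => i; rewrite !mxE tnth_mktuple.
have an0 : 0 < `|a| ^+ n by rewrite exprn_gt0// normr_gt0.
pose f t := (u (row_of_tuple t))%:E.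
have cpos (g : n.-tuple T -> \bar R) : measurable_fun setT g -> (forall t, 0 <= g t)%E ->
  (\int[lebesgue_tuple n]_t g (affine_tuple a b' t) =
  ((`|a| ^+ n)^-1)%:E * \int[lebesgue_tuple n]_t g t)%E.
  move=> mg g0; rewrite (ge0_integral_affine_tuple b' a0 mg g0).
  by rewrite muleA -EFinM mulVf ?mul1e// gt_eqF.
have ip := integrable_fin_num measurableT (integrable_funepos measurableT iu).
have im := integrable_fin_num measurableT (integrable_funeneg measurableT iu).
have E : (\int[lebesgue_tuple n]_t f (affine_tuple a b' t) = ((`|a| ^+ n)^-1)%:E * \int[lebesgue_tuple n]_t f t)%E.
  rewrite [LHS]integralE [in RHS]integralE.
  rewrite (_ : (fun t => f (affine_tuple a b' t)) = f \o affine_tuple a b')//.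
  under [X in (X - _)%E]eq_integral do rewrite funepos_comp/=.
  under [X in (_ - X)%E]eq_integral do rewrite funeneg_comp/=.
  rewrite (cpos _ (measurable_funepos mu_)) ?(cpos _ (measurable_funeneg mu_)); last 2 first.
  - by move=> t; exact: funeneg_ge0.
  - by move=> t; exact: funepos_ge0.
  by apply/esym/muleBr => //; apply: fin_num_adde_defl; rewrite fin_numN.
rewrite /rint /Rintegral; under [in RHS]eq_integral do rewrite -rowE.
rewrite [X in _ * fine X]E fineM//; last exact: integrable_fin_num.
by rewrite mulrA divff ?mul1r// gt_eqF.
Qed.

End real_integral.

Section measurability.
Context {R : realType}.
Local Notation T := (measurableTypeR R).

(** The sigma-algebra on tuples is generated by the coordinates, while continuity refers to the sup
    norm. An open set is the union of those boxes with rational centre and radius 1/(k + 1) that it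
    contains, and these are countably many. *)
Lemma open_row_measurable n (U : set 'rV[R]_n) : open U ->
  measurable ((@row_of_tuple R n) @^-1` U).
Proof.
move=> oU.
pose box (p : n.-tuple rat * nat) : set 'rV[R]_n :=
  [set x | forall i, `|ratr (tnth p.1 i) - x 0 i| < p.2.+1%:R^-1].
pose F p : set (n.-tuple T) :=
  if asbool (box p `<=` U) then (@row_of_tuple R n) @^-1` box p else set0.
rewrite (_ : _ @^-1` U = \bigcup_p F p).
  apply: countable_bigcupT_measurable; first exact: countableP.
  move=> p; rewrite /F; case: ifPn => // _.
  rewrite (_ : _ @^-1` _ = \bigcap_(i in [set: 'I_n])
     ((fun t : n.-tuple T => `|ratr (tnth p.1 i) - row_of_tuple t 0 i|) @^-1` `]-oo, p.2.+1%:R^-1[)); last first.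
    apply/seteqP; split=> [t /= tp|t].
      by move=> i _ /=; rewrite in_itv/=; exact: tp.
    by move=> h i; have := h i I; rewrite /= in_itv.
  apply: fin_bigcap_measurable => // i _.
  rewrite -[X in measurable X]setTI; apply: (_ : measurable_fun setT _) => //.
  apply: measurableT_comp => //; apply: measurable_funB => //.
  exact: measurable_coord.
apply/seteqP; split=> [t Ut|t [p _]]; last first.
  by rewrite /F; case: ifPn => // /asboolP h /h.
have /nbhs_ballP[e /= e0 eU] := open_nbhs_nbhs (conj oU Ut).
(* Two radii have to fit into e: from the point to the rational centre, and from there to any other
   point of the box. *)
pose k := Num.trunc (2 / e).
have ke : 2 * k.+1%:R^-1 < e.
  by rewrite ltr_pdivrMr// mulrC -ltr_pdivrMr// truncnS_gt.
have /choice[c cP] (i : 'I_n) : exists c : rat, `|ratr c - row_of_tuple t 0 i| < k.+1%:R^-1.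
  have [|c] := @rat_in_itvoo R (row_of_tuple t 0 i - k.+1%:R^-1) (row_of_tuple t 0 i + k.+1%:R^-1).
    by rewrite ltrD2l gtrN// invr_gt0.
  by rewrite in_itv/= => h; exists c; rewrite ltr_distl.
exists ([tuple c i | i < n], k) => //.
rewrite /F ifT; first by move=> i /=; rewrite tnth_mktuple.
apply/asboolP => x bx; apply: eU; split => // i j.
rewrite (ord1 i); have := bx j; rewrite /= tnth_mktuple => h.
rewrite /ball/= (le_lt_trans _ ke)//.
rewrite (le_trans (ler_distD (ratr (c j)) _ _))// mulr2n mulrDl mul1r lerD//.
  by rewrite distrC ltW.
by rewrite ltW.
Qed.

Lemma continuous_rmeas n (u : 'rV[R]_n -> R) : continuous u -> rmeas u.
Proof.
move=> /continuousP cu; apply: (measurability _ (RGenOpens.measurableE R)).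
move=> _ [_ [a [b ->] <-]]; rewrite setTI.
apply: (open_row_measurable (U := u @^-1` `]a, b[)).
by apply: cu; exact: interval_open.
Qed.

Lemma rmeas_comp m n (u : 'rV[R]_m -> R) (a : 'rV[R]_n -> 'rV[R]_m) :
  rmeas u -> (forall i, rmeas (fun x => a x 0 i)) -> rmeas (fun x => u (a x)).
Proof.
move=> mu_ ma; rewrite /rmeas.
pose A (t : n.-tuple (measurableTypeR R)) : m.-tuple (measurableTypeR R) := [tuple a (row_of_tuple t) 0 i | i < m].
rewrite (_ : (fun t => _) = (fun t => u (row_of_tuple t)) \o A); last first.
  by apply/funext => t /=; congr u; apply/rowP => i; rewrite mxE tnth_mktuple.
apply: (measurableT_comp mu_); apply/measurable_fun_tnthP => i.
rewrite (_ : _ \o _ = fun t => a (row_of_tuple t) 0 i); first exact: ma.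
by apply/funext => t /=; rewrite tnth_mktuple.
Qed.

End measurability.

Section complex_norm.
Context {R : realType}.
Local Notation C := R[i].
Implicit Types z w : C.

Lemma normc_ge0 z : 0 <= normc z.
Proof. by case: z => a b; exact: sqrtr_ge0. Qed.

Lemma ler_normc_Re z : `|complex.Re z| <= normc z.
Proof. by case: z => a b /=; rewrite -sqrtr_sqr ler_sqrt ?addr_ge0 ?sqr_ge0// lerDl sqr_ge0. Qed.

Lemma ler_normc_Im z : `|complex.Im z| <= normc z.
Proof. by case: z => a b /=; rewrite -sqrtr_sqr ler_sqrt ?addr_ge0 ?sqr_ge0// lerDr sqr_ge0. Qed.

Lemma normc_real (a : R) : normc a%:C = `|a|.
Proof. by rewrite /= expr0n addr0 sqrtr_sqr. Qed.

Lemma normc_imag (a : R) : normc (0 +i* a) = `|a|.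
Proof. by rewrite /= expr0n add0r sqrtr_sqr. Qed.

Lemma normc_le_ReIm z : normc z <= `|complex.Re z| + `|complex.Im z|.
Proof.
rewrite [X in normc X <= _](_ : _ = (complex.Re z)%:C + (0 +i* complex.Im z)).
  by rewrite (le_trans (le_normcD _ _))// normc_real normc_imag.
by case: z => a b; simpc.
Qed.

Lemma normc_conj z : normc (conjc z) = normc z.
Proof. by case: z => a b /=; rewrite sqrrN. Qed.

Lemma normc_cis (t : R) : normc (cis t) = 1.
Proof. by rewrite /= cos2Dsin2 sqrtr1. Qed.

Lemma cisD (s t : R) : cis (s + t) = cis s * cis t.
Proof. by rewrite /cis cosD sinD; simpc; rewrite addrC [X in _ +i* X]addrC. Qed.

Lemma cis0 : cis (0 : R) = 1.
Proof. by rewrite /cis cos0 sin0. Qed.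

Lemma ReM z w : complex.Re (z * w) = complex.Re z * complex.Re w - complex.Im z * complex.Im w.
Proof. by case: z w => a b [c e]; simpc. Qed.

Lemma ImM z w : complex.Im (z * w) = complex.Re z * complex.Im w + complex.Im z * complex.Re w.
Proof. by case: z w => a b [c e]; simpc. Qed.

Lemma ReD z w : complex.Re (z + w) = complex.Re z + complex.Re w.
Proof. by case: z w => a b [c e]. Qed.

Lemma ImD z w : complex.Im (z + w) = complex.Im z + complex.Im w.
Proof. by case: z w => a b [c e]. Qed.

Lemma ReIm_inj z w : complex.Re z = complex.Re w -> complex.Im z = complex.Im w -> z = w.
Proof. by case: z w => a b [c e] /= -> ->. Qed.

End complex_norm.

(** * Complex-valued integrals and their dominations *)

Section complex_integral.
Context {R : realType}.
Local Notation C := R[i].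

Lemma cintegralE n (u : 'rV[R]_n -> C) : cintegral u =
  rint (fun x => complex.Re (u x)) +i* rint (fun x => complex.Im (u x)).
Proof. by []. Qed.

Lemma cmeasurable_cst n (k : C) : cmeasurable (fun _ : 'rV[R]_n => k).
Proof. by split; exact: measurable_cst. Qed.

Lemma cmeasurableD n (u v : 'rV[R]_n -> C) : cmeasurable u -> cmeasurable v ->
  cmeasurable (fun x => u x + v x).
Proof.
move=> [u1 u2] [v1 v2]; split.
  by under eq_fun do rewrite ReD; exact: measurable_funD.
by under eq_fun do rewrite ImD; exact: measurable_funD.
Qed.

Lemma cmeasurableM n (u v : 'rV[R]_n -> C) : cmeasurable u -> cmeasurable v ->
  cmeasurable (fun x => u x * v x).
Proof.
move=> [u1 u2] [v1 v2]; split.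
  by under eq_fun do rewrite ReM; apply: measurable_funB; exact: measurable_funM.
by under eq_fun do rewrite ImM; apply: measurable_funD; exact: measurable_funM.
Qed.

Lemma cmeasurable_conj n (u : 'rV[R]_n -> C) : cmeasurable u ->
  cmeasurable (fun x => conjc (u x)).
Proof.
have eR z : complex.Re (conjc z) = complex.Re z :> R by case: z.
have eI z : complex.Im (conjc z) = - complex.Im z :> R by case: z.
move=> [u1 u2]; split; first by under eq_fun do rewrite eR.
by under eq_fun do rewrite eI; exact: measurable_funN.
Qed.

Definition ccontinuous n (u : 'rV[R]_n -> C) :=
  continuous (fun x => complex.Re (u x)) /\ continuous (fun x => complex.Im (u x)).

Lemma ccontinuous_cmeasurable n (u : 'rV[R]_n -> C) : ccontinuous u -> cmeasurable u.
Proof. by move=> [u1 u2]; split; [exact: (continuous_rmeas u1)|exact: (continuous_rmeas u2)]. Qed.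

Lemma cmeasurable_comp m n (u : 'rV[R]_m -> C) (a : 'rV[R]_n -> 'rV[R]_m) :
  cmeasurable u -> (forall i, rmeas (fun x => a x 0 i)) -> cmeasurable (fun x => u (a x)).
Proof.
move=> [u1 u2] ma; split.
  exact: (@rmeas_comp _ _ _ (fun x => complex.Re (u x)) a).
exact: (@rmeas_comp _ _ _ (fun x => complex.Im (u x)) a).
Qed.

Lemma ccontinuous_cmeasurable_comp m n (u : 'rV[R]_m -> C) (a : 'rV[R]_n -> 'rV[R]_m) :
  ccontinuous u -> (forall i, rmeas (fun x => a x 0 i)) ->
  cmeasurable (fun x => u (a x)).
Proof. by move=> /ccontinuous_cmeasurable; exact: cmeasurable_comp. Qed.

Lemma rmeas_coord n (i : 'I_n) : rmeas (fun x : 'rV[R]_n => x 0 i).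
Proof. exact: measurable_coord. Qed.

Lemma rmeasD n (u v : 'rV[R]_n -> R) : rmeas u -> rmeas v -> rmeas (fun x => u x + v x).
Proof. exact: measurable_funD. Qed.

Lemma rmeasB n (u v : 'rV[R]_n -> R) : rmeas u -> rmeas v -> rmeas (fun x => u x - v x).
Proof. exact: measurable_funB. Qed.

Lemma rmeasM n (u v : 'rV[R]_n -> R) : rmeas u -> rmeas v -> rmeas (fun x => u x * v x).
Proof. exact: measurable_funM. Qed.

Lemma rmeas_cst n (k : R) : rmeas (fun _ : 'rV[R]_n => k).
Proof. exact: measurable_cst. Qed.

Lemma rmeas_dotp n m (a b : 'rV[R]_n -> 'rV[R]_m) :
  (forall i, rmeas (fun x => a x 0 i)) -> (forall i, rmeas (fun x => b x 0 i)) ->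
  rmeas (fun x => dotp (a x) (b x)).
Proof. by move=> ma mb; apply: measurable_sum => i; exact: (rmeasM (ma i) (mb i)). Qed.

Lemma cmeasurable_cis n (u : 'rV[R]_n -> R) : rmeas u -> cmeasurable (fun x => cis (u x)).
Proof.
move=> mu_; split.
  by apply: measurableT_comp mu_; apply: continuous_measurable_fun; exact: continuous_cos.
by apply: measurableT_comp mu_; apply: continuous_measurable_fun; exact: continuous_sin.
Qed.

(** The constant is explicit because it bounds the integral, and because later estimates record how
    it depends on the parameters of the integrand. *)
Definition cdom n (u : 'rV[R]_n -> C) (c : R) :=
  cmeasurable u /\ forall x, normc (u x) <= c * weight x.

(* The factor 2 comes from bounding the modulus by |Re| + |Im|. *)
Definition wint n : R := 2 * rint (@weight R n).

Lemma wint_ge0 n : 0 <= wint n.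
Proof. apply: mulr_ge0; first exact: ler0n. by apply: rint_ge0 => x; exact: weight_ge0. Qed.

Lemma cdom_Re n (u : 'rV[R]_n -> C) c : cdom u c -> rmeas (fun x => complex.Re (u x)) /\
  forall x, `|complex.Re (u x)| <= c * weight x.
Proof. by move=> [[mu_ _] uc]; split=> // x; exact: le_trans (ler_normc_Re _) _. Qed.

Lemma cdom_Im n (u : 'rV[R]_n -> C) c : cdom u c -> rmeas (fun x => complex.Im (u x)) /\
  forall x, `|complex.Im (u x)| <= c * weight x.
Proof. by move=> [[_ mu_] uc]; split=> // x; exact: le_trans (ler_normc_Im _) _. Qed.

Lemma cdom_integrable n (u : 'rV[R]_n -> C) c : cdom u c -> cintegrable u.
Proof.
move=> du; split.
  by have [m b] := cdom_Re du; exact: dominated_rintegrable b.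
by have [m b] := cdom_Im du; exact: dominated_rintegrable b.
Qed.

Lemma normc_cintegral n (u : 'rV[R]_n -> C) c : cdom u c ->
  normc (cintegral u) <= c * wint n.
Proof.
move=> du; rewrite cintegralE (le_trans (normc_le_ReIm _))//=.
rewrite /wint mulrCA mulr_natl mulr2n lerD//.
  by have [m b] := cdom_Re du; exact: rint_dominated b.
by have [m b] := cdom_Im du; exact: rint_dominated b.
Qed.

Lemma cdomW n (u : 'rV[R]_n -> C) c c' : c <= c' -> cdom u c -> cdom u c'.
Proof.
move=> cc [mu_ uc]; split=> // x; rewrite (le_trans (uc x))//.
by rewrite ler_wpM2r ?weight_ge0.
Qed.

Lemma cdomD n (u v : 'rV[R]_n -> C) c e : cdom u c -> cdom v e ->
  cdom (fun x => u x + v x) (c + e).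
Proof.
move=> [mu_ uc] [mv ve]; split; first exact: cmeasurableD.
by move=> x; rewrite (le_trans (le_normcD _ _))// mulrDl lerD.
Qed.

Lemma cdomM n (k u : 'rV[R]_n -> C) c e : 0 <= e -> cdom u c -> cmeasurable k ->
  (forall x, normc (k x) <= e) -> cdom (fun x => k x * u x) (e * c).
Proof.
move=> e0 [mu_ uc] mk ke; split; first exact: cmeasurableM.
move=> x; rewrite normcM -mulrA ler_pM ?normc_ge0//.
Qed.

Lemma cdomZ n (k : C) (u : 'rV[R]_n -> C) c : cdom u c -> cdom (fun x => k * u x) (normc k * c).
Proof. by move=> du; exact: (cdomM (normc_ge0 k) du (cmeasurable_cst n k)). Qed.

Lemma cdom_cis n (u : 'rV[R]_n -> C) (a : 'rV[R]_n -> R) c : rmeas a -> cdom u c ->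
  cdom (fun x => u x * cis (a x)) c.
Proof.
move=> ma [mu_ uc]; split; first by apply: cmeasurableM => //; exact: cmeasurable_cis.
by move=> x; rewrite normcM normc_cis mulr1.
Qed.

Lemma eq_cintegral n (u v : 'rV[R]_n -> C) : u =1 v -> cintegral u = cintegral v.
Proof. by move=> uv; congr cintegral; exact/funext. Qed.

Lemma cintegralD n (u v : 'rV[R]_n -> C) : cintegrable u -> cintegrable v ->
  cintegral (fun x => u x + v x) = cintegral u + cintegral v.
Proof.
move=> [u1 u2] [v1 v2]; rewrite !cintegralE; apply: ReIm_inj => /=.
  by rewrite -(rintD u1 v1); congr rint; apply/funext => x; rewrite ReD.
by rewrite -(rintD u2 v2); congr rint; apply/funext => x; rewrite ImD.
Qed.

Lemma rintegrableZ n (u : 'rV[R]_n -> R) k : rintegrable u -> rintegrable (fun x => k * u x).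
Proof. by move=> iu; exact: (integrableZl measurableT k iu). Qed.

Lemma cintegralZ n (u : 'rV[R]_n -> C) k : cintegrable u ->
  cintegral (fun x => k * u x) = k * cintegral u.
Proof.
move=> [u1 u2]; rewrite !cintegralE; apply: ReIm_inj; rewrite ?ReM ?ImM/=.
  rewrite -!rintZ// -rintB; [|exact: rintegrableZ..].
  by congr rint; apply/funext => x; rewrite ReM.
rewrite -!rintZ// -rintD; [|exact: rintegrableZ..].
by congr rint; apply/funext => x; rewrite ImM.
Qed.

Lemma cintegral_affine n (a : R) (b : 'rV[R]_n) (u : 'rV[R]_n -> C) : a != 0 ->
  cintegrable u -> cintegral u = (`|a| ^+ n)%:C * cintegral (fun x => u (a *: x + b)).
Proof.
move=> a0 [u1 u2]; rewrite !cintegralE; apply: ReIm_inj; rewrite ?ReM ?ImM/= mul0r.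
  by rewrite subr0; exact: rint_affine.
by rewrite addr0; exact: rint_affine.
Qed.

Section fubini.
Variables (m n : nat) (u : 'rV[R]_(m + n) -> C) (c : R).
Hypothesis du : cdom u c.

Lemma cmeasurable_cintegral1 : cmeasurable (fun x => cintegral (fun y => u (row_mx x y))).
Proof.
have [m1 b1] := cdom_Re du; have [m2 b2] := cdom_Im du.
by split; [exact: rmeas_rint1 b1|exact: rmeas_rint1 b2].
Qed.

Lemma cmeasurable_cintegral2 : cmeasurable (fun y => cintegral (fun x => u (row_mx x y))).
Proof.
have [m1 b1] := cdom_Re du; have [m2 b2] := cdom_Im du.
by split; [exact: rmeas_rint2 b1|exact: rmeas_rint2 b2].
Qed.

Lemma cintegral_fubini1 : cintegral u = cintegral (fun x => cintegral (fun y => u (row_mx x y))).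
Proof.
have [m1 b1] := cdom_Re du; have [m2 b2] := cdom_Im du.
by rewrite cintegralE (rint_fubini1 m1 b1) (rint_fubini1 m2 b2).
Qed.

Lemma cintegral_fubini2 : cintegral u = cintegral (fun y => cintegral (fun x => u (row_mx x y))).
Proof.
have [m1 b1] := cdom_Re du; have [m2 b2] := cdom_Im du.
by rewrite cintegralE (rint_fubini2 m1 b1) (rint_fubini2 m2 b2).
Qed.

End fubini.

End complex_integral.

(** * Partial derivatives and smooth functions *)

Section real_partial.
Context {R : realType}.

Definition rpart n (i : 'I_n) (u : 'rV[R]_n -> R) (x : 'rV[R]_n) (l : R) :=
  is_derive x (dir R i) (u : 'rV[R]_n -> R^o) (l : R^o).

(** Restricting to a line turns a partial derivative into a derivative in one real variable, where
    the mean value theorem and the chain rule are available. *)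
Lemma rpart_line n (i : 'I_n) (u : 'rV[R]_n -> R) x t l :
  rpart i u (x + t *: dir R i) l <-> is_derive t (1 : R) (fun s => u (x + s *: dir R i) : R) l.
Proof.
have E : (fun h : R => h^-1 *: ((u : 'rV[R]_n -> R^o) (h *: dir R i + (x + t *: dir R i)) - u (x + t *: dir R i))) =
         (fun h : R => h^-1 *: (u (x + (h *: (1:R) + t) *: dir R i) - u (x + t *: dir R i) : R)).
  apply/funext => h; congr (_ *: (u _ - _)).
  by rewrite [h *: 1]mulr1 scalerDl addrCA.
split=> -[h1 h2]; split.
- by rewrite /derivable; rewrite /derivable E in h1; exact: h1.
- by rewrite /derive in h2 *; rewrite E in h2; exact: h2.
- by rewrite /derivable E; rewrite /derivable in h1; exact: h1.
- by rewrite /derive in h2 *; rewrite E; exact: h2.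
Qed.

Lemma rpart_val n (i : 'I_n) (u : 'rV[R]_n -> R) x l :
  rpart i u x l -> 'D_(dir R i) (u : 'rV[R]_n -> R^o) x = l.
Proof. by move=> h; exact: derive_val. Qed.

Lemma rpartD n (i : 'I_n) (u v : 'rV[R]_n -> R) x a b :
  rpart i u x a -> rpart i v x b -> rpart i (fun x => u x + v x) x (a + b).
Proof. by move=> hu hv; exact: (is_deriveD hu hv). Qed.

Lemma rpartN n (i : 'I_n) (u : 'rV[R]_n -> R) x a :
  rpart i u x a -> rpart i (fun x => - u x) x (- a).
Proof. by move=> hu; exact: (is_deriveN hu). Qed.

Lemma rpartB n (i : 'I_n) (u v : 'rV[R]_n -> R) x a b :
  rpart i u x a -> rpart i v x b -> rpart i (fun x => u x - v x) x (a - b).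
Proof. by move=> hu hv; exact: (is_deriveB hu hv). Qed.

Lemma rpartM n (i : 'I_n) (u v : 'rV[R]_n -> R) x a b :
  rpart i u x a -> rpart i v x b -> rpart i (fun x => u x * v x) x (u x * b + v x * a).
Proof. by move=> hu hv; exact: (is_deriveM hu hv). Qed.

Lemma rpart_cst n (i : 'I_n) (k : R) x : rpart i (fun _ => k) x 0.
Proof. exact: is_derive_cst. Qed.

Lemma MVT_line (F dF : R -> R) a b : a <= b -> (forall t, is_derive t (1 : R) F (dF t)) ->
  exists2 t, a <= t <= b & F b - F a = dF t * (b - a).
Proof.
move=> ab hF.
have [|t tab ->] := @MVT_segment R F dF a b ab (fun x _ => hF x).
  by apply: derivable_within_continuous => t _; case: (hF t).
by exists t => //; move: tab; rewrite in_itv.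
Qed.

(** The two inequalities place t between 0 and s, whatever the sign of s. *)
Lemma rpart_mvt n (i : 'I_n) (u g : 'rV[R]_n -> R) x (s : R) :
  (forall z, rpart i u z (g z)) ->
  exists2 t, `|t| <= `|s| /\ `|s - t| <= `|s| & u (x + s *: dir R i) - u x = g (x + t *: dir R i) * s.
Proof.
move=> hu.
have hF t : is_derive t (1 : R) (fun t => u (x + t *: dir R i) : R) (g (x + t *: dir R i)).
  exact/rpart_line.
have [s0|s0] := leP 0 s.
  have [t /andP[t1 t2]] := MVT_line s0 hF.
  rewrite scale0r addr0 subr0 => E; exists t => //.
  by rewrite !ger0_norm ?subr_ge0//; split=> //; rewrite gerBl.
have [t /andP[t1 t2]] := MVT_line (ltW s0) hF.
rewrite scale0r addr0 sub0r mulrN => /eqP; rewrite -[X in X == _]opprB eqr_opp => /eqP E.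
exists t => //.
by rewrite !ler0_norm ?(ltW s0)//; [split; lra|lra].
Qed.

(** The path from x to y changes one coordinate at a time and stays in the box they span; the mean
    value theorem is applied on each edge. [mix s] is the corner with the coordinates of y on s and
    those of x elsewhere. *)
Lemma lipschitz_box n (u : 'rV[R]_n -> R) (g : 'I_n -> 'rV[R]_n -> R)
    (x y : 'rV[R]_n) (L : R) :
  (forall i z, rpart i u z (g i z)) ->
  (forall i (z : 'rV[R]_n), (forall j, `|z 0 j - x 0 j| <= `|y 0 j - x 0 j|) -> `|g i z| <= L) ->
  `|u y - u x| <= L * \sum_i `|y 0 i - x 0 i|.
Proof.
move=> hu gL.
pose mix (s : seq 'I_n) := \row_j (if j \in s then y 0 j else x 0 j).
have key s : uniq s -> `|u (mix s) - u x| <= L * \sum_(i <- s) `|y 0 i - x 0 i|.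
  elim: s => [_|i s IH].
    rewrite big_nil mulr0 (_ : mix [::] = x) ?subrr ?normr0//.
    by apply/rowP => j; rewrite mxE.
  move=> /= /andP[si us].
  have [t [t1 t2] E] := @rpart_mvt n i u (g i) (mix s) (y 0 i - x 0 i) (hu i).
  have mixE : mix (i :: s) = mix s + (y 0 i - x 0 i) *: dir R i.
    apply/rowP => j; rewrite !mxE /= inE; have [->|ji] := eqVneq j i => /=.
      by rewrite (negbTE si) mulr1 addrC subrK.
    by rewrite mulr0 addr0.
  rewrite big_cons mulrDr (le_trans (ler_distD (u (mix s)) _ _))// lerD//; last exact: IH.
  rewrite mixE E normrM ler_wpM2r//; apply: gL => j.
  rewrite !mxE /=; have [->|ji] := eqVneq j i.
    by rewrite (negbTE si) mulr1 addrAC subrr add0r.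
  by rewrite mulr0 addr0; case: ifP => //; rewrite subrr normr0.
have := key (index_enum 'I_n) (index_enum_uniq _).
rewrite (_ : mix _ = y)//; apply/rowP => j; rewrite mxE mem_index_enum//.
Qed.

Definition locbdd n (u : 'rV[R]_n -> R) := forall x : 'rV[R]_n, exists L : R, forall y : 'rV[R]_n,
  (forall j, `|y 0 j - x 0 j| <= 1) -> `|u y| <= L.

(** Bounded partial derivatives make u locally Lipschitz. Continuity of a function, and of all its
    derivatives, is thus obtained from bounds alone. *)
Lemma locbdd_partials_continuous n (u : 'rV[R]_n -> R) (g : 'I_n -> 'rV[R]_n -> R) :
  (forall i z, rpart i u z (g i z)) -> (forall i, locbdd (g i)) -> continuous u.
Proof.
move=> hu gb x.
have /choice[L LP] i := gb i x.
pose M := \sum_i `|L i| + 1.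
have LM i : L i <= M.
  rewrite (le_trans (ler_norm _))// /M (bigD1 i)//= -addrA lerDl addr_ge0// sumr_ge0//.
have M0 : 0 < M by rewrite ltr_pwDr// sumr_ge0.
apply/(@cvgrPdist_lt R R^o 'rV[R]_n (nbhs (x : 'rV[R]_n)) _ u (u x)) => e e0.
(* Moving each coordinate by less than r changes u by at most M n r, which is below e because n < n
   + 1, also for n = 0. The minimum with 1 stays in the box where the bounds hold. *)
pose r := Num.min 1 (e / (M * n.+1%:R)).
have r0 : 0 < r by rewrite lt_min ltr01 divr_gt0// mulr_gt0.
near=> y.
have yx j : `|y 0 j - x 0 j| < r.
  have : ball x r y by near: y; exact: nbhsx_ballx.
  by case=> _ /(_ 0 j); rewrite /ball/= distrC.
rewrite distrC (le_lt_trans (lipschitz_box (L := M) hu _))//.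
  move=> i z hz; rewrite (le_trans (LP i z _))// => j.
  by rewrite (le_trans (hz j))// (le_trans (ltW (yx j)))// /r ge_min lexx.
have : \sum_i `|y 0 i - x 0 i| <= n%:R * (e / (M * n.+1%:R)).
  rewrite -[n in n%:R]card_ord -sumr_const mulr_suml ler_sum// => i _.
  by rewrite mul1r (le_trans (ltW (yx i)))// /r ge_min lexx orbT.
move=> h; rewrite (le_lt_trans (ler_wpM2l (ltW M0) h))//.
have n10 : (n.+1%:R : R) != 0 by rewrite pnatr_eq0.
have -> : M * (n%:R * (e / (M * n.+1%:R))) = e * (n%:R / n.+1%:R).
  by rewrite invfM; field; rewrite ?(gt_eqF M0) ?n10 ?(addrC 1) ?natr1 ?pnatr_eq0.
by rewrite gtr_pMr// ltr_pdivrMr// mul1r ltr_nat.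
Unshelve. all: end_near. Qed.

Lemma rpart_zero_const n (u : 'rV[R]_n -> R) :
  (forall i z, rpart i u z 0) -> forall x y, u x = u y.
Proof.
move=> hu x y; apply/eqP; rewrite -subr_eq0 -normr_le0.
have := @lipschitz_box n u (fun _ _ => 0) y x 0 hu; rewrite mul0r; apply.
by move=> *; rewrite normr0.
Qed.

(** The second difference over a square of side h equals uij p h^2 for some p near x and also uji q
    h^2 for some q near x. If the two mixed derivatives differed at x, continuity would separate
    these values for small h. *)
Lemma clairaut n (i j : 'I_n) (u ui uj uij uji : 'rV[R]_n -> R) :
  (forall z, rpart i u z (ui z)) -> (forall z, rpart j u z (uj z)) ->
  (forall z, rpart j ui z (uij z)) -> (forall z, rpart i uj z (uji z)) ->
  continuous uij -> continuous uji -> uij =1 uji.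
Proof.
move=> hui huj huij huji cij cji x; apply/eqP; rewrite -subr_eq0; apply/negPn/negP => ne.
pose e := `|uij x - uji x| / 2.
have e0 : 0 < e by rewrite divr_gt0// normr_gt0.
have /(@cvgrPdist_lt R R^o 'rV[R]_n (nbhs x) _ uij (uij x))/(_ _ e0)/nbhs_ballP[r1 /= r10 h1] := cij x.
have /(@cvgrPdist_lt R R^o 'rV[R]_n (nbhs x) _ uji (uji x))/(_ _ e0)/nbhs_ballP[r2 /= r20 h2] := cji x.
(* A third, so that 2 h is still below both radii: the displacements in the two directions add up
   when i = j. *)
pose h := Num.min r1 r2 / 3.
have h0 : 0 < h by rewrite divr_gt0// lt_min r10.
have hr1 : h + h < r1.
  have : Num.min r1 r2 <= r1 by rewrite ge_min lexx.
  by move: h0; rewrite /h; lra.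
have hr2 : h + h < r2.
  have : Num.min r1 r2 <= r2 by rewrite ge_min lexx orbT.
  by move: h0; rewrite /h; lra.
have shift k (v v' : 'rV[R]_n -> R) a : (forall z, rpart k v z (v' z)) ->
    forall z, rpart k (fun z => v (z + a) - v z) z (v' (z + a) - v' z).
  move=> hv z; apply: rpartB; last exact: hv.
  have /rpart_line := hv (z + a + 0 *: dir R k) => hl.
  have := (rpart_line k (fun z => v (z + a)) z 0 (v' (z + a))).2.
  rewrite scale0r addr0; apply.
  rewrite scale0r addr0 in hl.
  by rewrite (_ : (fun s => _) = (fun s => v (z + a + s *: dir R k)))//; apply/funext => s; rewrite addrAC.
(* Mean value theorem in direction k for the difference in direction l, then in direction l for the
   derivative. *)
have step (k l : 'I_n) (v vk vkl : 'rV[R]_n -> R) : (forall z, rpart k v z (vk z)) ->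
    (forall z, rpart l vk z (vkl z)) -> exists2 p : 'rV[R]_n, (forall m, `|x 0 m - p 0 m| <= h + h) &
    v (x + h *: dir R k + h *: dir R l) - v (x + h *: dir R k) - (v (x + h *: dir R l) - v x) =
    vkl p * h * h.
  move=> hk hl.
  have [t [t1 _] /= E] := rpart_mvt x h (shift k v vk (h *: dir R l) hk).
  have [t' [t1' _] E'] := rpart_mvt (x + t *: dir R k) h hl.
  exists (x + t *: dir R k + t' *: dir R l).
    move=> m; rewrite !mxE /= (_ : _ - _ = - (t * (m == k)%:R + t' * (m == l)%:R)); last by ring.
    rewrite (gtr0_norm h0) in t1 t1'.
    rewrite normrN (le_trans (ler_normD _ _))//.
    have b (b : bool) (s : R) : `|s| <= h -> `|s * b%:R| <= h.
      by case: b => sh; rewrite ?mulr1// mulr0 normr0 ltW.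
    by rewrite lerD// b.
  by rewrite E E'.
have [p hp Ep] := step i j u ui uij hui huij.
have [q hq Eq] := step j i u uj uji huj huji.
have Epq : uij p = uji q.
  apply: (mulIf (x := h)); first by rewrite gt_eqF.
  apply: (mulIf (x := h)); first by rewrite gt_eqF.
  rewrite -Ep -Eq (addrAC x); ring.
have : `|uij x - uij p| < e.
  apply: h1; split=> // a b; rewrite (ord1 a) /ball/=.
  exact: le_lt_trans (hp b) hr1.
have : `|uji x - uji q| < e.
  apply: h2; split=> // a b; rewrite (ord1 a) /ball/=.
  exact: le_lt_trans (hq b) hr2.
rewrite -Epq => B A.
have : `|uij x - uji x| < e + e.
  by rewrite (le_lt_trans (ler_distD (uij p) _ _))// (distrC _ (uji x)) ltrD.
by rewrite /e -splitr ltxx.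
Qed.

End real_partial.

Section complex_partial.
Context {R : realType}.
Local Notation C := R[i].

(** A relational form of [partial]: it carries differentiability together with the value, which the
    total operator does not. *)
Definition has_partial n (i : 'I_n) (f : 'rV[R]_n -> C) (x : 'rV[R]_n) (l : C) :=
  rpart i (fun y => complex.Re (f y)) x (complex.Re l) /\
  rpart i (fun y => complex.Im (f y)) x (complex.Im l).

Lemma has_partialE n (i : 'I_n) (f g : 'rV[R]_n -> C) :
  (forall x, has_partial i f x (g x)) -> partial i f = g.
Proof.
move=> fg; apply/funext => x; have [h1 h2] := fg x.
by apply: ReIm_inj; [exact: rpart_val h1|exact: rpart_val h2].
Qed.

Lemma has_partial_eq n (i : 'I_n) (f : 'rV[R]_n -> C) x l l' :
  l = l' -> has_partial i f x l -> has_partial i f x l'.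
Proof. by move=> ->. Qed.

Lemma has_partial_unique n (i : 'I_n) (f : 'rV[R]_n -> C) x l l' :
  has_partial i f x l -> has_partial i f x l' -> l = l'.
Proof.
move=> [h1 h2] [k1 k2].
by apply: ReIm_inj; [rewrite -(rpart_val h1) (rpart_val k1)|rewrite -(rpart_val h2) (rpart_val k2)].
Qed.

Lemma has_partialD n (i : 'I_n) (f g : 'rV[R]_n -> C) x a b :
  has_partial i f x a -> has_partial i g x b ->
  has_partial i (fun x => f x + g x) x (a + b).
Proof.
move=> [f1 f2] [g1 g2]; split.
  by under eq_fun do rewrite ReD; rewrite ReD; exact: rpartD.
by under eq_fun do rewrite ImD; rewrite ImD; exact: rpartD.
Qed.

Lemma rpart_eq n (i : 'I_n) (u : 'rV[R]_n -> R) x l l' :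
  l = l' -> rpart i u x l -> rpart i u x l'.
Proof. by move=> ->. Qed.

Lemma has_partialM n (i : 'I_n) (f g : 'rV[R]_n -> C) x a b :
  has_partial i f x a -> has_partial i g x b ->
  has_partial i (fun x => f x * g x) x (a * g x + f x * b).
Proof.
move=> [f1 f2] [g1 g2]; split.
  under eq_fun do rewrite ReM.
  apply: rpart_eq (rpartB (rpartM f1 g1) (rpartM f2 g2)).
  by rewrite ReD !ReM; ring.
under eq_fun do rewrite ImM.
apply: rpart_eq (rpartD (rpartM f1 g2) (rpartM f2 g1)).
by rewrite ImD !ImM; ring.
Qed.

Lemma has_partial_cst n (i : 'I_n) (k : C) x : has_partial i (fun _ : 'rV[R]_n => k) x 0.
Proof. by split; exact: rpart_cst. Qed.

Lemma has_partialZ n (i : 'I_n) (k : C) (f : 'rV[R]_n -> C) x a :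
  has_partial i f x a -> has_partial i (fun x => k * f x) x (k * a).
Proof.
move=> hf; apply: has_partial_eq (has_partialM (has_partial_cst i k x) hf).
by rewrite mul0r add0r.
Qed.

Lemma has_partial_conj n (i : 'I_n) (f : 'rV[R]_n -> C) x a :
  has_partial i f x a -> has_partial i (fun x => conjc (f x)) x (conjc a).
Proof.
have eR (z : C) : complex.Re (conjc z) = complex.Re z :> R by case: z.
have eI (z : C) : complex.Im (conjc z) = - complex.Im z :> R by case: z.
move=> [f1 f2]; split; first by under eq_fun do rewrite eR; rewrite eR.
by under eq_fun do rewrite eI; rewrite eI; exact: rpartN.
Qed.

Lemma has_partial_real n (i : 'I_n) (u : 'rV[R]_n -> R) x l :
  rpart i u x l -> has_partial i (fun x => (u x)%:C) x l%:C.
Proof. by move=> h; split => //; exact: rpart_cst. Qed.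

Lemma is_derive_mull (k t : R) : is_derive t (1 : R) (fun s : R => k * s) k.
Proof.
have := @is_deriveZ R R^o R^o (id : R -> R) k t 1 1 (is_derive_id _ _).
by rewrite [k *: 1]mulr1.
Qed.

Lemma rpart_coord n (i j : 'I_n) (x : 'rV[R]_n) : rpart i (fun x : 'rV[R]_n => x 0 j) x (i == j)%:R.
Proof.
have := (rpart_line i (fun x : 'rV[R]_n => x 0 j) x 0 (i == j)%:R).2.
rewrite scale0r addr0; apply.
rewrite (_ : (fun s => _) = (fun s : R => x 0 j + (i == j)%:R * s)); last first.
  by apply/funext => s; rewrite !mxE eq_sym mulrC.
have := @is_deriveD R R^o R^o (cst (x 0 j)) (fun s : R => (i == j)%:R * s) 0 1 0 (i == j)%:R (is_derive_cst _ _ _).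
by rewrite add0r; apply; exact: is_derive_mull.
Qed.

Lemma rpart_comp1 n (i : 'I_n) (u : 'rV[R]_n -> R) (F : R -> R) x a b :
  is_derive (u x) (1 : R) F b -> rpart i u x a -> rpart i (fun x => F (u x)) x (b * a).
Proof.
move=> hF hu.
have := (rpart_line i (fun x : 'rV[R]_n => F (u x)) x 0 (b * a)).2.
rewrite scale0r addr0; apply.
have := (rpart_line i u x 0 a).1; rewrite scale0r addr0 => /(_ hu) hl.
have := @is_derive1_comp R F (fun s => u (x + s *: dir R i)) 0 b a.
by apply; rewrite ?scale0r ?addr0//.
Qed.

Lemma has_partial_cis n (i : 'I_n) (u : 'rV[R]_n -> R) x a :
  rpart i u x a -> has_partial i (fun x => cis (u x)) x ((0 +i* a) * cis (u x)).
Proof.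
move=> hu; split.
  apply: rpart_eq (rpart_comp1 (is_derive_cos (u x)) hu).
  by rewrite ReM /=; ring.
apply: rpart_eq (rpart_comp1 (is_derive_sin (u x)) hu).
by rewrite ImM /=; ring.
Qed.

Lemma rpart_sum n (i : 'I_n) I (s : seq I) (u : I -> 'rV[R]_n -> R) l x :
  (forall k, rpart i (u k) x (l k)) ->
  rpart i (fun x => \sum_(k <- s) u k x) x (\sum_(k <- s) l k).
Proof.
move=> h; elim: s => [|k s IH].
  by under eq_fun do rewrite big_nil; rewrite big_nil; exact: rpart_cst.
by under eq_fun do rewrite big_cons; rewrite big_cons; exact: rpartD.
Qed.

Lemma rpart_dotp n (i : 'I_n) (y x : 'rV[R]_n) : rpart i (fun x => dotp x y) x (y 0 i).
Proof.
apply: rpart_eq (rpart_sum _ (l := fun j => (i == j)%:R * y 0 j) _).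
  rewrite (bigD1 i)//= eqxx mul1r big1 ?addr0// => j ji.
  by rewrite eq_sym (negbTE ji) mul0r.
move=> j; apply: rpart_eq (rpartM (rpart_coord i j x) (rpart_cst i (y 0 j) x)).
by rewrite mulr0 add0r mulrC.
Qed.

(** The inner map sends the line in direction i to the line in direction j at speed k, so the chain
    rule in one variable suffices and no total differential appears. *)
Lemma rpart_chain m n (i : 'I_n) (j : 'I_m) (L : 'rV[R]_n -> 'rV[R]_m) k
    (u : 'rV[R]_m -> R) z l :
  (forall s, L (z + s *: dir R i) = L z + (k * s) *: dir R j) ->
  rpart j u (L z) l -> rpart i (fun z => u (L z)) z (k * l).
Proof.
move=> hL hu.
have := (rpart_line i (fun z => u (L z)) z 0 (k * l)).2.
rewrite scale0r addr0; apply.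
under eq_fun do rewrite hL.
have := (rpart_line j u (L z) 0 l).1; rewrite scale0r addr0 => /(_ hu) hl.
rewrite mulrC.
have := @is_derive1_comp R (fun s => u (L z + s *: dir R j)) (fun s => k * s) 0 l k.
by apply; [rewrite mulr0|exact: is_derive_mull].
Qed.

Lemma has_partial_chain m n (i : 'I_n) (j : 'I_m) (L : 'rV[R]_n -> 'rV[R]_m) k
    (f : 'rV[R]_m -> C) z l :
  (forall s, L (z + s *: dir R i) = L z + (k * s) *: dir R j) ->
  has_partial j f (L z) l -> has_partial i (fun z => f (L z)) z (k%:C * l).
Proof.
move=> hL [f1 f2]; split.
  by apply: rpart_eq (rpart_chain hL f1); rewrite ReM /= mul0r subr0.
by apply: rpart_eq (rpart_chain hL f2); rewrite ImM /= mul0r addr0.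
Qed.

Lemma rpart_chain0 m n (i : 'I_n) (L : 'rV[R]_n -> 'rV[R]_m) (u : 'rV[R]_m -> R) z :
  (forall s, L (z + s *: dir R i) = L z) -> rpart i (fun z => u (L z)) z 0.
Proof.
move=> hL; have := (rpart_line i (fun z => u (L z)) z 0 0).2.
rewrite scale0r addr0; apply; under eq_fun do rewrite hL.
exact: is_derive_cst.
Qed.

Lemma has_partial_chain0 m n (i : 'I_n) (L : 'rV[R]_n -> 'rV[R]_m) (f : 'rV[R]_m -> C) z :
  (forall s, L (z + s *: dir R i) = L z) -> has_partial i (fun z => f (L z)) z 0.
Proof. by move=> hL; split; [exact: (rpart_chain0 (fun z => complex.Re (f z)) hL)|exact: (rpart_chain0 (fun z => complex.Im (f z)) hL)]. Qed.

(** The inner map moves along two axes at once, as a shear does. The increment is split into a step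
    along j, which is a derivative on a line, and a step along k. *)
Lemma rpart_chain2 m n (i : 'I_n) (j k : 'I_m) (L : 'rV[R]_n -> 'rV[R]_m)
    (u uj uk : 'rV[R]_m -> R) z :
  (forall s, L (z + s *: dir R i) = L z + s *: dir R j + s *: dir R k) ->
  (forall z, rpart j u z (uj z)) -> (forall z, rpart k u z (uk z)) -> continuous uk ->
  rpart i (fun z => u (L z)) z (uj (L z) + uk (L z)).
Proof.
move=> hL hj hk ck.
have := (rpart_line i (fun z => u (L z)) z 0 (uj (L z) + uk (L z))).2.
rewrite scale0r addr0; apply; under eq_fun do rewrite hL.
have := (rpart_line j u (L z) 0 (uj (L z))).1.
rewrite scale0r addr0 => /(_ (hj _)) hl.
(* The step along k starts from a base point that moves with s. The mean value theorem evaluates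
   [uk] at a point within 2 |h| of L z in each coordinate, and continuity of [uk] gives the
   limit. *)
have hd : is_derive (0 : R) (1 : R)
    (fun s : R => u (L z + s *: dir R j + s *: dir R k) - u (L z + s *: dir R j) : R) (uk (L z)).
  suff cv : h^-1 *: ((u (L z + h *: dir R j + h *: dir R k) - u (L z + h *: dir R j)) : R^o)
      @[h --> (0:R)^'] --> (uk (L z) : R^o).
    have E : (fun h : R => h^-1 *: (((fun s : R => u (L z + s *: dir R j + s *: dir R k) - u (L z + s *: dir R j) : R^o)
         \o shift 0) (h *: (1 : R)) - (u (L z + 0 *: dir R j + 0 *: dir R k) - u (L z + 0 *: dir R j)) : R^o)) =
      (fun h : R => h^-1 *: ((u (L z + h *: dir R j + h *: dir R k) - u (L z + h *: dir R j)) : R^o)).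
      by apply/funext => h /=; rewrite !scale0r !addr0 subrr subr0 [h *: 1]mulr1.
    split; first by apply/cvg_ex; exists (uk (L z)); rewrite E.
    by rewrite /derive E; apply/cvg_lim.
  apply/(@cvgrPdist_lt R R^o) => e e0.
  have /(@cvgrPdist_lt R R^o 'rV[R]_m (nbhs (L z)) _ uk (uk (L z)))/(_ _ e0)/nbhs_ballP[r /= r0 hr] := ck (L z).
  near=> h.
  have h0 : h != 0 by near: h; exact: nbhs_dnbhs_neq.
  have hr2 : `|h| < r / 2.
    near: h; apply: dnbhs0_lt; exact: divr_gt0.
  have [t [t1 _] ->] := rpart_mvt (L z + h *: dir R j) h hk.
  rewrite (_ : _ *: _ = uk (L z + h *: dir R j + t *: dir R k)); last first.
    by rewrite [_ *: _]mulrCA mulVf// mulr1.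
  apply: hr; split => // a b; rewrite (ord1 a) /ball/= !mxE/= -!addrA opprD addrA subrr add0r normrN.
  have bb (c : bool) (s : R) : `|s| <= `|h| -> `|s * c%:R| <= `|h|.
    by case: c => sh; rewrite ?mulr1// mulr0 normr0.
  rewrite (le_lt_trans (ler_normD _ _))// [ltRHS]splitr ltr_leD//.
    exact: le_lt_trans (bb _ _ (lexx _)) hr2.
  exact: le_trans (bb _ _ t1) (ltW hr2).
have := is_deriveD hl hd.
rewrite (_ : _ + _ = (fun x0 => u (L z + x0 *: dir R j + x0 *: dir R k)))//.
by apply/funext => s; rewrite /= [LHS]addrC subrK.
Unshelve. all: end_near. Qed.

Lemma has_partial_chain2 m n (i : 'I_n) (j k : 'I_m) (L : 'rV[R]_n -> 'rV[R]_m)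
    (f fj fk : 'rV[R]_m -> C) z :
  (forall s, L (z + s *: dir R i) = L z + s *: dir R j + s *: dir R k) ->
  (forall z, has_partial j f z (fj z)) -> (forall z, has_partial k f z (fk z)) -> ccontinuous fk ->
  has_partial i (fun z => f (L z)) z (fj (L z) + fk (L z)).
Proof.
move=> hL hj hk [c1 c2]; split; [rewrite ReD|rewrite ImD].
  exact: (rpart_chain2 hL (fun y => (hj y).1) (fun y => (hk y).1) c1).
exact: (rpart_chain2 hL (fun y => (hj y).2) (fun y => (hk y).2) c2).
Qed.

End complex_partial.

(** * Differentiation under the integral sign and integration by parts *)

Section under_integral.
Context {R : realType}.
Local Notation C := R[i].

(** The parameter runs over ]-1, 1[ on the line through x in direction i, so the dominations are
    required only there; a bound that is locally uniform in x is enough. *)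
Lemma rpart_rint m n (i : 'I_m) (u u' : 'rV[R]_m -> 'rV[R]_n -> R) x c :
  (forall x, rmeas (u x)) ->
  (forall x y, rpart i (u^~ y) x (u' x y)) ->
  (forall t y, `|t| < 1 -> `|u (x + t *: dir R i) y| <= c * weight y) ->
  (forall t y, `|t| < 1 -> `|u' (x + t *: dir R i) y| <= c * weight y) ->
  rpart i (fun x => rint (u x)) x (rint (u' x)).
Proof.
move=> mu_ hu uc uc'.
have := (rpart_line i (fun x => rint (u x)) x 0 (rint (u' x))).2.
rewrite scale0r addr0; apply.
pose f (s : R) (t : n.-tuple (measurableTypeR R)) := u (x + s *: dir R i) (row_of_tuple t).
pose G (t : n.-tuple (measurableTypeR R)) := c * weight (row_of_tuple t).
have I0 : [set` `]-1, 1[] (0 : R) by rewrite /= in_itv/= oppr_lt0 ltr01.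
have It (t : R) : [set` `]-1, 1[] t -> `|t| < 1 by rewrite /= in_itv/= -ltr_norml.
have intf (s : R) : [set` `]-1, 1[] s -> (lebesgue_tuple n).-integrable setT (EFin \o f s).
  by move=> /It s1; apply: (dominated_rintegrable (mu_ _)) => y; exact: uc.
have df s t : is_derive (s : R) (1 : R) (f ^~ t : R -> R^o) (u' (x + s *: dir R i) (row_of_tuple t)).
  by have /rpart_line := hu (x + s *: dir R i) (row_of_tuple t); exact.
have derf s t : [set` `]-1, 1[] s -> setT t -> derivable (f ^~ t) (s : R) 1.
  by move=> _ _; case: (df s t).
have d1 s t : partial1of2 f s t = u' (x + s *: dir R i) (row_of_tuple t).
  by rewrite partial1of2E; case: (df s t).
have G0 t : 0 <= G t.
  apply: le_trans (uc 0 (row_of_tuple t) _); first exact: normr_ge0.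
  by rewrite normr0 ltr01.
have iG : (lebesgue_tuple n).-integrable setT (EFin \o G).
  exact: (rintegrableZ c (integrable_weight n)).
have Gub s t : [set` `]-1, 1[] s -> setT t -> `|partial1of2 f s t| <= G t.
  by move=> /It s1 _; rewrite d1; exact: uc'.
split; first exact: (derivable_under_integral measurableT I0 intf derf G0 iG Gub).
have := differentiation_under_integral measurableT I0 intf derf G0 iG Gub.
rewrite derive1E => ->.
rewrite /rint; apply: eq_Rintegral => t _.
by rewrite d1 scale0r addr0.
Qed.

Lemma has_partial_cintegral m n (i : 'I_m) (u u' : 'rV[R]_m -> 'rV[R]_n -> C) x c :
  (forall x, cmeasurable (u x)) ->
  (forall x y, has_partial i (u^~ y) x (u' x y)) ->
  (forall t y, `|t| < 1 -> normc (u (x + t *: dir R i) y) <= c * weight y) ->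
  (forall t y, `|t| < 1 -> normc (u' (x + t *: dir R i) y) <= c * weight y) ->
  has_partial i (fun x => cintegral (u x)) x (cintegral (u' x)).
Proof.
move=> mu_ hu uc uc'; split.
  apply: (rpart_rint (u := fun x y => complex.Re (u x y)) (u' := fun x y => complex.Re (u' x y)) (c := c)).
  - by move=> z; have [] := mu_ z.
  - by move=> z y; have [] := hu z y.
  - by move=> t y t1; rewrite (le_trans (ler_normc_Re _))// uc.
  - by move=> t y t1; rewrite (le_trans (ler_normc_Re _))// uc'.
apply: (rpart_rint (u := fun x y => complex.Im (u x y)) (u' := fun x y => complex.Im (u' x y)) (c := c)).
- by move=> z; have [] := mu_ z.
- by move=> z y; have [] := hu z y.
- by move=> t y t1; rewrite (le_trans (ler_normc_Im _))// uc.
- by move=> t y t1; rewrite (le_trans (ler_normc_Im _))// uc'.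
Qed.

(** From y^2 <= 2 (y + t)^2 + 2 t^2 and t^2 <= 1, which give 1 + y^2 <= 3 (1 + (y + t)^2). *)
Lemma weight_shift n (i : 'I_n) (y : 'rV[R]_n) t : `|t| <= 1 ->
  weight (y + t *: dir R i) <= 3 * weight y.
Proof.
move=> t1; rewrite /weight (bigD1 i)//= [X in _ <= 3 * X](bigD1 i)//= mulrA.
rewrite [X in _ * X <= _](eq_bigr (fun j => (1 + y 0 j ^+ 2)^-1)); last first.
  by move=> j ji; rewrite !mxE/= (negbTE ji) mulr0 addr0.
apply: ler_wpM2r; first by apply: prodr_ge0 => j _; rewrite invr_ge0 ltW// onesqr_gt0.
rewrite !mxE /= eqxx mulr1 ler_pdivlMr ?onesqr_gt0// mulrC ler_pdivrMr ?onesqr_gt0//.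
have : t ^+ 2 <= 1 by rewrite -(expr1n _ 2) -(normr1 R) -[t ^+ 2]real_normK ?num_real// lerXn2r// ?nnegrE// normr1.
have := sqr_ge0 (y 0 i + 2 * t).
rewrite !expr2; nra.
Qed.

Lemma rmeas_affine n (a : R) (b : 'rV[R]_n) (u : 'rV[R]_n -> R) :
  rmeas u -> rmeas (fun x => u (a *: x + b)).
Proof.
move=> mu_; rewrite /rmeas (_ : (fun t => _) = (fun t => u (row_of_tuple t)) \o affine_tuple a (fun i => b 0 i)).
  exact: (measurableT_comp mu_ (measurable_affine_tuple _ _)).
by apply/funext => t /=; congr u; apply/rowP => i; rewrite !mxE tnth_mktuple.
Qed.

Lemma cmeasurable_affine n (a : R) (b : 'rV[R]_n) (u : 'rV[R]_n -> C) :
  cmeasurable u -> cmeasurable (fun x => u (a *: x + b)).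
Proof.
by move=> [u1 u2]; split; [exact: (@rmeas_affine _ a b (fun x => complex.Re (u x)))|exact: (@rmeas_affine _ a b (fun x => complex.Im (u x)))].
Qed.

(** By translation invariance the integral of u(y + x) in y does not depend on x; differentiating it
    at x = 0 under the integral sign gives the claim. Integration by parts follows without cut-offs
    or boundary terms. *)
Lemma cintegral_partial0 n (i : 'I_n) (u u' : 'rV[R]_n -> C) c :
  cdom u c -> (forall y, has_partial i u y (u' y)) ->
  (forall x, normc (u' x) <= c * weight x) -> cintegral u' = 0.
Proof.
move=> [mu_ uc] hu uc'.
have c0 : 0 <= c.
  by have := le_trans (normc_ge0 _) (uc 0); rewrite pmulr_lge0// weight_gt0.
pose U (x : 'rV[R]_n) := cintegral (fun y => u (y + x)).
have b (v : 'rV[R]_n -> C) t (y : 'rV[R]_n) : (forall x, normc (v x) <= c * weight x) -> `|t| < 1 ->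
    normc (v (y + (0 + t *: dir R i))) <= 3 * c * weight y.
  move=> vc t1; rewrite add0r (le_trans (vc _))// mulrAC mulrC ler_wpM2r//.
  by apply: weight_shift; exact: ltW.
have h0 : has_partial i U 0 (cintegral (fun y => u' (y + 0))).
  apply: (has_partial_cintegral (u := fun x y => u (y + x)) (u' := fun x y => u' (y + x)) (c := 3 * c)).
  - by move=> x; have := cmeasurable_affine 1 x mu_; under eq_fun do rewrite scale1r.
  - move=> x y; apply: has_partial_eq (@has_partial_chain _ _ _ i i (fun x => y + x) 1 u x _ _ (hu _)).
      by rewrite [_%:C]/(1 : C) mul1r.
    by move=> s; rewrite mul1r addrA.
  - by move=> t y t1; exact: b.
  - by move=> t y t1; exact: b.
have UE : U = fun=> cintegral u.
  apply/funext => x; rewrite (cintegral_affine x (oner_neq0 R) (cdom_integrable (conj mu_ uc))).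
  rewrite normr1 expr1n mul1r; apply: eq_cintegral => y.
  by rewrite scale1r.
rewrite UE in h0.
rewrite -(has_partial_unique h0 (has_partial_cst i _ 0)).
by apply: eq_cintegral => y; rewrite addr0.
Qed.

End under_integral.

(** * Criteria for smoothness, and closure under sums and products *)

Section smooth_functions.
Context {R : realType} (n : nat).
Local Notation C := R[i].
Implicit Types f g : 'rV[R]_n -> C.

Lemma smooth_cont f : smooth f -> ccontinuous f.
Proof. by move=> /(_ [::]) [h1 h2 _]. Qed.

Lemma derivable_has_partial i f x :
  derivable (fun y => complex.Re (f y) : R^o) x (dir R i) ->
  derivable (fun y => complex.Im (f y) : R^o) x (dir R i) -> has_partial i f x (partial i f x).
Proof. by move=> h1 h2; split; exact: DeriveDef. Qed.

Lemma smooth_has_partial i f x : smooth f -> has_partial i f x (partial i f x).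
Proof. by move=> /(_ [::]) [_ _ /(_ i x) [h1 h2]]; exact: derivable_has_partial. Qed.

Lemma smooth_partial i f : smooth f -> smooth (partial i f).
Proof. by move=> sf l; have := sf (rcons l i); rewrite foldr_rcons. Qed.

Lemma has_partial_derivable i f x l : has_partial i f x l ->
  derivable (fun y => complex.Re (f y) : R^o) x (dir R i) /\
  derivable (fun y => complex.Im (f y) : R^o) x (dir R i).
Proof. by move=> [[h1 _] [h2 _]]. Qed.

(** P is meant to be an explicit family closed under differentiation. It passes to every iterated
    derivative, since the derivatives it provides coincide with [partial]. *)
Lemma smooth_coind (P : ('rV[R]_n -> C) -> Prop) :
  (forall f, P f -> ccontinuous f) ->
  (forall f i, P f -> exists2 f', (forall x, has_partial i f x (f' x)) & P f') ->
  forall f, P f -> smooth f.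
Proof.
move=> Pc Pp f Pf l.
have Pl : P (foldr (@partial R n) f l).
  elim: l => //= i l /(Pp _ i)[f' h Pf'].
  by rewrite (has_partialE h).
split; [by have [] := Pc _ Pl|by have [] := Pc _ Pl|].
by move=> i x; have [f' h _] := Pp _ i Pl; exact: has_partial_derivable (h x).
Qed.

Definition clocbdd f := forall x : 'rV[R]_n, exists L : R, forall y : 'rV[R]_n,
  (forall j, `|y 0 j - x 0 j| <= 1) -> normc (f y) <= L.

(** Continuity of a member of P comes from the local bounds on its partial derivatives, which again
    belong to P. *)
Lemma smooth_coind_bdd (P : ('rV[R]_n -> C) -> Prop) :
  (forall f, P f -> clocbdd f) ->
  (forall f i, P f -> exists2 f', (forall x, has_partial i f x (f' x)) & P f') ->
  forall f, P f -> smooth f.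
Proof.
move=> Pb Pp; apply: smooth_coind => // f Pf.
have Pp' i := cid2 (Pp f i Pf).
pose g i := s2val (Pp' i).
have hg i x : has_partial i f x (g i x) := s2valP (Pp' i) x.
have bg i : clocbdd (g i) by apply: Pb; exact: s2valP' (Pp' i).
split.
  apply: (@locbdd_partials_continuous R n _ (fun i x => complex.Re (g i x))).
    by move=> i z; have [] := hg i z.
  move=> i x; have [L hL] := bg i x; exists L => y /hL; exact: le_trans (ler_normc_Re _).
apply: (@locbdd_partials_continuous R n _ (fun i x => complex.Im (g i x))).
  by move=> i z; have [] := hg i z.
move=> i x; have [L hL] := bg i x; exists L => y /hL; exact: le_trans (ler_normc_Im _).
Qed.

(** Differentiability to order k. Induction on k handles products, whose derivatives are sums of
    products rather than products. *)
Fixpoint smoothn k f := ccontinuous f /\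
  if k is k'.+1 then exists2 g : 'I_n -> 'rV[R]_n -> C,
    (forall i x, has_partial i f x (g i x)) & (forall i, smoothn k' (g i)) else True.

Lemma smoothn_cont k f : smoothn k f -> ccontinuous f.
Proof. by case: k => [|k] []. Qed.

Lemma smoothnS k f : smoothn k.+1 f -> smoothn k f.
Proof.
elim: k f => [|k IH] f; first by case.
by move=> [cf [g hg sg]]; split=> //; exists g => // i; exact: IH.
Qed.

Lemma smooth_smoothn f k : smooth f -> smoothn k f.
Proof.
elim: k f => [|k IH] f sf; first by split=> //; exact: smooth_cont.
split; first exact: smooth_cont.
exists (fun i => partial i f); first by move=> i x; exact: smooth_has_partial.
by move=> i; apply: IH; exact: smooth_partial.
Qed.

Lemma smoothn_smooth f : (forall k, smoothn k f) -> smooth f.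
Proof.
apply: (@smooth_coind (fun f => forall k, smoothn k f)) => {}f.
  by move=> /(_ 0%N); exact: smoothn_cont.
move=> i hf; have [_ [g hg _]] := hf 1%N.
exists (g i); first exact: hg.
move=> k; have [_ [g' hg' sg']] := hf k.+1.
by rewrite -(has_partialE (hg i)) (has_partialE (hg' i)); exact: sg'.
Qed.

Lemma ccontinuousD f g : ccontinuous f -> ccontinuous g -> ccontinuous (fun x => f x + g x).
Proof.
move=> [f1 f2] [g1 g2]; split=> x.
  by under eq_fun do rewrite ReD; exact: (@cvgD R R^o _ _ _ _ _ _ _ (f1 x) (g1 x)).
by under eq_fun do rewrite ImD; exact: (@cvgD R R^o _ _ _ _ _ _ _ (f2 x) (g2 x)).
Qed.

Lemma ccontinuousM f g : ccontinuous f -> ccontinuous g -> ccontinuous (fun x => f x * g x).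
Proof.
move=> [f1 f2] [g1 g2]; split=> x.
  under eq_fun do rewrite ReM.
  exact: (@cvgB R R^o _ _ _ _ _ _ _ (cvgM (f1 x) (g1 x)) (cvgM (f2 x) (g2 x))).
under eq_fun do rewrite ImM.
exact: (@cvgD R R^o _ _ _ _ _ _ _ (cvgM (f1 x) (g2 x)) (cvgM (f2 x) (g1 x))).
Qed.

Lemma ccontinuous_cst (k : C) : ccontinuous (fun _ : 'rV[R]_n => k).
Proof. by split; exact: cst_continuous. Qed.

Lemma smoothnD k f g : smoothn k f -> smoothn k g -> smoothn k (fun x => f x + g x).
Proof.
elim: k f g => [|k IH] f g [cf sf] [cg sg]; split => //; try exact: ccontinuousD.
move: sf sg => [f' hf sf'] [g' hg sg'].
exists (fun i x => f' i x + g' i x); first by move=> i x; exact: has_partialD.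
by move=> i; exact: IH (sf' i) (sg' i).
Qed.

Lemma smoothnM k f g : smoothn k f -> smoothn k g -> smoothn k (fun x => f x * g x).
Proof.
elim: k f g => [|k IH] f g sf sg; first by split=> //; apply: ccontinuousM; [case: sf|case: sg].
have := smoothnS sf; have := smoothnS sg; move: sf sg.
move=> [cf [f' hf sf']] [cg [g' hg sg']] sg sf; split; first exact: ccontinuousM.
exists (fun i x => f' i x * g x + f x * g' i x); first by move=> i x; exact: has_partialM.
by move=> i; exact: smoothnD (IH _ _ (sf' i) sg) (IH _ _ sf (sg' i)).
Qed.

Lemma smoothn_cst k (c : C) : smoothn k (fun=> c).
Proof.
elim: k c => [|k IH] c; split=> //; try exact: ccontinuous_cst.
exists (fun _ _ => 0); first by move=> i x; exact: has_partial_cst.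
by move=> i; exact: IH.
Qed.

Lemma smoothD f g : smooth f -> smooth g -> smooth (fun x => f x + g x).
Proof. by move=> sf sg; apply: smoothn_smooth => k; apply: smoothnD; exact: smooth_smoothn. Qed.

Lemma smoothM f g : smooth f -> smooth g -> smooth (fun x => f x * g x).
Proof. by move=> sf sg; apply: smoothn_smooth => k; apply: smoothnM; exact: smooth_smoothn. Qed.

Lemma smooth_cst (c : C) : smooth (fun _ : 'rV[R]_n => c).
Proof. by apply: smoothn_smooth => k; exact: smoothn_cst. Qed.

Lemma smoothZ (k : C) f : smooth f -> smooth (fun x => k * f x).
Proof. by move=> sf; apply: smoothM => //; exact: smooth_cst. Qed.

Lemma smooth_intro f (g : 'I_n -> 'rV[R]_n -> C) : ccontinuous f ->
  (forall i x, has_partial i f x (g i x)) -> (forall i, smooth (g i)) -> smooth f.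
Proof.
move=> cf hg sg; apply: smoothn_smooth => -[|k]; split => //.
by exists g => // i; exact: smooth_smoothn.
Qed.

Lemma smooth_coord (i : 'I_n) : smooth (fun x : 'rV[R]_n => (x 0 i)%:C).
Proof.
apply: (@smooth_intro _ (fun j _ => ((j == i)%:R)%:C)).
- by split; [exact: coord_continuous|exact: cst_continuous].
- by move=> j x; apply: has_partial_real; exact: rpart_coord.
- by move=> j; exact: smooth_cst.
Qed.

Lemma smooth_partialC i j f : smooth f -> partial i (partial j f) = partial j (partial i f).
Proof.
move=> sf; have s1 k x := smooth_has_partial k x sf.
have s2 k l x := smooth_has_partial k x (smooth_partial l sf).
have [c1 c2] := smooth_cont (smooth_partial i (smooth_partial j sf)).
have [d1 d2] := smooth_cont (smooth_partial j (smooth_partial i sf)).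
apply/funext => x; apply: ReIm_inj.
  apply: (clairaut (i := j) (j := i) (fun z => (s1 j z).1) (fun z => (s1 i z).1)
     (fun z => (s2 i j z).1) (fun z => (s2 j i z).1) c1 d1).
apply: (clairaut (i := j) (j := i) (fun z => (s1 j z).2) (fun z => (s1 i z).2)
   (fun z => (s2 i j z).2) (fun z => (s2 j i z).2) c2 d2).
Qed.

End smooth_functions.

(** * The space S_{1/2} and operators preserving it *)

Section words.
Context {R : realType}.
Local Notation C := R[i].

(* A letter [(true, i)] is multiplication by x_i, [(false, i)] is d/dx_i. *)
Definition letter n := (bool * 'I_n)%type.

Definition lop n (l : letter n) (f : 'rV[R]_n -> C) : 'rV[R]_n -> C :=
  if l.1 then (fun x : 'rV[R]_n => (x 0 l.2)%:C * f x) else partial l.2 f.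

Definition wop n (w : seq (letter n)) f := foldr (@lop n) f w.

Lemma eq_ler (x y : R) : x = y -> x <= y.
Proof. by move=> ->. Qed.

(** k!^(1/2), the growth allowed in S_{1/2} to a word of k letters. *)
Definition sqfact (k : nat) : R := Num.sqrt k`!%:R.

Lemma sqfact_gt0 k : 0 < sqfact k.
Proof. by rewrite sqrtr_gt0 ltr0n fact_gt0. Qed.

Lemma sqfact_ge0 k : 0 <= sqfact k. Proof. exact/ltW/sqfact_gt0. Qed.

Lemma sqfactS k : sqfact k.+1 = Num.sqrt k.+1%:R * sqfact k.
Proof. by rewrite /sqfact factS natrM sqrtrM. Qed.

Lemma sqfact0 : sqfact 0 = 1. Proof. by rewrite /sqfact sqrtr1. Qed.

Lemma sqrt_nat_le (k : nat) : Num.sqrt k%:R <= k%:R :> R.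
Proof.
rewrite -[leRHS]ger0_norm// -sqrtr_sqr ler_wsqrtr// expr2 -natrM ler_nat.
by case: k => // k; rewrite leq_pmull.
Qed.

Lemma sqfactS_le k : sqfact k.+1 <= 2 ^+ k * sqfact k.
Proof.
rewrite sqfactS ler_wpM2r ?sqfact_ge0// (le_trans (sqrt_nat_le _))// -natrX ler_nat.
by rewrite ltn_expl.
Qed.

Lemma sqfactSS_le k : sqfact k.+2 <= 2 * 4 ^+ k * sqfact k.
Proof.
rewrite (le_trans (sqfactS_le _))// exprS -!mulrA ler_wpM2l//.
rewrite (le_trans (ler_wpM2l _ (sqfactS_le _)))//.
by rewrite mulrA -exprMn -natrM.
Qed.

Lemma sqfactD_ge a b : sqfact a * sqfact b <= sqfact (a + b).
Proof.
rewrite -sqrtrM// ler_wsqrtr// -natrM ler_nat.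
rewrite -(bin_fact (leq_addr b a)) addKn leq_pmull// bin_gt0 leq_addr//.
Qed.

Lemma lop_smooth n (l : letter n) f : smooth f -> smooth (lop l f).
Proof.
move=> sf; rewrite /lop; case: ifP => _; last exact: smooth_partial.
by apply: smoothM => //; exact: smooth_coord.
Qed.

Lemma wop_smooth n (w : seq (letter n)) f : smooth f -> smooth (wop w f).
Proof. by move=> sf; elim: w => [|l w IH]; [exact: sf|exact: lop_smooth]. Qed.

Lemma wop_cat n (w1 w2 : seq (letter n)) f : wop (w1 ++ w2) f = wop w1 (wop w2 f).
Proof. by rewrite /wop foldr_cat. Qed.

Lemma wop_rcons n (w : seq (letter n)) l f : wop (rcons w l) f = wop w (lop l f).
Proof. by rewrite /wop foldr_rcons. Qed.

Lemma lop_lin n (l : letter n) (a b : C) f g : smooth f -> smooth g ->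
  lop l (fun x => a * f x + b * g x) = (fun x => a * lop l f x + b * lop l g x).
Proof.
move=> sf sg; rewrite /lop; case: ifP => _.
  by apply/funext => x; ring.
apply: has_partialE => x; apply: has_partialD; apply: has_partialZ;
exact: smooth_has_partial.
Qed.

Lemma wop_lin n (w : seq (letter n)) (a b : C) f g : smooth f -> smooth g ->
  wop w (fun x => a * f x + b * g x) = (fun x => a * wop w f x + b * wop w g x).
Proof.
move=> sf sg; elim: w => [|l w IH]; first by [].
by rewrite /= IH (lop_lin l a b (wop_smooth w sf) (wop_smooth w sg)).
Qed.

(* S_{1/2} described by words in the operators x_i and d/dx_i: this form, unlike the
   bounds on x^b d^a f, passes to the image under any operator that conjugates
   letters into combinations of letters. *)
Definition GS n (f : 'rV[R]_n -> C) := smooth f /\ exists c h : R,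
  [/\ 0 <= c, 1 <= h & forall w x, normc (wop w f x) <= c * h ^+ size w * sqfact (size w)].

Lemma GS_smooth n (f : 'rV[R]_n -> C) : GS f -> smooth f. Proof. by case. Qed.

Lemma GS_lop n (l : letter n) f : GS f -> GS (lop l f).
Proof.
move=> [sf [c [h [c0 h1 H]]]]; split; first exact: lop_smooth.
have h0 : 0 <= h by apply: le_trans h1.
exists (c * h), (2 * h); split; [exact: mulr_ge0|by lra|].
move=> w x; rewrite -wop_rcons (le_trans (H _ _))// size_rcons.
have := ler_wpM2l (mulr_ge0 (mulr_ge0 c0 h0) (exprn_ge0 (size w) h0)) (sqfactS_le (size w)).
rewrite [X in X <= _ -> _](_ : _ = c * h ^+ (size w).+1 * sqfact (size w).+1); last by rewrite exprS; ring.
by move=> /le_trans; apply; apply: eq_ler; rewrite exprMn; ring.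
Qed.

Lemma GS_lin n (a b : C) (f g : 'rV[R]_n -> C) : GS f -> GS g ->
  GS (fun x => a * f x + b * g x).
Proof.
move=> [sf [c [h [c0 h1 H]]]] [sg [c' [h' [c'0 h'1 H']]]].
split; first by apply: smoothD; exact: smoothZ.
exists (normc a * c + normc b * c'), (Num.max h h'); split.
- by rewrite addr_ge0// mulr_ge0// normc_ge0.
- by rewrite le_max h1.
move=> w x; rewrite wop_lin// (le_trans (le_normcD _ _))// !normcM !mulrDl.
have h0 : 0 <= h by apply: le_trans h1.
have h'0 : 0 <= h' by apply: le_trans h'1.
rewrite lerD// -!mulrA ler_wpM2l ?normc_ge0//.
  rewrite (le_trans (H _ _))// mulrA ler_wpM2r ?sqfact_ge0// ler_wpM2l//.
  by rewrite lerXn2r ?nnegrE ?le_max ?h0// lexx.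
rewrite (le_trans (H' _ _))// mulrA ler_wpM2r ?sqfact_ge0// ler_wpM2l//.
by rewrite lerXn2r ?nnegrE ?le_max ?h'0 ?orbT// lexx orbT.
Qed.

Lemma GSZ n (a : C) (f : 'rV[R]_n -> C) : GS f -> GS (fun x => a * f x).
Proof.
move=> gf; have := GS_lin a 0 gf gf.
by under eq_fun do rewrite mul0r addr0.
Qed.

(** Multiplication by 1 + x_j^2 adds a word longer by two letters, again controlled by the S_{1/2}
    bounds. The inverse weight is built up in this way one coordinate at a time. *)
Lemma GS_weight n (f : 'rV[R]_n -> C) : GS f -> exists c h : R,
  [/\ 0 <= c, 1 <= h & forall w x,
    normc (wop w f x) <= c * h ^+ size w * sqfact (size w) * weight x].
Proof.
move=> [sf H].
suff key (s : seq 'I_n) : exists c h : R, [/\ 0 <= c, 1 <= h & forall w x,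
    normc (wop w f x) * \prod_(i <- s) (1 + x 0 i ^+ 2) <= c * h ^+ size w * sqfact (size w)].
  have [c [h [c0 h1 K]]] := key (index_enum 'I_n).
  exists c, h; split=> // w x; have := K w x.
  rewrite -ler_pdivlMr; last by apply: prodr_gt0 => i _; exact: onesqr_gt0.
  by rewrite /weight prodfV.
elim: s => [|j s [c [h [c0 h1 K]]]].
  have [c [h [c0 h1 K]]] := H.
  by exists c, h; split=> // w x; rewrite big_nil mulr1.
have h0 : 0 <= h by apply: le_trans h1.
(* The two further letters cost h^2 and, by [sqfactSS_le], a factor 2 * 4^k, whose geometric part
   goes into the new base. *)
exists (c + 2 * c * h ^+ 2), (4 * h); split; [|lra|].
  by rewrite addr_ge0// mulr_ge0 ?exprn_ge0// mulr_ge0.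
move=> w x; rewrite big_cons mulrCA mulrDl mul1r.
have -> : x 0 j ^+ 2 * (normc (wop w f x) * \prod_(i <- s) (1 + x 0 i ^+ 2)) =
   normc (wop ((true, j) :: (true, j) :: w) f x) * \prod_(i <- s) (1 + x 0 i ^+ 2).
  by rewrite mulrA /= /lop/= !normcM normc_real mulrA -expr2 real_normK ?num_real.
rewrite exprMn [leRHS](_ : _ = c * (4 ^+ size w * h ^+ size w) * sqfact (size w) +
  2 * c * h ^+ 2 * (4 ^+ size w * h ^+ size w) * sqfact (size w)); last by ring.
rewrite lerD//.
  rewrite (le_trans (K _ _))// ler_wpM2r ?sqfact_ge0// ler_wpM2l//.
  by rewrite ler_peMl ?exprn_ge0// exprn_ege1// ler1n.
rewrite (le_trans (K _ _))//=.
have := ler_wpM2l (mulr_ge0 c0 (exprn_ge0 (size w).+2 h0)) (sqfactSS_le (size w)).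
by move=> /le_trans; apply; apply: eq_ler; rewrite !exprS; ring.
Qed.

Lemma GS_dominated n (f : 'rV[R]_n -> C) : GS f ->
  exists2 c, 0 <= c & forall x, normc (f x) <= c * weight x.
Proof.
move=> /GS_weight[c [h [c0 h1 H]]]; exists c => // x.
by have := H [::] x; rewrite /= expr0 sqfact0 !mulr1.
Qed.

Lemma GS_cdom n (f : 'rV[R]_n -> C) : GS f -> exists2 c, 0 <= c & cdom f c.
Proof.
move=> gf; have [c c0 H] := GS_dominated gf; exists c => //; split => //.
by apply: ccontinuous_cmeasurable; exact: smooth_cont (GS_smooth gf).
Qed.

(* A pair of weighted letters stands for the operator c1 l1 + c2 l2. *)
Definition letter2 n := ((C * letter n) * (C * letter n))%type.

Definition lop2 n (g : letter2 n) (f : 'rV[R]_n -> C) : 'rV[R]_n -> C :=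
  fun x => g.1.1 * lop g.1.2 f x + g.2.1 * lop g.2.2 f x.

Lemma GS_lop2 n (g : letter2 n) f : GS f -> GS (lop2 g f).
Proof. by move=> gf; apply: GS_lin; exact: GS_lop. Qed.

(** Each two-term letter doubles the number of words and lengthens them by one; the coefficients
    have modulus at most 1. *)
Lemma lop2_words m n (f : 'rV[R]_n -> C) (tau : letter m -> letter2 n) (B : nat -> R) :
  smooth f -> (forall l, normc (tau l).1.1 <= 1 /\ normc (tau l).2.1 <= 1) ->
  (forall w x, normc (wop w f x) <= B (size w) * weight x) ->
  forall v w x, normc (wop w (foldr (@lop2 n) f (map tau v)) x) <=
    2 ^+ size v * B (size v + size w)%N * weight x.
Proof.
move=> sf hs H; elim=> [w x|l v IH w x]; first by rewrite /= expr0 mul1r.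
have sF : smooth (foldr (@lop2 n) f (map tau v)).
  elim: v {IH} => [|k v IH]; first exact: sf.
  by apply: smoothD; apply: smoothZ; exact: lop_smooth.
have [g1 g2] := hs l; rewrite /=; move: (tau l) g1 g2 => g g1 g2.
rewrite /= wop_lin; [|exact: lop_smooth..].
apply: le_trans (le_normcD _ _) _; rewrite (normcM g.1.1) (normcM g.2.1) -!wop_rcons.
have := IH (rcons w g.1.2) x; have := IH (rcons w g.2.2) x.
rewrite !size_rcons addnS addSn exprS => b2 b1; move: b1 b2.
set X := normc (wop (rcons w g.1.2) _ x) => b1; set Y := normc (wop (rcons w g.2.2) _ x) => b2.
have e1 : normc g.1.1 * X <= X by rewrite ler_piMl ?normc_ge0.
have e2 : normc g.2.1 * Y <= Y by rewrite ler_piMl ?normc_ge0.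
rewrite (le_trans (lerD e1 e2))// (le_trans (lerD b1 b2))//.
by apply: eq_ler; ring.
Qed.

(* [T] conjugates letters into combinations of letters, hence words into sums of words. *)
Lemma GS_transfer m n (T : ('rV[R]_n -> C) -> 'rV[R]_m -> C) (K : R)
    (tau : letter m -> letter2 n) : 0 <= K ->
  (forall l, normc (tau l).1.1 <= 1 /\ normc (tau l).2.1 <= 1) ->
  (forall f b, GS f -> (forall x, normc (f x) <= b * weight x) -> forall y, normc (T f y) <= K * b) ->
  (forall f i (y : 'rV[R]_m), GS f -> (y 0 i)%:C * T f y = T (lop2 (tau (true, i)) f) y) ->
  (forall f i y, GS f -> has_partial i (T f) y (T (lop2 (tau (false, i)) f) y)) ->
  forall f, GS f -> GS (T f).
Proof.
move=> K0 tau1 Tb Tm Td f gf.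
have ST : smooth (T f).
  (* The image of S_{1/2} under T is closed under partial derivatives, and its members are
     bounded. *)
  apply: (@smooth_coind_bdd _ _ (fun u => exists2 f, GS f & u = T f)).
  - move=> _ [g gg ->] y.
    have [c _ H] := GS_dominated gg.
    by exists (K * c) => z _; exact: Tb.
  - move=> _ i [g gg ->]; exists (T (lop2 (tau (false, i)) g)); first by move=> x; exact: Td.
    by eexists; last reflexivity; exact: GS_lop2.
  - by exists f.
have Tl l g : GS g -> lop l (T g) = T (lop2 (tau l) g).
  case: l => -[] i gg; first by apply/funext => y; exact: Tm.
  by apply: has_partialE => y; exact: Td.
have GSs s : GS (foldr (@lop2 n) f s).
  by elim: s => [|g s IH]; [exact: gf|exact: GS_lop2].
have Tw w : wop w (T f) = T (foldr (@lop2 n) f (map tau w)).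
  by elim: w => //= l w ->; rewrite Tl.
split=> //.
have [c [h [c0 h1 H]]] := GS_weight gf.
exists (K * c), (2 * h); split; [exact: mulr_ge0|lra|].
move=> w x; rewrite Tw.
have W := @lop2_words m n f tau (fun N => c * h ^+ N * sqfact N) (GS_smooth gf) tau1 H w [::].
rewrite addn0 in W.
rewrite (le_trans (Tb _ (2 ^+ size w * (c * h ^+ size w * sqfact (size w))) (GSs _) _ _))//.
by rewrite exprMn; apply: eq_ler; ring.
Qed.

End words.

(** * Multi-indices, and the equivalence of the two descriptions of S_{1/2} *)

Section multi_indices.
Context {R : realType} (n : nat).
Local Notation C := R[i].
Implicit Types (a b : multi_index n) (f : 'rV[R]_n -> C).

Definition incr i a : multi_index n := [ffun j => (a j + (j == i))%N].
Definition decr i a : multi_index n := [ffun j => (a j - (j == i))%N].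
Definition zero_index : multi_index n := [ffun=> 0%N].

Lemma decrK i a : (0 < a i)%N -> incr i (decr i a) = a.
Proof.
move=> ai; apply/ffunP => j; rewrite !ffunE; have [->|ji] := eqVneq j i.
  by rewrite subnK.
by rewrite subn0 addn0.
Qed.

Lemma mlen_incr i a : mlen (incr i a) = (mlen a).+1.
Proof.
rewrite /mlen (bigD1 i)//= [in RHS](bigD1 i)//= ffunE eqxx addn1 addSn.
by congr (_ + _).+1; apply: eq_bigr => j ji; rewrite ffunE (negbTE ji) addn0.
Qed.

Lemma mfact_incr i a : mfact (incr i a) = ((a i).+1 * mfact a)%N.
Proof.
rewrite /mfact (bigD1 i)//= [in RHS](bigD1 i)//= ffunE eqxx addn1 factS -mulnA.
by congr (_ * (_ * _))%N; apply: eq_bigr => j ji; rewrite ffunE (negbTE ji) addn0.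
Qed.

Lemma mpow_incr i a (x : 'rV[R]_n) : mpow x (incr i a) = x 0 i * mpow x a.
Proof.
rewrite /mpow (bigD1 i)//= [in RHS](bigD1 i)//= ffunE eqxx addn1 exprS -mulrA.
by congr (_ * (_ * _)); apply: eq_bigr => j ji; rewrite ffunE (negbTE ji) addn0.
Qed.

Lemma leq_mlen i a : (a i <= mlen a)%N.
Proof. by rewrite /mlen (bigD1 i)//= leq_addr. Qed.

Lemma mlen0 : mlen zero_index = 0%N.
Proof. by rewrite /mlen big1// => i _; rewrite ffunE. Qed.

Lemma mfact0 : mfact zero_index = 1%N.
Proof. by rewrite /mfact big1// => i _; rewrite ffunE. Qed.

Lemma mpow0 (x : 'rV[R]_n) : mpow x zero_index = 1.
Proof. by rewrite /mpow big1// => i _; rewrite ffunE expr0. Qed.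

Lemma rpart_expr (i j : 'I_n) (k : nat) (x : 'rV[R]_n) :
  rpart i (fun x : 'rV[R]_n => x 0 j ^+ k) x ((i == j)%:R * (k%:R * x 0 j ^+ k.-1)).
Proof.
elim: k => [|k IH].
  by under eq_fun do rewrite expr0; rewrite mul0r mulr0; exact: rpart_cst.
under eq_fun do rewrite exprS.
apply: rpart_eq (rpartM (rpart_coord i j x) IH).
case: k {IH} => [|k] /=; first by rewrite !expr0; ring.
by rewrite exprS -[in RHS]natr1; ring.
Qed.

Lemma rpart_mpow (i : 'I_n) b (x : 'rV[R]_n) :
  rpart i (fun x : 'rV[R]_n => mpow x b) x ((b i)%:R * mpow x (decr i b)).
Proof.
rewrite /mpow (bigD1 i)//=.
rewrite (_ : (fun y : 'rV[R]_n => _) =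
  (fun y : 'rV[R]_n => y 0 i ^+ b i * \prod_(j < n | j != i) y 0 j ^+ b j)); last first.
  by apply/funext => y; rewrite (bigD1 i).
have h : rpart i (fun y : 'rV[R]_n => \prod_(j < n | j != i) y 0 j ^+ b j) x 0.
  elim: (index_enum _) => [|j s IH].
    by under eq_fun do rewrite big_nil; exact: rpart_cst.
  under eq_fun do rewrite big_cons.
  case ji: (j != i); last exact: IH.
  apply: rpart_eq (rpartM (rpart_expr i j (b j) x) IH).
  by rewrite mulr0 add0r eq_sym (negbTE ji) mul0r mulr0.
apply: rpart_eq (rpartM (rpart_expr i i (b i) x) h).
rewrite eqxx mulr0 add0r mul1r ffunE eqxx subn1 mulrC -mulrA.
congr (_ * (_ * _)); apply: eq_bigr => j ji.
by rewrite ffunE (negbTE ji) subn0.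
Qed.

Definition dirs a : seq 'I_n := flatten [seq nseq (a i) i | i <- enum 'I_n].

Lemma mderivE a f : mderiv a f = foldr (@partial R n) f (dirs a).
Proof.
rewrite /mderiv /dirs; elim: (enum 'I_n) => //= i s IH.
by rewrite foldr_cat -IH; elim: (a i) => //= k ->.
Qed.

Lemma size_dirs a : size (dirs a) = mlen a.
Proof.
rewrite /dirs size_flatten /shape -map_comp sumnE big_map /mlen big_enum/=.
by apply: eq_bigr => i _; rewrite size_nseq.
Qed.

Lemma mem_count_dirs a i : count_mem i (dirs a) = a i.
Proof.
rewrite /dirs count_flatten -map_comp sumnE big_map big_enum/= (bigD1 i)//=.
rewrite count_nseq /= eqxx mul1n big1 ?addn0// => j ji.
by rewrite count_nseq/= (negbTE ji) mul0n.
Qed.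

(** Clairaut's theorem, applied until the head of the first list reaches the front of the second. *)
Lemma foldr_partial_perm (s t : seq 'I_n) f : smooth f -> perm_eq s t ->
  foldr (@partial R n) f s = foldr (@partial R n) f t.
Proof.
move=> sf; elim: s t => [|i s IH] t; first by rewrite perm_sym => /perm_nilP ->.
move=> st; have it : i \in t by rewrite -(perm_mem st) mem_head.
have : perm_eq (i :: s) (i :: rem i t) by rewrite (perm_trans st)// perm_to_rem.
rewrite perm_cons => /IH E; rewrite /= E.
elim: t it {st IH E} => //= j t IH; rewrite inE; have [->//|ij /= it] := eqVneq j i.
rewrite -(IH it)/= smooth_partialC//.
by elim: (rem i t) => [|k s' IH']; [exact: sf|exact: smooth_partial].
Qed.

Lemma mderiv_incr i a f : smooth f -> mderiv (incr i a) f = partial i (mderiv a f).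
Proof.
move=> sf; rewrite !mderivE; apply: (foldr_partial_perm (t := i :: dirs a)) => //.
by apply/allP => j _ /=; rewrite !mem_count_dirs ffunE (eq_sym j) addnC.
Qed.

End multi_indices.

Section gelfand_shilov_words.
Context {R : realType} (n : nat).
Local Notation C := R[i].
Implicit Types (a b : multi_index n) (f : 'rV[R]_n -> C).

Definition monoder b a f : 'rV[R]_n -> C := fun x => (mpow x b)%:C * mderiv a f x.

Lemma smooth_foldr_partial (s : seq 'I_n) f : smooth f -> smooth (foldr (@partial R n) f s).
Proof. by move=> sf; elim: s => [|i s IH]; [exact: sf|exact: smooth_partial]. Qed.

Lemma smooth_mderiv a f : smooth f -> smooth (mderiv a f).
Proof. by move=> sf; rewrite mderivE; exact: smooth_foldr_partial. Qed.

(** The factor 1 keeps the sum in the form a f + b g to which [wop_lin] applies. *)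
Lemma has_partial_monoder i b a f x : smooth f ->
  has_partial i (monoder b a f) x
    ((b i)%:R * monoder (decr i b) a f x + 1 * monoder b (incr i a) f x).
Proof.
move=> sf.
apply: has_partial_eq (has_partialM (has_partial_real (rpart_mpow i b x)) (smooth_has_partial i x (smooth_mderiv a sf))).
rewrite /monoder mderiv_incr// [(_ * _)%:C]rmorphM/= mul1r mulrA; congr (_ * _ * _ + _).
by rewrite rmorph_nat.
Qed.

Lemma smooth_mpow b : smooth (fun x : 'rV[R]_n => (mpow x b)%:C).
Proof.
rewrite /mpow; elim: (index_enum _) => [|i s IH].
  rewrite (_ : (fun x => _) = fun _ => 1); first exact: smooth_cst.
  by apply/funext => x; rewrite big_nil.
rewrite (_ : (fun x => _) = fun x : 'rV[R]_n => (x 0 i ^+ b i)%:C * (\prod_(i <- s) x 0 i ^+ b i)%:C); last first.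
  by apply/funext => x; rewrite big_cons [(_ * _)%:C in LHS]rmorphM.
apply: (smoothM _ IH); elim: (b i) => [|k IHk].
  rewrite (_ : (fun x => _) = fun _ => 1); first exact: smooth_cst.
  by apply/funext => x; rewrite expr0.
rewrite (_ : (fun x => _) = fun x : 'rV[R]_n => (x 0 i)%:C * (x 0 i ^+ k)%:C); last first.
  by apply/funext => x; rewrite exprS [(_ * _)%:C in LHS]rmorphM.
by apply: smoothM; [exact: smooth_coord|exact: IHk].
Qed.

Lemma smooth_monoder b a f : smooth f -> smooth (monoder b a f).
Proof. by move=> sf; apply: smoothM; [exact: smooth_mpow|exact: smooth_mderiv]. Qed.

Lemma lop_mul_monoder i b a f : lop (true, i) (monoder b a f) = monoder (incr i b) a f.
Proof.
by apply/funext => x; rewrite /lop /monoder/= mpow_incr [(_ * _)%:C]rmorphM/= mulrA.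
Qed.

Lemma lop_der_monoder i b a f : smooth f -> lop (false, i) (monoder b a f) =
  (fun x => (b i)%:R * monoder (decr i b) a f x + 1 * monoder b (incr i a) f x).
Proof. by move=> sf; apply: has_partialE => x; exact: has_partial_monoder. Qed.

Definition sqmfact b a : R := Num.sqrt (mfact b * mfact a)%:R.

Lemma sqmfact_incl i b a : sqmfact (incr i b) a = Num.sqrt (b i).+1%:R * sqmfact b a.
Proof. by rewrite /sqmfact mfact_incr -mulnA natrM sqrtrM. Qed.

Lemma sqmfact_incr i b a : sqmfact b (incr i a) = Num.sqrt (a i).+1%:R * sqmfact b a.
Proof. by rewrite /sqmfact mfact_incr mulnCA natrM sqrtrM. Qed.

Lemma sqmfact_ge0 b a : 0 <= sqmfact b a. Proof. exact: sqrtr_ge0. Qed.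

(* Peeling the letters of a word from the right, against the weight sqrt((N+m)!/m!). *)
Lemma monoder_words f (r h : R) : smooth f -> 0 <= r -> 1 <= h ->
  (forall b a x, normc (monoder b a f x) <= r * h ^+ (mlen b + mlen a) * sqmfact b a) ->
  forall w b a x,
  normc (wop w (monoder b a f) x) * sqfact (mlen b + mlen a) <=
  r * (2 * h) ^+ size w * h ^+ (mlen b + mlen a) * sqfact (mlen b + mlen a + size w) * sqmfact b a :> R.
Proof.
move=> sf r0 h1 H.
have h0 : 0 <= h by apply: le_trans h1.
elim/last_ind => [b a x|w l IH b a x].
  by rewrite expr0 addn0 mulr1 [leRHS]mulrAC ler_wpM2r ?sqfact_ge0//; exact: H.
rewrite wop_rcons size_rcons addnS; set m := (mlen b + mlen a)%N; set N := size w.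
(* Half of the bound to be proved: a letter turns x^b d^a f into at most two terms, and each is
   shown to be at most [K]. *)
pose K := r * (2 * h) ^+ N * h ^+ m.+1 * sqfact (m + N).+1 * sqmfact b a.
have K0 : 0 <= K.
  by rewrite !mulr_ge0 ?exprn_ge0 ?sqfact_ge0 ?sqmfact_ge0// mulr_ge0.
have KE : r * (2 * h) ^+ N.+1 * h ^+ m * sqfact (m + N).+1 * sqmfact b a = K + K.
  by rewrite /K !exprS; ring.
rewrite KE; have s0 k : 0 < Num.sqrt k.+1%:R :> R by rewrite sqrtr_gt0 ltr0n.
have sqle (j k : nat) : (j <= k)%N -> Num.sqrt j%:R <= Num.sqrt k%:R :> R.
  by move=> jk; rewrite ler_wsqrtr// ler_nat.
(* Raising one exponent multiplies [sqmfact] by sqrt(i + 1) with i <= m; this is absorbed by the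
   ratio sqrt(m + 1) of [sqfact] at m + 1 and at m. *)
have main b' a' i : (mlen b' + mlen a' = m.+1)%N -> sqmfact b' a' = Num.sqrt i.+1%:R * sqmfact b a ->
    (i <= m)%N -> normc (wop w (monoder b' a' f) x) * sqfact m <= K.
  move=> em es im; have := IH b' a' x; rewrite em es sqfactS addSn mulrCA => Hw.
  rewrite -(ler_pM2l (s0 m)) (le_trans Hw)//.
  rewrite [leLHS](_ : _ = Num.sqrt i.+1%:R * K); last by rewrite /K; ring.
  by rewrite ler_wpM2r// sqle.
case: l => -[] i.
  rewrite lop_mul_monoder (le_trans (main _ _ (b i) _ _ _))//.
  - by rewrite mlen_incr.
  - exact: sqmfact_incl.
  - by rewrite (leq_trans (leq_mlen i b))// leq_addr.
  - by rewrite lerDl.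
rewrite lop_der_monoder//.
rewrite (wop_lin w _ _ (smooth_monoder (decr i b) a sf) (smooth_monoder b (incr i a) sf)).
rewrite (le_trans (ler_wpM2r (sqfact_ge0 _) (le_normcD _ _)))// mulrDl lerD//; last first.
  rewrite mul1r (main _ _ (a i))//.
  - by rewrite mlen_incr addnS.
  - exact: sqmfact_incr.
  - by rewrite (leq_trans (leq_mlen i a))// leq_addl.
rewrite normcM (_ : (b i)%:R = ((b i)%:R : R)%:C); last by rewrite rmorph_nat.
rewrite normc_real normr_nat.
case bi: (b i) => [|k]; first by rewrite mul0r mul0r.
have bi0 : (0 < b i)%N by rewrite bi.
set b' := decr i b.
have bE : incr i b' = b by exact: decrK.
have mE : m = (mlen b' + mlen a).+1 by rewrite /m -[in LHS]bE mlen_incr addSn.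
have b'i : b' i = k by rewrite /b' ffunE eqxx bi subn1.
have sE : sqmfact b a = Num.sqrt k.+1%:R * sqmfact b' a by rewrite -[in LHS]bE sqmfact_incl b'i.
set m' := (mlen b' + mlen a)%N in mE.
have km : (k <= m')%N by rewrite -b'i (leq_trans (leq_mlen i b'))// leq_addr.
have := IH b' a x; rewrite -/m' -/N => Hw.
rewrite /K mE sE addSn !sqfactS.
(* The coefficient k + 1 of the lowered power is S * S. One S is the ratio of [sqmfact b a] to
   [sqmfact b' a]; the other is at most sqrt(m' + N + 2), supplied by the factorial on the right,
   whose argument exceeds that of the induction hypothesis by two. *)
have Ek : (k.+1%:R : R) = Num.sqrt k.+1%:R * Num.sqrt k.+1%:R by rewrite -expr2 sqr_sqrtr.
set S := Num.sqrt k.+1%:R in Ek *; have S0 : 0 <= S by exact: sqrtr_ge0.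
set X := normc _ in Hw *.
rewrite Ek [leLHS](_ : _ = S * S * Num.sqrt m'.+1%:R * (X * sqfact m')); last by ring.
rewrite (le_trans (ler_wpM2l _ Hw))//; first by rewrite !mulr_ge0// sqrtr_ge0.
set P := r * _ ^+ _ * _ ^+ _ * _ * _.
have P0 : 0 <= P by rewrite !mulr_ge0 ?exprn_ge0 ?sqfact_ge0 ?sqmfact_ge0// mulr_ge0.
rewrite [leRHS](_ : _ = h * h * (S * Num.sqrt (m' + N).+2%:R * Num.sqrt (m' + N).+1%:R * P)); last first.
  by rewrite /P !exprS; ring.
have hh : 1 <= h * h by rewrite -[1]mulr1 ler_pM.
have Q0 : 0 <= S * Num.sqrt (m' + N).+2%:R * Num.sqrt (m' + N).+1%:R * P.
  by apply: mulr_ge0 P0; apply: mulr_ge0; [apply: mulr_ge0|]; exact: sqrtr_ge0.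
rewrite (le_trans _ (ler_peMl Q0 hh))// ler_wpM2r// -!mulrA ler_wpM2l//.
rewrite ler_pM ?sqrtr_ge0//; apply: sqle; first by rewrite ltnS (leq_trans km)// leqW// leq_addr.
by rewrite ltnS leq_addr.
Qed.

Lemma powR12 (k : nat) : k%:R `^ 2^-1 = Num.sqrt k%:R :> R.
Proof. by rewrite powR12_sqrt. Qed.

Lemma monoder0 f : monoder (zero_index n) (zero_index n) f = f.
Proof.
apply/funext => x; rewrite /monoder mpow0 mul1r mderivE.
by rewrite (_ : dirs _ = [::])//; apply/nilP; rewrite /nilp size_dirs mlen0.
Qed.

Lemma gelfand_shilov_GS f : gelfand_shilov 2^-1 f -> GS f.
Proof.
move=> [h h0 [r r0 [sf H]]]; split=> //.
pose h1 := Num.max 1 h.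
have h11 : 1 <= h1 by rewrite le_max lexx.
exists r, (2 * h1); split; [exact: ltW|lra|].
move=> w x.
have := @monoder_words f r h1 sf (ltW r0) h11 _ w (zero_index n) (zero_index n) x.
rewrite mlen0 addn0 add0n sqfact0 expr0 /sqmfact mfact0 sqrtr1 !mulr1 monoder0; apply.
move=> b a y; rewrite (le_trans (H a b y))// powR12 mulrA /sqmfact (mulnC (mfact b)) (addnC (mlen b)).
rewrite ler_wpM2r ?sqrtr_ge0// ler_wpM2l ?(ltW r0)// lerXn2r ?nnegrE ?(ltW h0)//.
  by rewrite (le_trans _ h11).
by rewrite le_max lexx orbT.
Qed.

Lemma bin_le_exp k m : ('C(k, m) <= 2 ^ k)%N.
Proof.
elim: k m => [|k IH] [|m]; rewrite ?bin0 ?expn_gt0//.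
by rewrite binS expnS mul2n -addnn leq_add.
Qed.

Lemma factD_le k m : ((k + m)`! <= 2 ^ (k + m) * (k`! * m`!))%N.
Proof. by rewrite -(bin_fact (leq_addr m k)) addKn leq_mul2r bin_le_exp orbT. Qed.

(** Iteration of (k + m)! <= 2^(k + m) k! m!, at the price of one geometric factor per summand. The
    loss is harmless because every bound carries a free geometric factor. *)
Lemma fact_sum_le (I : Type) (s : seq I) (a : I -> nat) :
  ((\sum_(i <- s) a i)`! <= (2 ^ size s) ^ (\sum_(i <- s) a i) * \prod_(i <- s) (a i)`!)%N.
Proof.
elim: s => [|i s IH]; first by rewrite !big_nil.
rewrite !big_cons (leq_trans (factD_le _ _))//=.
set S := (\sum_(_ <- _) _)%N in IH *.
rewrite (leq_trans (leq_mul (leqnn _) (leq_mul (leqnn _) IH)))//.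
rewrite expnS expnMn -mulnA leq_mul2l; apply/orP; right.
rewrite mulnCA leq_mul// expnD leq_pmull// expn_gt0 expn_gt0//.
Qed.

Lemma fact_mlen_le a : ((mlen a)`! <= (2 ^ n) ^ mlen a * mfact a)%N.
Proof.
by have := fact_sum_le (enum 'I_n) a; rewrite !big_enum size_enum_ord.
Qed.

Definition monoword b : seq (letter n) := [seq (true, i) | i <- dirs b].
Definition derword a : seq (letter n) := [seq (false, i) | i <- dirs a].

Lemma wop_derword a f : wop (derword a) f = mderiv a f.
Proof. by rewrite mderivE /derword; elim: (dirs a) => //= i s ->. Qed.

Lemma wop_monoword b f : wop (monoword b) f = (fun x => (mpow x b)%:C * f x).
Proof.
have -> : wop (monoword b) f = (fun x => (\prod_(i <- dirs b) x 0 i)%:C * f x).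
  rewrite /monoword; elim: (dirs b) => [|i s IH] /=.
    by apply/funext => x; rewrite big_nil mul1r.
  by rewrite IH; apply/funext => x; rewrite /lop/= big_cons [(_ * _)%:C in RHS]rmorphM/= mulrA.
apply/funext => x; congr (_%:C * _).
rewrite /dirs big_flatten big_map /mpow big_enum/=; apply: eq_bigr => i _.
by rewrite big_nseq iter_mulr_1.
Qed.

Lemma GS_gelfand_shilov f : GS f -> gelfand_shilov 2^-1 f.
Proof.
move=> [sf [c [h [c0 h1 H]]]].
have h0 : 0 < h by apply: lt_le_trans h1.
(* The factor 2 splits (|a| + |b|)! and 2^n replaces |a|! and |b|! by a! and b!. *)
exists (h * (2 * 2 ^+ n)); first by rewrite mulr_gt0// mulr_gt0// exprn_gt0.
exists (c + 1); first by rewrite ltr_wpDl.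
split=> // a b x.
have -> : (mpow x b)%:C * mderiv a f x = wop (monoword b ++ derword a) f x.
  by rewrite wop_cat wop_derword wop_monoword.
rewrite (le_trans (H _ _))// size_cat !size_map !size_dirs addnC exprMn.
set m := (mlen a + mlen b)%N.
rewrite -mulrA ler_pM ?lerDl ?mulr_ge0 ?exprn_ge0 ?sqfact_ge0 ?(ltW h0)//.
rewrite -mulrA ler_wpM2l ?exprn_ge0 ?(ltW h0)// powR12.
have E : (2 * 2 ^+ n) ^+ m = Num.sqrt (((2 * 2 ^ n) ^ m) ^ 2)%:R :> R.
  by rewrite natrX sqrtr_sqr ger0_norm// !natrX natrM natrX.
rewrite E -sqrtrM// ler_wsqrtr// -natrM ler_nat.
rewrite (leq_trans (factD_le _ _))//.
rewrite (leq_trans (leq_mul (leqnn _) (leq_mul (fact_mlen_le a) (fact_mlen_le b))))//.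
rewrite [X in (2 ^ m * X <= _)%N](_ : _ = (2 ^ n) ^ m * (mfact a * mfact b))%N; last first.
  by rewrite /m expnD mulnACA.
rewrite mulnA -expnMn leq_mul2r; apply/orP; right.
by rewrite -[X in (X <= _)%N]expn1 leq_pexp2l// expn_gt0 muln_gt0 expn_gt0.
Qed.

End gelfand_shilov_words.

Section block_directions.
Context {R : realType} (m n : nat).

Lemma row_mx_dirl (i : 'I_m) (x : 'rV[R]_m) (y : 'rV[R]_n) s :
  row_mx (x + s *: dir R i) y = row_mx x y + s *: dir R (lshift n i).
Proof.
apply/rowP => j; rewrite [RHS]mxE; case: (split_ordP j) => k ->.
  by rewrite !row_mxEl !mxE /= (inj_eq (@lshift_inj _ _)).
by rewrite !row_mxEr !mxE /= eq_rlshift mulr0 addr0.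
Qed.

Lemma row_mx_dirr (i : 'I_n) (x : 'rV[R]_m) (y : 'rV[R]_n) s :
  row_mx x (y + s *: dir R i) = row_mx x y + s *: dir R (rshift m i).
Proof.
apply/rowP => j; rewrite [RHS]mxE; case: (split_ordP j) => k ->.
  by rewrite !row_mxEl !mxE /= eq_lrshift mulr0 addr0.
by rewrite !row_mxEr !mxE /= (inj_eq (@rshift_inj _ _)).
Qed.

Lemma lsubmx_dirl (i : 'I_m) (z : 'rV[R]_(m + n)) s :
  lsubmx (z + s *: dir R (lshift n i)) = lsubmx z + s *: dir R i.
Proof. by apply/rowP => j; rewrite !mxE /= (inj_eq (@lshift_inj _ _)). Qed.

Lemma rsubmx_dirl (i : 'I_m) (z : 'rV[R]_(m + n)) s :
  rsubmx (z + s *: dir R (lshift n i)) = rsubmx z.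
Proof. by apply/rowP => j; rewrite !mxE /= eq_rlshift mulr0 addr0. Qed.

Lemma lsubmx_dirr (i : 'I_n) (z : 'rV[R]_(m + n)) s :
  lsubmx (z + s *: dir R (rshift m i)) = lsubmx z.
Proof. by apply/rowP => j; rewrite !mxE /= eq_lrshift mulr0 addr0. Qed.

Lemma rsubmx_dirr (i : 'I_n) (z : 'rV[R]_(m + n)) s :
  rsubmx (z + s *: dir R (rshift m i)) = rsubmx z + s *: dir R i.
Proof. by apply/rowP => j; rewrite !mxE /= (inj_eq (@rshift_inj _ _)). Qed.

Lemma rmeas_row_mxr (x : 'rV[R]_m) i : rmeas (fun y : 'rV[R]_n => row_mx x y 0 i).
Proof.
case: (split_ordP i) => j ->; rewrite /rmeas.
  by under eq_fun do rewrite row_mxEl; exact: measurable_cst.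
by under eq_fun do rewrite row_mxEr; exact: measurable_coord.
Qed.

Lemma rmeas_row_mxl (y : 'rV[R]_n) i : rmeas (fun x : 'rV[R]_m => row_mx x y 0 i).
Proof.
case: (split_ordP i) => j ->; rewrite /rmeas.
  by under eq_fun do rewrite row_mxEl; exact: measurable_coord.
by under eq_fun do rewrite row_mxEr; exact: measurable_cst.
Qed.

End block_directions.

(** * The partial Fourier transform on S_{1/2} *)

Section stability.
Context {R : realType}.
Local Notation C := R[i].

Lemma rmeas_lsubmx m n i : rmeas (fun z : 'rV[R]_(m + n) => lsubmx z 0 i).
Proof. by rewrite /rmeas; under eq_fun do rewrite mxE; exact: rmeas_coord. Qed.

Lemma rmeas_rsubmx m n i : rmeas (fun z : 'rV[R]_(m + n) => rsubmx z 0 i).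
Proof. by rewrite /rmeas; under eq_fun do rewrite mxE; exact: rmeas_coord. Qed.

Lemma rmeas_llsubmx m n p i : rmeas (fun z : 'rV[R]_(m + n + p) => lsubmx (lsubmx z) 0 i).
Proof. by rewrite /rmeas; under eq_fun do rewrite 2!mxE; exact: rmeas_coord. Qed.

Lemma rmeas_rlsubmx m n p i : rmeas (fun z : 'rV[R]_(m + n + p) => rsubmx (lsubmx z) 0 i).
Proof. by rewrite /rmeas; under eq_fun do rewrite 2!mxE; exact: rmeas_coord. Qed.

Lemma cdom_section1 m n (u : 'rV[R]_(m + n) -> C) c x :
  cdom u c -> cdom (fun y => u (row_mx x y)) (c * weight x).
Proof.
move=> [mu_ uc]; split; first by apply: cmeasurable_comp mu_ _ => i; exact: rmeas_row_mxr.
by move=> y; rewrite -mulrA -weight_row_mx.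
Qed.

Lemma cdom_section2 m n (u : 'rV[R]_(m + n) -> C) c y :
  cdom u c -> cdom (fun x => u (row_mx x y)) (c * weight y).
Proof.
move=> [mu_ uc]; split; first by apply: cmeasurable_comp mu_ _ => i; exact: rmeas_row_mxl.
by move=> x; rewrite mulrAC -mulrA -weight_row_mx.
Qed.

Lemma cdom_cintegral1 m n (u : 'rV[R]_(m + n) -> C) c : cdom u c ->
  cdom (fun x => cintegral (fun y => u (row_mx x y))) (c * wint n).
Proof.
move=> du; split; first exact: cmeasurable_cintegral1 du.
by move=> x; rewrite mulrAC; apply: normc_cintegral; exact: cdom_section1.
Qed.

Lemma cdom_cintegral2 m n (u : 'rV[R]_(m + n) -> C) c : cdom u c ->
  cdom (fun y => cintegral (fun x => u (row_mx x y))) (c * wint m).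
Proof.
move=> du; split; first exact: cmeasurable_cintegral2 du.
by move=> y; rewrite mulrAC; apply: normc_cintegral; exact: cdom_section2.
Qed.

Definition single n (c : C) (l : letter n) : letter2 n := ((c, l), (0, l)).

Lemma lop2_single n c (l : letter n) (f : 'rV[R]_n -> C) :
  lop2 (single c l) f = (fun x => c * lop l f x).
Proof. by apply/funext => x; rewrite /lop2/= mul0r addr0. Qed.

Lemma single_le1 n c (l : letter n) : normc c <= 1 ->
  normc (single c l).1.1 <= 1 /\ normc (single c l).2.1 <= 1.
Proof. by move=> c1; split=> //; rewrite [normc _](@normc0 R) ler01. Qed.

Lemma dominated_coef_ge0 n (f : 'rV[R]_n -> C) b : (forall x, normc (f x) <= b * weight x) -> 0 <= b.
Proof. by move=> /(_ 0) /(le_trans (normc_ge0 _)); rewrite pmulr_lge0// weight_gt0. Qed.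

Lemma cdom_row_mxr m n (f : 'rV[R]_(m + n) -> C) b x : smooth f ->
  (forall x, normc (f x) <= b * weight x) -> cdom (fun y => f (row_mx x y)) (b * weight x).
Proof.
by move=> sf fb; apply: cdom_section1; split=> //; exact: ccontinuous_cmeasurable (smooth_cont sf).
Qed.

Lemma cdom_row_mxl m n (f : 'rV[R]_(m + n) -> C) b y : smooth f ->
  (forall x, normc (f x) <= b * weight x) -> cdom (fun x => f (row_mx x y)) (b * weight y).
Proof.
by move=> sf fb; apply: cdom_section2; split=> //; exact: ccontinuous_cmeasurable (smooth_cont sf).
Qed.

Lemma weight_coef_le n b (x : 'rV[R]_n) : 0 <= b -> b * weight x <= b.
Proof. by move=> b0; rewrite ler_piMr// weight_le1. Qed.

(** Unnormalised, with a sign: sg = -1 is the transform used in [partial_fourier], sg = 1 its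
    inverse up to a constant. *)
Definition pfourier m n (sg : R) (f : 'rV[R]_(m + n) -> C) : 'rV[R]_(m + n) -> C :=
  fun z => cintegral (fun xi => f (row_mx (lsubmx z) xi) * cis (sg * dotp (rsubmx z) xi)).

Lemma rmeas_phase n sg (y : 'rV[R]_n) : rmeas (fun xi : 'rV[R]_n => sg * dotp y xi).
Proof.
have md : rmeas (fun xi : 'rV[R]_n => dotp y xi).
  by apply: (@rmeas_dotp _ _ _ (fun _ => y) id) => i; [exact: rmeas_cst|exact: rmeas_coord].
exact: (rmeasM (rmeas_cst sg) md).
Qed.

Lemma cdom_pfourier m n sg (f : 'rV[R]_(m + n) -> C) b (z : 'rV[R]_(m + n)) : smooth f ->
  (forall x, normc (f x) <= b * weight x) ->
  cdom (fun xi => f (row_mx (lsubmx z) xi) * cis (sg * dotp (rsubmx z) xi)) b.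
Proof.
move=> sf fb; apply: cdom_cis.
  exact: rmeas_phase.
apply: cdomW (cdom_row_mxr (lsubmx z) sf fb).
exact: weight_coef_le (dominated_coef_ge0 fb).
Qed.

Lemma pfourierZ m n sg k (f : 'rV[R]_(m + n) -> C) : GS f ->
  pfourier sg (fun x => k * f x) = (fun z => k * pfourier sg f z).
Proof.
move=> gf; have [c _ fc] := GS_dominated gf; apply/funext => z.
rewrite /pfourier -cintegralZ; first by apply: eq_cintegral => xi; rewrite mulrA.
exact: cdom_integrable (cdom_pfourier sg z (GS_smooth gf) fc).
Qed.

Lemma has_partial_pfourierl m n sg (f : 'rV[R]_(m + n) -> C) (i : 'I_m) z : GS f ->
  has_partial (lshift n i) (pfourier sg f) z (pfourier sg (partial (lshift n i) f) z).
Proof.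
move=> gf; have sf := GS_smooth gf.
have gf' : GS (partial (lshift n i) f) := GS_lop (false, lshift n i) gf.
have [b b0 fb] := GS_dominated gf; have [b' b'0 fb'] := GS_dominated gf'.
apply: (has_partial_cintegral
  (u := fun z xi => f (row_mx (lsubmx z) xi) * cis (sg * dotp (rsubmx z) xi))
  (u' := fun z xi => partial (lshift n i) f (row_mx (lsubmx z) xi) * cis (sg * dotp (rsubmx z) xi))
  (c := b + b')).
- by move=> x; have [] := cdom_pfourier sg x sf fb.
- move=> x xi; apply: has_partial_eq (has_partialM
   (@has_partial_chain _ _ _ (lshift n i) (lshift n i) (fun z => row_mx (lsubmx z) xi) 1 f x _ _ (smooth_has_partial _ _ sf))
   (@has_partial_chain0 _ _ _ (lshift n i) (fun z => rsubmx z) (fun y => cis (sg * dotp y xi)) x _)).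
  + by rewrite mulr0 addr0 [_%:C]/(1 : C) mul1r.
  + by move=> s; rewrite mul1r lsubmx_dirl row_mx_dirl.
  + by move=> s; rewrite rsubmx_dirl.
- move=> t y _; have [_ h] := cdom_pfourier sg (z + t *: dir R (lshift n i)) sf fb.
  by rewrite (le_trans (h y))// ler_wpM2r ?weight_ge0// lerDl.
- move=> t y _; have [_ h] := cdom_pfourier sg (z + t *: dir R (lshift n i)) (GS_smooth gf') fb'.
  by rewrite (le_trans (h y))// ler_wpM2r ?weight_ge0// lerDr.
Qed.

Lemma has_partial_pfourierr m n sg (f : 'rV[R]_(m + n) -> C) (i : 'I_n) z : GS f ->
  has_partial (rshift m i) (pfourier sg f) z ((0 +i* sg) * pfourier sg (lop (true, rshift m i) f) z).
Proof.
move=> gf; have sf := GS_smooth gf.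
have gf1 : GS (lop (true, rshift m i) f) := GS_lop _ gf.
rewrite -[_ * _](congr1 (fun u => u z) (pfourierZ sg (0 +i* sg) gf1)).
have gf' := GSZ (0 +i* sg) gf1.
have [b b0 fb] := GS_dominated gf; have [b' b'0 fb'] := GS_dominated gf'.
apply: (has_partial_cintegral
  (u := fun z xi => f (row_mx (lsubmx z) xi) * cis (sg * dotp (rsubmx z) xi))
  (u' := fun z xi => (0 +i* sg) * lop (true, rshift m i) f (row_mx (lsubmx z) xi) * cis (sg * dotp (rsubmx z) xi))
  (c := b + b')).
- by move=> x; have [] := cdom_pfourier sg x sf fb.
- move=> x xi.
  have hd : rpart (rshift m i) (fun z => sg * dotp (rsubmx z) xi) x (sg * xi 0 i).
    apply: rpart_eq (rpartM (rpart_cst _ sg x)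
      (@rpart_chain _ _ _ (rshift m i) i (fun z => rsubmx z) 1 (fun y => dotp y xi) x _ _ (rpart_dotp i xi (rsubmx x)))).
      by rewrite mulr0 addr0 mul1r.
    by move=> s; rewrite mul1r rsubmx_dirr.
  apply: has_partial_eq (has_partialM
   (@has_partial_chain0 _ _ _ (rshift m i) (fun z => row_mx (lsubmx z) xi) f x _) (has_partial_cis hd)).
  + rewrite mul0r add0r /lop /= row_mxEr.
    have -> : 0 +i* (sg * xi 0 i) = (0 +i* sg) * (xi 0 i)%:C :> C by simpc.
    by ring.
  + by move=> s; rewrite lsubmx_dirr.
- move=> t y _; have [_ h] := cdom_pfourier sg (z + t *: dir R (rshift m i)) sf fb.
  by rewrite (le_trans (h y))// ler_wpM2r ?weight_ge0// lerDl.
- move=> t y _; have [_ h] := cdom_pfourier sg (z + t *: dir R (rshift m i)) (GS_smooth gf') fb'.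
  by rewrite (le_trans (h y))// ler_wpM2r ?weight_ge0// lerDr.
Qed.

(** The xi-derivative of the integrand integrates to 0 by [cintegral_partial0]. It is the sum of the
    derivative of f times the phase and of i sg y_i times the integrand, and (i sg)^2 = -1. *)
Lemma pfourier_parts m n sg (f : 'rV[R]_(m + n) -> C) (i : 'I_n) (z : 'rV[R]_(m + n)) : sg * sg = 1 -> GS f ->
  (z 0 (rshift m i))%:C * pfourier sg f z =
  (0 +i* sg) * pfourier sg (partial (rshift m i) f) z.
Proof.
move=> sg2 gf; have sf := GS_smooth gf.
have gf' : GS (partial (rshift m i) f) := GS_lop (false, rshift m i) gf.
have [b b0 fb] := GS_dominated gf; have [b' b'0 fb'] := GS_dominated gf'.
set x := lsubmx z; set y := rsubmx z.
have d1 := cdom_pfourier sg z sf fb; have d2 := cdom_pfourier sg z (GS_smooth gf') fb'.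
pose k : C := 0 +i* (sg * y 0 i).
have := @cintegral_partial0 R n i
  (fun xi => f (row_mx x xi) * cis (sg * dotp y xi))
  (fun xi => partial (rshift m i) f (row_mx x xi) * cis (sg * dotp y xi) +
     k * (f (row_mx x xi) * cis (sg * dotp y xi))) (b + (b' + normc k * b)).
move=> H; have {}H := H (cdomW _ d1) _ _.
rewrite cintegralD in H; last 2 first.
- exact: cdom_integrable d2.
- exact: cdom_integrable (cdomZ k d1).
rewrite (cintegralZ k (cdom_integrable d1)) in H.
have E : k = (0 +i* sg) * (z 0 (rshift m i))%:C by rewrite /k mxE; simpc.
have ii : (0 +i* sg) * (0 +i* sg) = -1 :> C by simpc; rewrite sg2.
have {}H : pfourier sg (partial (rshift m i) f) z + k * pfourier sg f z = 0.
  apply: H.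
  - by rewrite lerDl addr_ge0// mulr_ge0// normc_ge0.
  - move=> xi; apply: has_partial_eq (has_partialM
      (@has_partial_chain _ _ _ i (rshift m i) (fun xi => row_mx x xi) 1 f xi _ _ (smooth_has_partial _ _ sf))
      (@has_partial_cis _ _ i (fun xi => sg * dotp y xi) xi (sg * y 0 i) _)).
    + by rewrite [1%:C]/(1 : C) mul1r /k; ring.
    + by move=> s; rewrite mul1r row_mx_dirr.
    + apply: rpart_eq (rpartM (rpart_cst _ sg xi) (_ : rpart i (fun xi => dotp y xi) xi (y 0 i))).
        by rewrite mulr0 addr0.
      have := rpart_dotp i y xi; congr rpart; apply/funext => xi'.
      by rewrite /dotp; apply: eq_bigr => j _; rewrite mulrC.
  - have [_ h] := cdomD d2 (cdomZ k d1).
    by move=> xi; rewrite (le_trans (h xi))// ler_wpM2r ?weight_ge0// lerDr.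
have -> : pfourier sg (partial (rshift m i) f) z = - (k * pfourier sg f z).
  by apply/eqP; rewrite -addr_eq0 H.
rewrite E; transitivity (- ((0 +i* sg) * (0 +i* sg)) * ((z 0 (rshift m i))%:C * pfourier sg f z)); last by ring.
by rewrite ii opprK mul1r.
Qed.

(** Letters of the first block commute with the transform; in the second block multiplication and
    differentiation are exchanged, up to the factor i sg of modulus 1 when sg^2 = 1. *)
Definition pfourier_letters m n (sg : R) (l : letter (m + n)) : letter2 (m + n) :=
  match fintype.split l.2 with
  | inl _ => single 1 l
  | inr _ => single (0 +i* sg) (~~ l.1, l.2)
  end.

Lemma GS_pfourier m n sg (f : 'rV[R]_(m + n) -> C) : sg * sg = 1 -> GS f -> GS (pfourier sg f).
Proof.
move=> sg2; apply: (GS_transfer (K := wint n) (tau := pfourier_letters sg)).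
- exact: wint_ge0.
- have sg1 : `|sg| = 1.
    have : `|sg| ^+ 2 = 1 by rewrite real_normK ?num_real// expr2.
    by move=> /eqP; rewrite sqrp_eq1// => /eqP.
  move=> l; rewrite /pfourier_letters; case: (fintype.split l.2) => k; apply: single_le1.
    by rewrite normc1.
  by rewrite normc_imag sg1.
- move=> g b gg gb z; rewrite mulrC.
  exact: normc_cintegral (cdom_pfourier sg z (GS_smooth gg) gb).
- move=> g j z gg; rewrite /pfourier_letters/=; case: (split_ordP j) => i -> /=.
    rewrite lop2_single (pfourierZ _ _ (GS_lop _ gg)) mul1r /pfourier.
    have [b _ gb] := GS_dominated gg.
    rewrite -cintegralZ; last exact: cdom_integrable (cdom_pfourier sg z (GS_smooth gg) gb).
    by apply: eq_cintegral => xi; rewrite /lop/= row_mxEl mxE mulrA.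
  rewrite lop2_single (pfourierZ _ _ (GS_lop _ gg)).
  exact: pfourier_parts.
- move=> g j z gg; rewrite /pfourier_letters/=; case: (split_ordP j) => i -> /=.
    rewrite lop2_single (pfourierZ _ _ (GS_lop _ gg)) mul1r.
    exact: has_partial_pfourierl.
  rewrite lop2_single (pfourierZ _ _ (GS_lop _ gg)).
  exact: has_partial_pfourierr.
Qed.

End stability.

(** * Shear, integration over a block, and tensor products on S_{1/2} *)

Section shear_marginal_tensor.
Context {R : realType}.
Local Notation C := R[i].

(** The substitution x -> y - x applied to f: it turns a window phi(y - x) into phi(x), so that
    derivatives in y fall on f alone. *)
Definition shear n (f : 'rV[R]_(n + n) -> C) : 'rV[R]_(n + n) -> C :=
  fun z => f (row_mx (rsubmx z - lsubmx z) (rsubmx z)).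

(** Multiplication by x_i is y_i minus (y_i - x_i), and y_i occurs in both arguments of f, so d/dy_i
    becomes a sum of two derivatives. These are the cases that call for letters with two terms. *)
Definition shear_letters n (l : letter (n + n)) : @letter2 R (n + n) :=
  match fintype.split l.2, l.1 with
  | inl i, true => ((1, (true, rshift n i)), (- 1, (true, lshift n i)))
  | inl i, false => single (- 1) l
  | inr i, true => single 1 l
  | inr i, false => ((1, (false, lshift n i)), (1, (false, rshift n i)))
  end.

Lemma GS_shear n (f : 'rV[R]_(n + n) -> C) : GS f -> GS (shear f).
Proof.
apply: (GS_transfer (K := 1) (tau := @shear_letters n)) => //.
- have [n1 n2] : normc (1 : C) <= 1 :> R /\ normc (- 1 : C) <= 1 :> R by rewrite normcN normc1.
  move=> [b j]; rewrite /shear_letters; case: (fintype.split (b, j).2) => i; case: b;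
    try exact: single_le1 n1; try exact: single_le1 n2; exact: conj.
- move=> g b gg gb y; rewrite mul1r (le_trans (gb _))// weight_coef_le//.
  exact: dominated_coef_ge0 gb.
- move=> g j z gg; rewrite /shear_letters/=; case: (split_ordP j) => i -> /=.
    by rewrite /lop2 /shear /lop /= row_mxEl row_mxEr !mxE rmorphB/=; ring.
  by rewrite lop2_single /shear /lop /= row_mxEr !mxE mul1r.
- move=> g j z gg; have sg := GS_smooth gg.
  rewrite /shear_letters/=; case: (split_ordP j) => i -> /=.
    rewrite lop2_single /shear /lop /=.
    apply: has_partial_eq (@has_partial_chain _ _ _ (lshift n i) (lshift n i)
       (fun z => row_mx (rsubmx z - lsubmx z) (rsubmx z)) (-1) g z _ _ (smooth_has_partial _ _ sg)).
      by rewrite rmorphN1.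
    by move=> s; rewrite lsubmx_dirl rsubmx_dirl mulN1r -row_mx_dirl opprD addrA scaleNr.
  apply: has_partial_eq (@has_partial_chain2 _ _ _ (rshift n i) (lshift n i) (rshift n i)
       (fun z => row_mx (rsubmx z - lsubmx z) (rsubmx z)) g (partial (lshift n i) g) (partial (rshift n i) g) z _ _ _ _).
  + by rewrite /lop2/shear /lop/= !mul1r.
  + by move=> s; rewrite lsubmx_dirr rsubmx_dirr row_mx_dirr addrAC row_mx_dirl.
  + by move=> y; exact: smooth_has_partial.
  + by move=> y; exact: smooth_has_partial.
  + exact: smooth_cont (smooth_partial _ sg).
Qed.

Definition marginal m n (k : 'rV[R]_m -> C) (f : 'rV[R]_(m + n) -> C) : 'rV[R]_n -> C :=
  fun y => cintegral (fun x => k x * f (row_mx x y)).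

Section marginal.
Variables (m n : nat) (k : 'rV[R]_m -> C) (B : R).
Hypotheses (mk : cmeasurable k) (B0 : 0 <= B) (kB : forall x, normc (k x) <= B).

Lemma cdom_marginal (f : 'rV[R]_(m + n) -> C) b y : smooth f ->
  (forall x, normc (f x) <= b * weight x) -> cdom (fun x => k x * f (row_mx x y)) (B * b).
Proof.
move=> sf fb; apply: cdomM => //.
apply: cdomW (cdom_row_mxl y sf fb).
exact: weight_coef_le (dominated_coef_ge0 fb).
Qed.

(** Letters in y act on f through its second block and k is never differentiated, so a bounded
    measurable k preserves S_{1/2}. *)
Lemma GS_marginal (f : 'rV[R]_(m + n) -> C) : GS f -> GS (marginal k f).
Proof.
apply: (GS_transfer (K := wint m * B) (tau := fun l => single 1 (l.1, rshift m l.2))).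
- by rewrite mulr_ge0// wint_ge0.
- by move=> l; apply: single_le1; rewrite normc1.
- move=> g b gg gb y; rewrite -mulrA mulrC.
  exact: normc_cintegral (cdom_marginal y (GS_smooth gg) gb).
- move=> g i y gg; rewrite lop2_single /marginal.
  have [b _ gb] := GS_dominated gg.
  rewrite -cintegralZ; last exact: cdom_integrable (cdom_marginal y (GS_smooth gg) gb).
  by apply: eq_cintegral => x; rewrite /lop/= row_mxEr mul1r mulrCA.
- move=> g i y gg; rewrite lop2_single.
  have sg := GS_smooth gg.
  have gg' : GS (partial (rshift m i) g) := GS_lop (false, rshift m i) gg.
  have [b b0 gb] := GS_dominated gg; have [b' b'0 gb'] := GS_dominated gg'.
  apply: (has_partial_cintegral (u := fun y x => k x * g (row_mx x y))
    (u' := fun y x => k x * (1 * partial (rshift m i) g (row_mx x y))) (c := B * b + B * b')).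
  + by move=> z; have [] := cdom_marginal z sg gb.
  + move=> z x; apply: has_partialZ.
    apply: (@has_partial_chain _ _ _ i (rshift m i) (fun y => row_mx x y) 1 g z _ _ (smooth_has_partial _ _ sg)).
    by move=> s; rewrite mul1r row_mx_dirr.
  + move=> t x _; have [_ h] := cdom_marginal (y + t *: dir R i) sg gb.
    by rewrite (le_trans (h x))// ler_wpM2r ?weight_ge0// lerDl mulr_ge0.
  + move=> t x _; have [_ h] := cdom_marginal (y + t *: dir R i) (GS_smooth gg') gb'.
    by rewrite mul1r (le_trans (h x))// ler_wpM2r ?weight_ge0// lerDr mulr_ge0.
Qed.

End marginal.

Definition tensor m n (f : 'rV[R]_m -> C) (g : 'rV[R]_n -> C) : 'rV[R]_(m + n) -> C :=
  fun z => f (lsubmx z) * g (rsubmx z).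

Lemma has_partial_tensorl m n (f : 'rV[R]_m -> C) (g : 'rV[R]_n -> C) i z : smooth f ->
  has_partial (lshift n i) (tensor f g) z (tensor (partial i f) g z).
Proof.
move=> sf; apply: has_partial_eq (has_partialM
  (@has_partial_chain _ _ _ (lshift n i) i (fun z => lsubmx z) 1 f z _ _ (smooth_has_partial _ _ sf))
  (@has_partial_chain0 _ _ _ (lshift n i) (fun z => rsubmx z) g z _)).
- by rewrite mulr0 addr0 [_%:C]/(1 : C) mul1r.
- by move=> s; rewrite mul1r lsubmx_dirl.
- by move=> s; rewrite rsubmx_dirl.
Qed.

Lemma has_partial_tensorr m n (f : 'rV[R]_m -> C) (g : 'rV[R]_n -> C) i z : smooth g ->
  has_partial (rshift m i) (tensor f g) z (tensor f (partial i g) z).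
Proof.
move=> sg; apply: has_partial_eq (has_partialM
  (@has_partial_chain0 _ _ _ (rshift m i) (fun z => lsubmx z) f z _)
  (@has_partial_chain _ _ _ (rshift m i) i (fun z => rsubmx z) 1 g z _ _ (smooth_has_partial _ _ sg))).
- by rewrite mul0r add0r [_%:C]/(1 : C) mul1r.
- by move=> s; rewrite lsubmx_dirr.
- by move=> s; rewrite mul1r rsubmx_dirr.
Qed.

Lemma smooth_tensor m n (f : 'rV[R]_m -> C) (g : 'rV[R]_n -> C) : GS f -> GS g -> smooth (tensor f g).
Proof.
move=> gf gg; apply: (@smooth_coind_bdd _ _ (fun u => exists f' g', [/\ GS f', GS g' & u = tensor f' g'])).
- move=> _ [f' [g' [gf' gg' ->]]] x.
  have [b b0 fb] := GS_dominated gf'; have [b' b'0 gb'] := GS_dominated gg'.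
  exists (b * b') => y _; rewrite normcM ler_pM ?normc_ge0//.
    by rewrite (le_trans (fb _))// weight_coef_le.
  by rewrite (le_trans (gb' _))// weight_coef_le.
- move=> _ j [f' [g' [gf' gg' ->]]]; case: (split_ordP j) => i ->.
    exists (tensor (partial i f') g').
      by move=> z; exact: has_partial_tensorl (GS_smooth gf').
    by exists (partial i f'), g'; split=> //; exact: (GS_lop (false, i) gf').
  exists (tensor f' (partial i g')).
    by move=> z; exact: has_partial_tensorr (GS_smooth gg').
  by exists f', (partial i g'); split=> //; exact: (GS_lop (false, i) gg').
- by exists f, g.
Qed.

Lemma wop_tensor m n (f : 'rV[R]_m -> C) (g : 'rV[R]_n -> C) w : smooth f -> smooth g ->
  exists w1 w2, [/\ size w = (size w1 + size w2)%N & wop w (tensor f g) = tensor (wop w1 f) (wop w2 g)].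
Proof.
move=> sf sg; elim: w => [|[b j] w [w1 [w2 [sw E]]]]; first by exists [::], [::].
have s1 := wop_smooth w1 sf; have s2 := wop_smooth w2 sg.
case: (split_ordP j) => i ->.
  exists ((b, i) :: w1), w2; split; first by rewrite /= sw.
  rewrite [LHS]/= E; case: b.
    by apply/funext => z; rewrite /= /tensor /lop /= mxE mulrA.
  by apply: has_partialE => z; exact: has_partial_tensorl.
exists w1, ((b, i) :: w2); split; first by rewrite /= sw addnS.
rewrite [LHS]/= E; case: b.
  by apply/funext => z; rewrite /= /tensor /lop /= mxE mulrCA.
by apply: has_partialE => z; exact: has_partial_tensorr.
Qed.

(** A word on the tensor product splits into a word on each factor, and sqrt(k! l!) <= sqrt((k +
    l)!). *)
Lemma GS_tensor m n (f : 'rV[R]_m -> C) (g : 'rV[R]_n -> C) : GS f -> GS g -> GS (tensor f g).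
Proof.
move=> gf gg; split; first exact: smooth_tensor.
have [sf [c [h [c0 h1 H]]]] := gf; have [sg [c' [h' [c'0 h'1 H']]]] := gg.
have h0 : 0 <= h by apply: le_trans h1.
have h'0 : 0 <= h' by apply: le_trans h'1.
exists (c * c'), (h * h'); split; [exact: mulr_ge0|by rewrite -[1]mulr1 ler_pM|].
move=> w z; have [w1 [w2 [-> ->]]] := wop_tensor w sf sg.
rewrite normcM (le_trans (ler_pM (normc_ge0 _) (normc_ge0 _) (H w1 _) (H' w2 _)))//.
rewrite [leLHS](_ : _ = c * c' * (h ^+ size w1 * h' ^+ size w2) * (sqfact (size w1) * sqfact (size w2))); last by ring.
have hh : h ^+ size w1 * h' ^+ size w2 <= (h * h') ^+ (size w1 + size w2).
  rewrite exprMn !exprD mulrACA -[leLHS]mulr1 -[in leLHS]mulrA.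
  rewrite [leRHS](_ : _ = h ^+ size w1 * h' ^+ size w2 * (h' ^+ size w1 * h ^+ size w2)); last by ring.
  rewrite mulrA ler_wpM2l ?mulr_ge0 ?exprn_ge0//.
  by rewrite -[1]mulr1 ler_pM// exprn_ege1.
rewrite ler_pM ?mulr_ge0 ?exprn_ge0 ?sqfact_ge0//; last exact: sqfactD_ge.
by rewrite ler_wpM2l// mulr_ge0.
Qed.

End shear_marginal_tensor.

(** * Gaussians and Fourier inversion *)

Section gaussian.
Context {R : realType}.
Local Notation C := R[i].

Definition gauss n (a : R) (b x : 'rV[R]_n) : R := expR (- (a * dotp (x - b) (x - b))).

Lemma gauss_ge0 n a (b x : 'rV[R]_n) : 0 <= gauss a b x. Proof. exact: expR_ge0. Qed.

Lemma gauss_prod n a (b x : 'rV[R]_n) :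
  gauss a b x = \prod_i expR (- (a * (x 0 i - b 0 i) ^+ 2)).
Proof.
rewrite /gauss /dotp mulr_sumr -sumrN expR_sum; apply: eq_bigr => i _.
by rewrite !mxE expr2.
Qed.

Lemma rpart_shift n (i : 'I_n) (b : 'rV[R]_n) (u : 'rV[R]_n -> R) x l :
  rpart i u (x - b) l -> rpart i (fun x => u (x - b)) x l.
Proof.
move=> h; rewrite -[l]mul1r; apply: (@rpart_chain _ _ _ i i (fun x => x - b)) => //.
by move=> s; rewrite mul1r addrAC.
Qed.

Lemma rpart_gauss n (i : 'I_n) a (b x : 'rV[R]_n) :
  rpart i (gauss a b) x (- (2 * a) * (x 0 i - b 0 i) * gauss a b x).
Proof.
have hs : rpart i (fun y : 'rV[R]_n => - (a * dotp y y)) (x - b) (- (a * (2 * (x - b) 0 i))).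
  apply: rpartN; apply: rpart_eq (rpartM (rpart_cst i a _)
    (rpart_sum _ (l := fun j => (x - b) 0 j * (i == j)%:R + (x - b) 0 j * (i == j)%:R) _)).
    rewrite mulr0 addr0; congr (_ * _).
    rewrite (bigD1 i)//= eqxx mulr1 big1 ?addr0; first by rewrite mulr_natl mulr2n.
    by move=> j ji; rewrite eq_sym (negbTE ji) mulr0 addr0.
  by move=> j; exact: rpartM (rpart_coord i j _) (rpart_coord i j _).
have := rpart_shift (rpart_comp1 (is_derive_expR _) hs).
by apply: rpart_eq; rewrite !mxE -/(gauss a b x); ring.
Qed.

(** Monomials centred at b times the Gaussian: both kinds of letters send this family into its own
    linear combinations. *)
Definition mgauss n a (b : 'rV[R]_n) (k : multi_index n) : 'rV[R]_n -> C :=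
  fun x => (mpow (x - b) k * gauss a b x)%:C.

Lemma has_partial_mgauss n (i : 'I_n) a (b x : 'rV[R]_n) k :
  has_partial i (mgauss a b k) x
    ((k i)%:R * mgauss a b (decr i k) x + (- (2 * a))%:C * mgauss a b (incr i k) x).
Proof.
have h := rpartM (rpart_shift (rpart_mpow i k (x - b))) (rpart_gauss i a b x).
apply: has_partial_eq (has_partial_real h).
rewrite /mgauss mpow_incr !mxE.
rewrite (_ : (k i)%:R = ((k i)%:R : R)%:C); last by rewrite rmorph_nat.
by rewrite -!rmorphM -rmorphD/=; congr (_%:C); ring.
Qed.

Lemma exp_term_le (t : R) k : 0 <= t -> t ^+ k <= k`!%:R * expR t.
Proof.
move=> t0; case: k => [|k]; first by rewrite expr0 mul1r (le_trans _ (expR_ge1Dx _))// lerDl.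
rewrite mulrC -ler_pdivrMr ?ltr0n ?fact_gt0//.
by rewrite (le_trans _ (expR_ge1Dxn k t0))// lerDr.
Qed.

(** With t = 2 a y^2, the square of the left-hand side is (2 a)^(-k) t^k exp(-t), and t^k <= k!
    exp(t). *)
Lemma expr_gauss_le a (y : R) k : 0 < a ->
  `|y| ^+ k * expR (- (a * y ^+ 2)) <= Num.sqrt (2 * a)^-1 ^+ k * sqfact k.
Proof.
move=> a0.
have a20 : 0 < 2 * a by rewrite mulr_gt0.
have t0 : 0 <= 2 * a * y ^+ 2 by rewrite mulr_ge0 ?sqr_ge0// ltW.
have e1 : (`|y| ^+ k * expR (- (a * y ^+ 2))) ^+ 2 =
    (2 * a)^-1 ^+ k * ((2 * a * y ^+ 2) ^+ k * expR (- (2 * a * y ^+ 2))).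
  rewrite [RHS]mulrA -exprMn (mulrA (_^-1)) mulVf ?gt_eqF// mul1r.
  by rewrite exprMn -exprM mulnC exprM real_normK ?num_real// -expRM_natl mulrN mulrA.
have e2 : (Num.sqrt (2 * a)^-1 ^+ k * sqfact k) ^+ 2 = (2 * a)^-1 ^+ k * k`!%:R :> R.
  by rewrite exprMn -exprM mulnC exprM !sqr_sqrtr ?invr_ge0 ?(ltW a20).
rewrite -(@ler_pXn2r _ 2)// ?nnegrE ?mulr_ge0 ?exprn_ge0 ?expR_ge0 ?sqfact_ge0 ?sqrtr_ge0//.
rewrite e1 e2 ler_wpM2l ?exprn_ge0 ?invr_ge0 ?(ltW a20)//.
by rewrite expRN ler_pdivrMr ?expR_gt0// exp_term_le.
Qed.

Lemma mpow_gauss_le n a (b x : 'rV[R]_n) k : 0 < a ->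
  normc (mgauss a b k x) <= Num.sqrt (2 * a)^-1 ^+ mlen k * sqfact (mlen k).
Proof.
move=> a0; rewrite /mgauss normc_real normrM (ger0_norm (gauss_ge0 _ _ _)) gauss_prod /mpow.
rewrite normr_prod -big_split/= /mlen.
elim: (index_enum 'I_n) => [|i s IH]; first by rewrite !big_nil expr0 sqfact0 mulr1.
rewrite !big_cons exprD.
rewrite (le_trans (ler_pM _ _ (_ : _ <= Num.sqrt (2 * a)^-1 ^+ k i * sqfact (k i)) IH))//.
- by rewrite prodr_ge0// => j _; rewrite mulr_ge0// expR_ge0.
- by rewrite normrX !mxE; exact: expr_gauss_le.
rewrite mulrACA ler_wpM2l ?mulr_ge0 ?exprn_ge0 ?sqrtr_ge0//.
exact: sqfactD_ge.
Qed.

Lemma mgauss0 n a (b : 'rV[R]_n) : mgauss a b (zero_index n) = fun x => (gauss a b x)%:C.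
Proof. by apply/funext => x; rewrite /mgauss mpow0 mul1r. Qed.

Lemma smooth_mgauss n a (b : 'rV[R]_n) k : 0 < a -> smooth (mgauss a b k).
Proof.
move=> a0; apply: smoothn_smooth => N.
have cm k' : ccontinuous (mgauss a b k').
  split; last exact: cst_continuous.
  apply: (@locbdd_partials_continuous R n _ (fun i x => complex.Re
    ((k' i)%:R * mgauss a b (decr i k') x + (- (2 * a))%:C * mgauss a b (incr i k') x))).
    by move=> i z; have [] := has_partial_mgauss i a b z k'.
  move=> i x; eexists => y _; rewrite (le_trans (ler_normc_Re _))// (le_trans (le_normcD _ _))//.
  rewrite !normcM; apply: lerD; (apply: ler_wpM2l; [exact: normc_ge0|exact: mpow_gauss_le]).
elim: N k => [|N IH] k; split=> //.
exists (fun i x => (k i)%:R * mgauss a b (decr i k) x + (- (2 * a))%:C * mgauss a b (incr i k) x).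
  by move=> i x; exact: has_partial_mgauss.
move=> i; apply: smoothnD; apply: smoothnM; try exact: smoothn_cst; exact: IH.
Qed.

Lemma GS_gauss n a (b : 'rV[R]_n) : 0 < a -> GS (fun x => (gauss a b x)%:C).
Proof.
move=> a0; rewrite -mgauss0; split; first exact: smooth_mgauss.
(* [A] is the base of the bound on monomials times the Gaussian, made at least 1. [B] dominates the
   cost of a letter: 1 + |b_i| for x_i = (x_i - b_i) + b_i, and 1 + 2 a for a derivative. *)
pose A := 1 + Num.sqrt (2 * a)^-1.
pose B := 1 + 2 * a + \sum_i `|b 0 i|.
have A1 : 1 <= A by rewrite lerDl sqrtr_ge0.
have A0 : 0 <= A by apply: le_trans A1.
have sb0 : 0 <= \sum_i `|b 0 i| by rewrite sumr_ge0.
have B1 : 1 <= B by rewrite /B -addrA lerDl addr_ge0// mulr_ge0// ltW.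
have B0 : 0 <= B by apply: le_trans B1.
have Bb i : 1 + `|b 0 i| <= B.
  have : `|b 0 i| <= \sum_i `|b 0 i| by rewrite (bigD1 i)//= lerDl sumr_ge0.
  by rewrite /B; move: a0; lra.
have Ba : 1 + 2 * a <= B by rewrite /B lerDl.
(* Stated for all k because each letter moves to neighbouring indices. A lowered index brings a
   factor k_i, compensated by the argument of the factorial, which is larger by two than the one the
   induction hypothesis then gives. *)
suff key w k x : normc (wop w (mgauss a b k) x) <=
    B ^+ size w * A ^+ (size w + mlen k) * sqfact (size w + mlen k).
  exists 1, (B * A); split=> //; first by rewrite -[1]mulr1 ler_pM.
  move=> w x; rewrite (le_trans (key _ _ _))//.
  by rewrite mlen0 addn0 mul1r exprMn.
elim/last_ind: w k x => [k x|w l IH k x].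
  rewrite /= expr0 mul1r add0n (le_trans (mpow_gauss_le _ _ _ a0))//.
  rewrite ler_wpM2r ?sqfact_ge0// lerXn2r ?nnegrE ?sqrtr_ge0//.
  by rewrite lerDr.
rewrite wop_rcons size_rcons; set N := size w; set m := mlen k.
have s0 j : 0 <= sqfact j :> R := sqfact_ge0 j.
pose E j : R := B ^+ N * A ^+ j * sqfact j.
have E0 j : 0 <= E j by rewrite !mulr_ge0 ?exprn_ge0.
have Einc : E (N + m)%N <= E (N + m).+1.
  rewrite /E -!mulrA ler_wpM2l ?exprn_ge0// ler_pM ?exprn_ge0//.
    by rewrite exprS ler_peMl ?exprn_ge0.
  by rewrite sqfactS ler_peMl// -{1}(@sqrtr1 R) ler_wsqrtr// ler1n.
have EB : B ^+ N.+1 * A ^+ (N.+1 + m) * sqfact (N.+1 + m) = B * E (N + m).+1.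
  by rewrite /E addSn exprS !mulrA.
rewrite EB.
case: l => -[] i.
  have -> : lop (true, i) (mgauss a b k) =
    (fun x => 1 * mgauss a b (incr i k) x + (b 0 i)%:C * mgauss a b k x).
    apply/funext => y; rewrite /lop /= /mgauss mpow_incr !mxE mul1r -!rmorphM -rmorphD/=.
    by congr (_%:C); ring.
  rewrite (wop_lin w _ _ (smooth_mgauss b (incr i k) a0) (smooth_mgauss b k a0)).
  rewrite (le_trans (le_normcD _ _))// (normcM 1) (normcM (_%:C)) normc1 mul1r normc_real.
  rewrite (le_trans (lerD (IH _ _) (ler_wpM2l (normr_ge0 _) (IH _ _))))// mlen_incr addnS -/N -/m.
  rewrite (le_trans (lerD (lexx _) (ler_wpM2l (normr_ge0 _) Einc)))//.
  rewrite -/(E (N + m).+1) -[X in X + _ <= _]mul1r -mulrDl.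
  by apply: ler_wpM2r; [exact: E0|exact: Bb].
have -> : lop (false, i) (mgauss a b k) = (fun x => (k i)%:R * mgauss a b (decr i k) x +
    (- (2 * a))%:C * mgauss a b (incr i k) x).
  by apply: has_partialE => y; exact: has_partial_mgauss.
rewrite (wop_lin w _ _ (smooth_mgauss b (decr i k) a0) (smooth_mgauss b (incr i k) a0)).
rewrite (le_trans (le_normcD _ _))// (normcM _%:R) (normcM (_%:C)) normc_real normrN.
rewrite (_ : (k i)%:R = ((k i)%:R : R)%:C); last by rewrite rmorph_nat.
rewrite normc_real normr_nat gtr0_norm ?mulr_gt0//.
apply: (le_trans _ (ler_wpM2r (E0 (N + m).+1) Ba)); rewrite [leRHS]mulrDl mul1r; apply: lerD; last first.
  apply: ler_wpM2l; first by rewrite mulr_ge0 ?(ltW a0).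
  by rewrite (le_trans (IH _ _))// mlen_incr addnS.
case ki: (k i) => [|j]; first by rewrite mul0r.
rewrite (le_trans (ler_wpM2l (ler0n _ _) (IH _ _)))// -ki.
have mE : m = (mlen (decr i k)).+1 by rewrite /m -(mlen_incr i) decrK// ki.
have km : (k i <= m)%N by exact: leq_mlen.
move: km; rewrite mE; set m' := mlen _ => km.
rewrite /E addnS !exprS !sqfactS.
have q0 j' : 0 <= Num.sqrt j'%:R :> R by exact: sqrtr_ge0.
have kk : (k i)%:R <= Num.sqrt (N + m').+2%:R * Num.sqrt (N + m').+1%:R :> R.
  rewrite (_ : (k i)%:R = Num.sqrt (k i)%:R * Num.sqrt (k i)%:R); last by rewrite -expr2 sqr_sqrtr.
  rewrite ler_pM// ler_wsqrtr// ler_nat (leq_trans km)//; last by rewrite ltnS leq_addl.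
  by rewrite ltnW// !ltnS leq_addl.
rewrite [leRHS](_ : _ = (Num.sqrt (N + m').+2%:R * Num.sqrt (N + m').+1%:R) *
   ((A * A) * (B ^+ N * A ^+ (N + m') * sqfact (N + m')))); last by ring.
rewrite ler_pM ?mulr_ge0 ?exprn_ge0// ler_peMl ?mulr_ge0 ?exprn_ge0//.
by rewrite -[1]mulr1 ler_pM.
Qed.

End gaussian.

Section gaussian_fourier.
Context {R : realType}.
Local Notation C := R[i].
Local Notation T := (measurableTypeR R).

(** One coordinate at a time; [gauss_fun] is exp(-x^2), and a dilation by sqrt 2 turns its integral
    sqrt pi into sqrt(2 pi). *)
Lemma rint_gauss_half n : rint (gauss (2^-1 : R) (0 : 'rV[R]_n)) = Num.sqrt (2 * pi) ^+ n.
Proof.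
have mg k : rmeas (gauss (2^-1 : R) (0 : 'rV[R]_k)).
  have [h _] := smooth_cont (GS_smooth (@GS_gauss R k (2^-1) 0 ltac:(by rewrite invr_gt0))).
  exact: (continuous_rmeas h).
suff E : (\int[lebesgue_tuple n]_t (gauss (2^-1 : R) (0 : 'rV[R]_n) (row_of_tuple t))%:E = (Num.sqrt (2 * pi) ^+ n)%:E)%E.
  by rewrite /rint /Rintegral E.
elim: n => [|n IH].
  rewrite integral_dirac//; last by apply/measurable_EFinP; exact: (mg 0%N).
  rewrite diracE in_setT mul1e expr0; congr (_%:E).
  by rewrite /gauss /dotp big_ord0 mulr0 oppr0 expR0.
rewrite ge0_integral_cons; last 2 first.
- by apply/measurable_EFinP; exact: (mg n.+1).
- by move=> t; rewrite lee_fin gauss_ge0.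
have e x : (\int[lebesgue_tuple n]_t (gauss (2^-1 : R) (0 : 'rV[R]_n.+1) (row_of_tuple (cons_pair (x, t))))%:E =
    (expR (- (2^-1 * x ^+ 2)))%:E * (Num.sqrt (2 * pi) ^+ n)%:E)%E.
  rewrite -IH -ge0_integralZl//.
  - apply: eq_integral => t _; rewrite -EFinM; congr (_%:E).
    rewrite !gauss_prod big_ord_recl !mxE tnth0 subr0; congr (_ * _).
    by apply: eq_bigr => i _; rewrite !mxE tnthS.
  - by apply/measurable_EFinP; exact: (mg n).
  - by move=> t _; rewrite lee_fin gauss_ge0.
under eq_integral do rewrite e.
have m1 : measurable_fun setT (fun x : T => expR (- (2^-1 * x ^+ 2)) : R).
  apply: measurableT_comp => //; apply: measurable_funN; apply: measurable_funM => //.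
rewrite ge0_integralZr//; last exact/measurable_EFinP.
have s20 : Num.sqrt 2 != 0 :> R by rewrite gt_eqF// sqrtr_gt0.
have := @ge0_integral_affine R (Num.sqrt 2)^-1 0 (fun x => (gauss_fun x)%:E) _ _ _.
rewrite integralT_gauss => H.
have {}H := H (invr_neq0 s20) ltac:(by apply/measurable_EFinP; exact: measurable_gauss_fun)
  ltac:(by move=> x; rewrite lee_fin gauss_fun_ge0).
have gE x : (gauss_fun ((Num.sqrt 2)^-1 * x + 0))%:E = (expR (- (2^-1 * x ^+ 2)))%:E :> \bar R.
  by rewrite /gauss_fun addr0 exprMn exprVn sqr_sqrtr.
set I := (\int[_]_x _)%E.
have {}H : ((Num.sqrt pi)%:E = (`|(Num.sqrt 2)^-1| : R)%:E * I)%E.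
  by rewrite H; congr (_ * _)%E; apply: eq_integral => x _; exact: gE.
have -> : I = (Num.sqrt (2 * pi))%:E.
  rewrite sqrtrM// EFinM H muleA -EFinM gtr0_norm ?invr_gt0 ?sqrtr_gt0//.
  by rewrite divff// mul1e.
by rewrite -EFinM -exprS.
Qed.

(** Dominated convergence, the argument of v shrinking to y. With K a Gaussian this is an
    approximate identity; with v a Gaussian and y = 0 it is a summability method. Inversion uses
    both. *)
Lemma rint_dilation_cvg n (v K : 'rV[R]_n -> R) (y : 'rV[R]_n) B c : continuous v -> (forall x, `|v x| <= B) ->
  rmeas K -> (forall x, `|K x| <= c * weight x) ->
  rint (fun u => v (y + (k.+1%:R^-1 : R) *: u) * K u) @[k --> \oo] --> v y * rint K.
Proof.
move=> cv vB mK Kc.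
have B0 : 0 <= B by apply: le_trans (vB 0).
have bnd (x : 'rV[R]_n) z : `|v x * K z| <= (B * c) * weight z.
  by rewrite normrM -mulrA ler_pM.
have mv (a : R) : rmeas (fun u => v (y + a *: u) * K u).
  apply: (measurable_funM _ mK).
  have := rmeas_affine a y (continuous_rmeas cv).
  by rewrite /rmeas; under eq_fun do rewrite addrC.
have iK : rintegrable K := dominated_rintegrable mK Kc.
have [] := @dominated_convergence _ _ _ (lebesgue_tuple n) setT measurableT
  (fun k t => (v (y + (k.+1%:R^-1 : R) *: row_of_tuple t) * K (row_of_tuple t))%:E)
  (fun t => (v y * K (row_of_tuple t))%:E)
  (fun t => ((B * c) * weight (row_of_tuple t))%:E).
- by move=> k; apply/measurable_EFinP; exact: mv.
- by apply/measurable_EFinP; apply: measurable_funM => //; exact: measurable_cst.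
- apply: aeW => t _; apply: cvg_EFin; first exact: nearW.
  have c1 : y + (k.+1%:R^-1 : R) *: row_of_tuple t @[k --> \oo] --> y.
    have c0 : (k.+1%:R^-1 : R) *: row_of_tuple t @[k --> \oo] --> (0 : R) *: row_of_tuple t.
      exact: (@cvgZ R 'rV[R]_n _ _ _ _ _ _ _ (@cvg_harmonic R) (cvg_cst (row_of_tuple t))).
    rewrite -[X in _ --> X]addr0 -(scale0r (row_of_tuple t)).
    by apply: (@cvgD R 'rV[R]_n _ _ _ _ _ _ _ (cvg_cst y) c0).
  exact: (cvgM (cvg_comp _ _ c1 (cv y)) (cvg_cst (K (row_of_tuple t)))).
- exact: (rintegrableZ (B * c) (integrable_weight n)).
- by apply: aeW => t k _; rewrite lee_fin bnd.
move=> i1 _ H.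
have -> : v y * rint K = fine (\int[lebesgue_tuple n]_t (v y * K (row_of_tuple t))%:E).
  by rewrite -(rintZ (v y) iK).
by apply: fine_cvg; rewrite fineK//; exact: integrable_fin_num.
Qed.

End gaussian_fourier.

(** * Gaussian summability and Fourier inversion *)

Section fourier_inversion.
Context {R : realType}.
Local Notation C := R[i].

Definition stdgauss n : 'rV[R]_n -> R := gauss 2^-1 0.

Lemma GS_stdgauss n : GS (fun x : 'rV[R]_n => (stdgauss x)%:C).
Proof. by apply: GS_gauss; rewrite invr_gt0. Qed.

Lemma stdgauss0 n : stdgauss (0 : 'rV[R]_n) = 1.
Proof. by rewrite /stdgauss /gauss subrr /dotp big1 ?mulr0 ?oppr0 ?expR0// => i _; rewrite mxE mul0r. Qed.

Lemma stdgauss_le1 n (x : 'rV[R]_n) : `|stdgauss x| <= 1.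
Proof.
rewrite ger0_norm ?gauss_ge0// -expR0 ler_expR oppr_le0 mulr_ge0// ?invr_ge0// sumr_ge0// => i _.
by rewrite -expr2 sqr_ge0.
Qed.

Definition gaussmass n : R := Num.sqrt (2 * pi) ^+ n.

Lemma gaussmass_gt0 n : 0 < gaussmass n.
Proof. by rewrite exprn_gt0// sqrtr_gt0 mulr_gt0// pi_gt0. Qed.

Lemma cintegral_real n (u : 'rV[R]_n -> R) : cintegral (fun x => (u x)%:C) = (rint u)%:C.
Proof.
rewrite cintegralE; congr (_ +i* _).
by rewrite /rint /Rintegral integral0_eq.
Qed.

(* Both sides satisfy the differential equations d/du_i G = - u_i G. *)
Lemma fourier_stdgauss n (u : 'rV[R]_n) :
  cintegral (fun xi => (stdgauss xi)%:C * cis (dotp u xi)) = (gaussmass n * stdgauss u)%:C.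
Proof.
pose g : 'rV[R]_n -> C := fun x => (stdgauss x)%:C.
have gg : GS g := GS_stdgauss n.
(* The first block is a dummy variable, frozen at 0 where g = 1, so that the rules for the partial
   Fourier transform apply to a full one. *)
pose f := tensor g g; have gf : GS f := GS_tensor gg gg.
pose G y := pfourier 1 f (row_mx 0 y).
have GE y : G y = cintegral (fun xi => (stdgauss xi)%:C * cis (dotp y xi)).
  apply: eq_cintegral => xi; rewrite /f /tensor row_mxKl row_mxKl !row_mxKr /g stdgauss0.
  by rewrite [1%:C]/(1 : C) !mul1r.
have gd i : partial i g = fun x => (- 1) * lop (true, i) g x.
  apply: has_partialE => x; apply: has_partial_eq (has_partial_real (rpart_gauss i 2^-1 0 x)).
  rewrite /lop/= mulN1r -rmorphM -rmorphN/=; congr (_%:C); rewrite mxE subr0 divff//.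
  by rewrite mulN1r mulNr.
have fd i : partial (rshift n i) f = fun z => (-1) * lop (true, rshift n i) f z.
  apply: has_partialE => z; apply: has_partial_eq (@has_partial_tensorr _ _ _ g g i z (GS_smooth gg)).
  by rewrite gd /f /tensor /lop/= mxE mulN1r mulN1r mulrN mulrCA.
have hG i y : has_partial i G y (- (y 0 i)%:C * G y).
  apply: has_partial_eq (@has_partial_chain _ _ _ i (rshift n i) (fun y => row_mx 0 y) 1 (pfourier 1 f) y _ _
    (has_partial_pfourierr 1 i (row_mx 0 y) gf)).
    have := pfourier_parts i (row_mx 0 y) (mulr1 1) gf.
    rewrite fd (pfourierZ _ _ (GS_lop _ gf)) row_mxEr /G => E.
    by rewrite [1%:C]/(1 : C) mul1r mulNr E; ring.
  by move=> s; rewrite mul1r row_mx_dirr.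
(* The integrating factor of the equations: H has zero partial derivatives, hence equals its value
   at 0, the mass of the Gaussian. *)
pose H y := (expR (2^-1 * dotp y y))%:C * G y.
have hE i y : rpart i (fun y : 'rV[R]_n => expR (2^-1 * dotp y y)) y (y 0 i * expR (2^-1 * dotp y y)).
  have hd : rpart i (fun y : 'rV[R]_n => dotp y y) y (2 * y 0 i).
    apply: rpart_eq (rpart_sum _ (l := fun j => y 0 j * (i == j)%:R + y 0 j * (i == j)%:R) _).
      rewrite (bigD1 i)//= eqxx mulr1 big1 ?addr0; first by rewrite mulr_natl mulr2n.
      by move=> j ji; rewrite eq_sym (negbTE ji) mulr0 addr0.
    by move=> j; exact: rpartM (rpart_coord i j _) (rpart_coord i j _).
  have hd' := rpartM (rpart_cst i 2^-1 y) hd.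
  apply: rpart_eq (rpart_comp1 (is_derive_expR _) hd').
  by field.
have hH i y : has_partial i H y 0.
  apply: has_partial_eq (has_partialM (has_partial_real (hE i y)) (hG i y)).
  by rewrite [(_ * _)%:C]rmorphM/=; ring.
have H0 y : H y = H 0.
  apply: ReIm_inj.
    by apply: (rpart_zero_const (u := fun y => complex.Re (H y))) => i z; have [] := hH i z.
  by apply: (rpart_zero_const (u := fun y => complex.Im (H y))) => i z; have [] := hH i z.
have d0 (x : 'rV[R]_n) : dotp 0 x = 0 by rewrite /dotp big1// => i _; rewrite !mxE mul0r.
have G0 : G 0 = (gaussmass n)%:C.
  rewrite GE /gaussmass -rint_gauss_half -cintegral_real; apply: eq_cintegral => xi.
  by rewrite d0 cis0 mulr1.
have := H0 u; rewrite /H d0 mulr0 expR0 G0 [1%:C]/(1 : C) mul1r => E.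
rewrite -GE rmorphM/= -E mulrAC -rmorphM/= /stdgauss /gauss subr0 -expRD subrr expR0.
by rewrite [1%:C]/(1 : C) mul1r.
Qed.

Lemma cintegral_dilation_cvg n (v K : 'rV[R]_n -> C) (y : 'rV[R]_n) B c : ccontinuous v ->
  (forall x, normc (v x) <= B) -> cdom K c ->
  complex.Re (cintegral (fun u => v (y + (k.+1%:R^-1 : R) *: u) * K u)) @[k --> \oo] -->
    complex.Re (v y * cintegral K) /\
  complex.Im (cintegral (fun u => v (y + (k.+1%:R^-1 : R) *: u) * K u)) @[k --> \oo] -->
    complex.Im (v y * cintegral K).
Proof.
move=> [c1 c2] vB dK.
have b1 x : `|complex.Re (v x)| <= B by apply: le_trans (ler_normc_Re _) _.
have b2 x : `|complex.Im (v x)| <= B by apply: le_trans (ler_normc_Im _) _.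
have [m1 k1] := cdom_Re dK; have [m2 k2] := cdom_Im dK.
have bb (p q : 'rV[R]_n -> R) a : continuous p -> (forall x, `|p x| <= B) -> rmeas q ->
   (forall x, `|q x| <= c * weight x) -> rintegrable (fun u => p (y + a *: u) * q u).
  move=> cp pB mq qc; apply: (@dominated_rintegrable _ _ _ (B * c)).
    apply: (measurable_funM _ mq).
    have := rmeas_affine a y (continuous_rmeas cp).
    by rewrite /rmeas; under eq_fun do rewrite addrC.
  by move=> x; rewrite normrM -mulrA ler_pM.
have e1 : complex.Re (cintegral K) = rint (fun x => complex.Re (K x)) by [].
have e2 : complex.Im (cintegral K) = rint (fun x => complex.Im (K x)) by [].
pose vR (x : 'rV[R]_n) := complex.Re (v x); pose vI (x : 'rV[R]_n) := complex.Im (v x).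
split.
  rewrite ReM (_ : (fun k : nat => _) = (fun k => rint (fun u => vR (y + (k.+1%:R^-1 : R) *: u) * complex.Re (K u)) -
     rint (fun u => vI (y + (k.+1%:R^-1 : R) *: u) * complex.Im (K u)))); last first.
    apply/funext => k; rewrite cintegralE -rintB; [|exact: (bb vR)|exact: (bb vI)].
    by congr rint; apply/funext => u; rewrite ReM.
  rewrite e1 e2; apply: cvgB.
    exact: (@rint_dilation_cvg R n vR _ y B c c1 b1 m1 k1).
  exact: (@rint_dilation_cvg R n vI _ y B c c2 b2 m2 k2).
rewrite ImM (_ : (fun k : nat => _) = (fun k => rint (fun u => vR (y + (k.+1%:R^-1 : R) *: u) * complex.Im (K u)) +
   rint (fun u => vI (y + (k.+1%:R^-1 : R) *: u) * complex.Re (K u)))); last first.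
  apply/funext => k; rewrite cintegralE -rintD; [|exact: (bb vR)|exact: (bb vI)].
  by congr rint; apply/funext => u; rewrite ImM.
rewrite e1 e2; apply: cvgD.
  exact: (@rint_dilation_cvg R n vR _ y B c c1 b1 m2 k2).
exact: (@rint_dilation_cvg R n vI _ y B c c2 b2 m1 k1).
Qed.

Lemma scaled_fourier_stdgauss n (d : R) (z : 'rV[R]_n) : 0 < d ->
  cintegral (fun xi => (stdgauss (d *: xi))%:C * cis (dotp z xi)) =
  (d ^+ n)^-1%:C * (gaussmass n * stdgauss (d^-1 *: z))%:C.
Proof.
move=> d0; rewrite -fourier_stdgauss.
have [c _ gc] := GS_cdom (GS_stdgauss n).
have di : cdom (fun xi : 'rV[R]_n => (stdgauss xi)%:C * cis (dotp (d^-1 *: z) xi)) c.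
  apply: cdom_cis => //; have := rmeas_phase 1 (d^-1 *: z).
  by rewrite /rmeas; under eq_fun do rewrite mul1r.
rewrite (cintegral_affine (a := d) 0 _ (cdom_integrable di)) ?gt_eqF//.
rewrite gtr0_norm// mulrA -rmorphM/= mulVf ?mul1r ?gt_eqF ?exprn_gt0//.
apply: eq_cintegral => xi; rewrite addr0; congr (_ * cis _).
rewrite /dotp; apply: eq_bigr => i _; rewrite !mxE mulrACA mulVf ?mul1r// gt_eqF//.
Qed.

(* Gaussian summability: the means of [hat G * cis] against [stdgauss (d xi)] are computed
   by Fubini as means of [G] against a Gaussian of width [d]. *)
Lemma gauss_mean n (G : 'rV[R]_n -> C) c (y : 'rV[R]_n) (d : R) : 0 < d -> ccontinuous G -> cdom G c ->
  cintegral (fun xi => (stdgauss (d *: xi))%:C *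
     (cintegral (fun t => G t * cis (dotp t xi)) * cis (- dotp y xi))) =
  (gaussmass n)%:C * cintegral (fun u => G (y + d *: u) * (stdgauss u)%:C).
Proof.
move=> d0 cG dG.
have d20 : 0 < 2^-1 * d ^+ 2 by rewrite mulr_gt0 ?invr_gt0// exprn_gt0.
have gd xi : stdgauss (d *: xi) = gauss (2^-1 * d ^+ 2) (0 : 'rV[R]_n) xi.
  rewrite /stdgauss /gauss !subr0; congr (expR (- _)); rewrite -mulrA; congr (_ * _).
  by rewrite /dotp mulr_sumr; apply: eq_bigr => i _; rewrite !mxE; ring.
have [c' c'0 dg] := GS_cdom (GS_gauss (0 : 'rV[R]_n) d20).
pose H (z : 'rV[R]_(n + n)) := (gauss (2^-1 * d ^+ 2) 0 (lsubmx z))%:C * G (rsubmx z) *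
  cis (dotp (rsubmx z - y) (lsubmx z)).
have mr i := @rmeas_rsubmx R n n i; have ml i := @rmeas_lsubmx R n n i.
have G0 : 0 <= c by have [_ /dominated_coef_ge0] := dG.
have dH : cdom H (c' * c).
  apply: cdom_cis.
    apply: (@rmeas_dotp _ _ _ (fun z => rsubmx z - y) (fun z => lsubmx z)) => // i.
    rewrite (_ : (fun z => (rsubmx z - y) 0 i) = (fun z => rsubmx z 0 i - y 0 i)).
      exact: (rmeasB (mr i) (rmeas_cst (y 0 i))).
    by apply/funext => z; rewrite [LHS]mxE; congr (_ + _); rewrite mxE.
  split.
    apply: cmeasurableM.
      exact: (ccontinuous_cmeasurable_comp (smooth_cont (GS_smooth (GS_gauss 0 d20))) ml).
    exact: (ccontinuous_cmeasurable_comp cG mr).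
  move=> z; rewrite -[z in weight z]hsubmxK weight_row_mx normcM mulrACA.
  by rewrite ler_pM ?normc_ge0//; [have [_] := dg; exact|have [_] := dG; exact].
rewrite (_ : (fun xi => _) = (fun xi => cintegral (fun t => H (row_mx xi t)))); last first.
  apply/funext => xi.
  have dGc : cdom (fun t => G t * cis (dotp t xi)) c.
    by apply: cdom_cis => //; apply: (@rmeas_dotp _ _ _ id (fun=> xi)) => i; [exact: rmeas_coord|exact: rmeas_cst].
  rewrite mulrCA -(mulrC (_ * _)) -cintegralZ; last exact: cdom_integrable dGc.
  apply: eq_cintegral => t; rewrite /H row_mxKl row_mxKr -gd.
  have -> : dotp (t - y) xi = dotp t xi - dotp y xi.
    by rewrite /dotp -sumrB; apply: eq_bigr => i _; rewrite !mxE mulrBl.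
  by rewrite cisD; ring.
rewrite -(cintegral_fubini1 dH) (cintegral_fubini2 dH).
have E t : cintegral (fun xi => H (row_mx xi t)) =
    ((d ^+ n)^-1 * gaussmass n)%:C * (G t * (stdgauss (d^-1 *: (t - y)))%:C).
  transitivity (G t * cintegral (fun xi => (stdgauss (d *: xi))%:C * cis (dotp (t - y) xi))).
    rewrite -cintegralZ.
      by apply: eq_cintegral => xi; rewrite /H row_mxKl row_mxKr gd mulrAC mulrCA mulrA mulrC mulrA.
    apply: (@cdom_integrable _ _ _ c'); apply: cdom_cis.
      by apply: (@rmeas_dotp _ _ _ (fun=> t - y) id) => i; [exact: rmeas_cst|exact: rmeas_coord].
    by have := dg; congr (cdom _ _); apply/funext => xi; rewrite gd.
  by rewrite scaled_fourier_stdgauss// !rmorphM/=; ring.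
have dn0 : 0 < d ^+ n by rewrite exprn_gt0.
have dT : cdom (fun t => G t * (stdgauss (d^-1 *: (t - y)))%:C) (1 * c).
  rewrite (_ : (fun t => _) = (fun t => (stdgauss (d^-1 *: (t - y)))%:C * G t)); last first.
    by apply/funext => t; rewrite mulrC.
  apply: cdomM => //; last by move=> t; rewrite normc_real stdgauss_le1.
  apply: (ccontinuous_cmeasurable_comp (smooth_cont (GS_smooth (GS_stdgauss n)))) => i.
  rewrite (_ : (fun t : 'rV[R]_n => (d^-1 *: (t - y)) 0 i) = (fun t => d^-1 * (t 0 i - y 0 i))).
    exact: (rmeasM (rmeas_cst d^-1) (rmeasB (rmeas_coord i) (rmeas_cst (y 0 i)))).
  by apply/funext => t; rewrite !mxE.
rewrite (eq_cintegral E) (cintegralZ _ (cdom_integrable dT)).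
rewrite (cintegral_affine (a := d) y _ (cdom_integrable dT)) ?gt_eqF// gtr0_norm//.
rewrite mulrA -rmorphM/=.
rewrite (_ : (d ^+ n)^-1 * gaussmass n * d ^+ n = gaussmass n); last by field; rewrite gt_eqF.
apply: (congr1 (fun z => (gaussmass n)%:C * z)).
apply: eq_cintegral => u; rewrite [d *: u + y]addrC; congr (_ * (stdgauss _)%:C).
by rewrite addrAC subrr add0r scalerA mulVf ?scale1r// gt_eqF.
Qed.

Lemma cvg_eq_seq (u v : nat -> R) (a b : R^o) : (forall k, u k = v k) ->
  u k @[k --> \oo] --> a -> v k @[k --> \oo] --> b -> a = b.
Proof.
move=> /funext-> va vb.
by rewrite -(cvg_lim (@Rhausdorff R) va) -(cvg_lim (@Rhausdorff R) vb).
Qed.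

(** Let the width d = 1/(k + 1) tend to 0 in [gauss_mean]: the left-hand side tends to the integral
    without the Gaussian, the right-hand side to G(y) times a mass. One factor [gaussmass] comes
    from [gauss_mean], the other is this mass; together they give (2 pi)^n. *)
Lemma fourier_inversion n (G : 'rV[R]_n -> C) c c' (y : 'rV[R]_n) : ccontinuous G -> cdom G c ->
  cdom (fun xi => cintegral (fun t => G t * cis (dotp t xi))) c' ->
  cintegral (fun xi => cintegral (fun t => G t * cis (dotp t xi)) * cis (- dotp y xi)) =
  (gaussmass n * gaussmass n)%:C * G y.
Proof.
move=> cG dG dGh.
pose K xi := cintegral (fun t => G t * cis (dotp t xi)) * cis (- dotp y xi).
have dK : cdom K c'.
  apply: cdom_cis => //; apply: measurable_funN.
  by apply: (@rmeas_dotp _ _ _ (fun=> y) id) => i; [exact: rmeas_cst|exact: rmeas_coord].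
have [cg ccg dg] := GS_cdom (GS_stdgauss n).
have c0 : 0 <= c by have [_ /dominated_coef_ge0] := dG.
have Gb x : normc (G x) <= c by have [_ /(_ x)/le_trans] := dG; apply; rewrite weight_coef_le.
have b1 (x : 'rV[R]_n) : normc ((stdgauss x)%:C : C) <= 1 :> R by rewrite normc_real stdgauss_le1.
have L := @cintegral_dilation_cvg n (fun x => (stdgauss x)%:C) K 0 1 c' (smooth_cont (GS_smooth (GS_stdgauss n))) b1 dK.
have M := @cintegral_dilation_cvg n G (fun u => ((gaussmass n)%:C : C) * (stdgauss u)%:C) y c _ cG Gb (cdomZ _ dg).
have E (k : nat) : cintegral (fun u => (stdgauss (0 + (k.+1%:R^-1 : R) *: u))%:C * K u) =
    cintegral (fun u => G (y + (k.+1%:R^-1 : R) *: u) * (((gaussmass n)%:C : C) * (stdgauss u)%:C)).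
  have k0 : 0 < (k.+1%:R^-1 : R) by rewrite invr_gt0.
  under eq_cintegral do rewrite add0r.
  rewrite /K (gauss_mean y k0 cG dG) -cintegralZ.
    by apply: eq_cintegral => u; rewrite mulrCA.
  apply: (@cdom_integrable _ _ _ (c * cg)); apply: cdomM => //.
  apply: (ccontinuous_cmeasurable_comp cG) => i.
  rewrite (_ : (fun t : 'rV[R]_n => (y + (k.+1%:R^-1 : R) *: t) 0 i) = (fun t => y 0 i + (k.+1%:R^-1 : R) * t 0 i)).
    exact: (rmeasD (rmeas_cst (y 0 i)) (rmeasM (rmeas_cst _) (rmeas_coord i))).
  by apply/funext => t; rewrite !mxE.
have mE : cintegral (fun u : 'rV[R]_n => ((gaussmass n)%:C : C) * (stdgauss u)%:C) = (gaussmass n * gaussmass n)%:C.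
  rewrite (cintegralZ _ (cdom_integrable dg)) cintegral_real.
  by rewrite [rint _]rint_gauss_half -/(gaussmass n) -rmorphM.
rewrite stdgauss0 [1%:C]/(1 : C) mul1r in L; rewrite mE in M.
rewrite -/K [RHS]mulrC; apply: ReIm_inj.
  by apply: cvg_eq_seq L.1 M.1 => k; rewrite E.
by apply: cvg_eq_seq L.2 M.2 => k; rewrite E.
Qed.

(** If all Gaussian means centred at x0 vanished, letting the width tend to 0 would give f(x0) =
    0. *)
Lemma gauss_test_nonzero n (f : 'rV[R]_n -> C) B x0 : ccontinuous f -> (forall x, normc (f x) <= B) ->
  f x0 != 0 -> exists2 a : R, 0 < a & cintegral (fun x => f x * (gauss a x0 x)%:C) != 0.
Proof.
move=> cf fB fx0; have [cg ccg dg] := GS_cdom (GS_stdgauss n).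
have [L1 L2] := @cintegral_dilation_cvg n f (fun u => (stdgauss u)%:C) x0 B _ cf fB dg.
have mE : cintegral (fun u : 'rV[R]_n => (stdgauss u)%:C) = (gaussmass n)%:C.
  by rewrite cintegral_real [rint _]rint_gauss_half.
rewrite mE in L1 L2.
apply/not_exists2P => H.
have Z (k : nat) : cintegral (fun u => f (x0 + (k.+1%:R^-1 : R) *: u) * (stdgauss u)%:C) = 0.
  have k0 : 0 < (k.+1%:R^-1 : R) by rewrite invr_gt0.
  set d : R := k.+1%:R^-1 in k0 *.
  (* The Gaussian of parameter 1/(2 d^2) is [stdgauss] dilated by d around x0. *)
  have a0 : 0 < 2^-1 * d ^- 2 by rewrite mulr_gt0 ?invr_gt0// exprn_gt0.
  have [//|] := H (2^-1 * d ^- 2); move/negP; rewrite negbK => /eqP H0.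
  have [cg' ccg' dg'] := GS_cdom (GS_gauss x0 a0).
  have di : cdom (fun x => f x * (gauss (2^-1 * d ^- 2) x0 x)%:C) (B * cg').
    apply: cdomM => //; first by apply: le_trans (normc_ge0 _) (fB 0).
    exact: ccontinuous_cmeasurable.
  move: H0; rewrite (cintegral_affine (a := d) x0 _ (cdom_integrable di)) ?gt_eqF// => /eqP.
  rewrite mulf_eq0 => /orP[|/eqP].
    by rewrite eq_complex/= eqxx andbT gt_eqF// exprn_gt0// normr_gt0 gt_eqF.
  move=> <-; apply: eq_cintegral => u; rewrite [d *: u + x0]addrC; congr (_ * _%:C).
  rewrite /stdgauss /gauss subr0 addrAC subrr add0r; congr (expR (- _)); rewrite -mulrA; congr (_ * _).
  rewrite /dotp mulr_sumr; apply: eq_bigr => i _; rewrite !mxE.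
  transitivity ((d ^- 2 * d ^+ 2) * (u 0 i * u 0 i)); first by rewrite mulVf ?mul1r// sqrf_eq0 gt_eqF.
  by rewrite -mulrA; congr (_ * _); rewrite expr2 mulrACA.
have E0 : f x0 * (gaussmass n)%:C = 0.
  apply: ReIm_inj.
    by apply: cvg_eq_seq L1 (cvg_cst 0) => k; rewrite Z.
  by apply: cvg_eq_seq L2 (cvg_cst 0) => k; rewrite Z.
move/eqP: E0; rewrite mulf_eq0 (negbTE fx0)/= eq_complex/= eqxx andbT.
by rewrite gt_eqF// gaussmass_gt0.
Qed.

End fourier_inversion.

(** * Factorial bounds and exponential decay *)

Section growth.
Context {R : realType}.
Local Notation C := R[i].
Variable s : R.
Hypothesis s0 : 0 < s.

Lemma powR_fact_le a b : (a`!)%:R `^ s * (b`!)%:R `^ s <= ((a + b)`!)%:R `^ s :> R.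
Proof.
rewrite -powRM// ge0_ler_powR ?nnegrE// ?(ltW s0)// -natrM ler_nat.
by rewrite -(bin_fact (leq_addr b a)) addKn leq_pmull// bin_gt0 leq_addr.
Qed.

Lemma fact_le_expn n m : (n <= m -> n`! <= m ^ n)%N.
Proof.
elim: n => [|n IH] nm; first by rewrite fact0 expn0.
by rewrite factS expnS leq_mul// IH// ltnW.
Qed.

Lemma powR_Xn (x r : R) n : 0 <= x -> (x ^+ n) `^ r = (x `^ r) ^+ n.
Proof.
move=> x0; elim: n => [|n IH]; first by rewrite !expr0 powR1.
by rewrite !exprS powRM ?exprn_ge0// IH.
Qed.

Lemma powR_expR (x r : R) : (expR x) `^ r = expR (r * x).
Proof. by rewrite /powR gt_eqF ?expR_gt0// expRK. Qed.

Lemma powRVK (x : R) : 0 <= x -> (x `^ s^-1) `^ s = x.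
Proof. by move=> x0; rewrite -powRrM mulVf ?gt_eqF// powRr1. Qed.

(* Optimal choice of the order: n is the integer part of u / e, where t = eps u^s. *)
Lemma exp_decay_of_factorial (F t C0 e : R) : 0 <= t -> 0 < e -> 0 <= C0 ->
  (forall n, F * t ^+ n <= C0 * (e ^+ n * (n`!)%:R `^ s)) ->
  F <= C0 * expR s * expR (- (s / expR 1 * (t / e) `^ s^-1)).
Proof.
move=> t0 e0 C00 H; set u := (t / e) `^ s^-1.
have e1 : 0 < expR 1 :> R := expR_gt0 _.
have u0 : 0 <= u := powR_ge0 _ _.
have te : 0 <= t / e by rewrite divr_ge0// ltW.
pose n := Num.trunc (u / expR 1).
have nu : n%:R <= u / expR 1 by rewrite truncn_le// divr_ge0// ltW.
have nu' : u / expR 1 < n%:R + 1 by rewrite natr1 truncnS_gt.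
have Hn : F <= C0 * expR (- s * n%:R).
  have [n00|n00] := eqVneq n 0%N.
    have := H 0%N; rewrite !expr0 fact0 powR1 !mulr1 => F0.
    by rewrite n00 mulr0 expR0 mulr1.
  have n0 : 0 < n%:R :> R by rewrite ltr0n lt0n.
  have up : 0 < u.
    by rewrite lt_neqAle u0 andbT; apply/eqP => u00; move: nu; rewrite -u00 mul0r leNgt n0.
  have tp : 0 < t.
    rewrite lt_neqAle t0 andbT; apply/eqP => t00; move: up.
    by rewrite /u -t00 mul0r powR0 ?ltxx// invr_eq0 gt_eqF.
  have us : u `^ s = t / e by rewrite powRVK.
  rewrite -(ler_pM2r (exprn_gt0 n tp)); apply: le_trans (H n) _.
  rewrite -mulrA ler_wpM2l//.
  (* n! <= n^n reduces the n-th bound to e n^s <= t exp(-s), which is what n <= u / expR 1 gives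
     since u^s = t / e. *)
  have fn : (n`!)%:R `^ s <= (n%:R `^ s) ^+ n :> R.
    rewrite -powR_Xn// ge0_ler_powR ?nnegrE ?exprn_ge0// ?(ltW s0)// -natrX ler_nat.
    exact: fact_le_expn.
  rewrite (le_trans (ler_wpM2l _ fn)) ?exprn_ge0 ?(ltW e0)// -exprMn.
  rewrite expRM_natr -exprMn lerXn2r ?nnegrE ?mulr_ge0 ?powR_ge0 ?expR_ge0 ?(ltW e0)//.
  rewrite (le_trans (ler_wpM2l (ltW e0) (_ : _ <= (u / expR 1) `^ s)))//.
    by rewrite ge0_ler_powR ?nnegrE ?divr_ge0// ?(ltW s0)// ?ltW.
  rewrite powRM ?invr_ge0 ?(ltW e1)// us -expRN powR_expR mulrN1 mulrA mulrC.
  by rewrite [e * _]mulrC divfK// gt_eqF.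
(* As n > u / expR 1 - 1, taking the integer part costs at most the factor [expR s]. *)
apply: le_trans Hn _; rewrite -mulrA ler_wpM2l// -expRD ler_expR.
rewrite mulrAC -[_ / expR 1]mulrA mulNr lerNl opprB lerBlDr.
by rewrite -[X in _ <= _ + X]mulr1 -mulrDr ler_wpM2l// ltW.
Qed.

(** The inequality u^k <= k! exp(u) for u = (a / s) t^(1/s), raised to the power s. *)
Lemma factorial_of_exp_decay (t a : R) k : 0 <= t -> 0 < a ->
  t ^+ k * expR (- (a * t `^ s^-1)) <= ((s / a) `^ s) ^+ k * (k`!)%:R `^ s.
Proof.
move=> t0 a0; pose u := a / s * t `^ s^-1.
have u0 : 0 <= u by rewrite mulr_ge0 ?powR_ge0// divr_ge0// ltW.
have := exp_term_le k u0.
move=> /(ge0_ler_powR (ltW s0)); rewrite !nnegrE exprn_ge0// mulr_ge0 ?expR_ge0// => /(_ isT isT).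
have v0 : 0 <= a / s by rewrite divr_ge0// ltW.
rewrite powR_Xn// /u (powRM _ v0 (powR_ge0 _ _)) powRVK// exprMn [(_%:R * _) `^ _]powRM ?expR_ge0//.
rewrite powR_expR [s * _]mulrA [s * _]mulrC divfK ?gt_eqF// => H.
rewrite expRN ler_pdivrMr ?expR_gt0//.
have p0 : 0 < (a / s) `^ s by rewrite powR_gt0// divr_gt0.
rewrite -[s / a]invf_div (_ : ((a / s)^-1) `^ s = ((a / s) `^ s)^-1).
  by rewrite exprVn -mulrA -ler_pdivrMl ?invr_gt0 ?exprn_gt0// invrK.
by rewrite -[in LHS]powR_inv1// -powRrM mulN1r powRN.
Qed.

(** The same inequality for u = a^(1/s), raised to the power s. *)
Lemma pow_le_factorial (a : R) : 0 <= a -> exists2 A : R, 0 < A & forall k, a ^+ k <= A * (k`!)%:R `^ s.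
Proof.
move=> a0; exists (expR (s * a `^ s^-1)); first exact: expR_gt0.
move=> k; have := exp_term_le k (powR_ge0 a s^-1).
move=> /(ge0_ler_powR (ltW s0)); rewrite !nnegrE exprn_ge0 ?powR_ge0// mulr_ge0 ?expR_ge0// => /(_ isT isT).
by rewrite powR_Xn ?powR_ge0// powRVK// [(_%:R * _) `^ _]powRM ?expR_ge0// powR_expR mulrC.
Qed.

Definition enormp n (x : 'rV[R]_n) : R := enorm x `^ s^-1.

Lemma enormp_ge0 n (x : 'rV[R]_n) : 0 <= enormp x.
Proof. exact: powR_ge0. Qed.

Lemma dotp_ge0 n (x : 'rV[R]_n) : 0 <= dotp x x.
Proof. by apply: sumr_ge0 => i _; rewrite -expr2 sqr_ge0. Qed.

Lemma enorm_ge0 n (x : 'rV[R]_n) : 0 <= enorm x.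
Proof. exact: sqrtr_ge0. Qed.

Lemma enorm_dotp n (x : 'rV[R]_n) : enorm x ^+ 2 = dotp x x.
Proof. by rewrite sqr_sqrtr// dotp_ge0. Qed.

Lemma enorm_le_sqr n (x : 'rV[R]_n) (b : R) : 0 <= b -> (enorm x <= b) = (dotp x x <= b ^+ 2).
Proof. by move=> b0; rewrite -enorm_dotp ler_pXn2r// nnegrE ?enorm_ge0. Qed.

Lemma enormN n (x : 'rV[R]_n) : enorm (- x) = enorm x.
Proof. by congr Num.sqrt; apply: eq_bigr => i _; rewrite !mxE mulrNN. Qed.

Lemma enormD_max n (x y : 'rV[R]_n) : enorm (x + y) <= 2 * Num.max (enorm x) (enorm y).
Proof.
set M := Num.max _ _.
have M0 : 0 <= M by rewrite le_max enorm_ge0.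
rewrite enorm_le_sqr ?mulr_ge0//.
have h (z : 'rV[R]_n) : enorm z <= M -> dotp z z <= M ^+ 2 by rewrite enorm_le_sqr.
have hx : dotp x x <= M ^+ 2 by apply: h; rewrite le_max lexx.
have hy : dotp y y <= M ^+ 2 by apply: h; rewrite le_max lexx orbT.
have : dotp (x + y) (x + y) <= 2 * dotp x x + 2 * dotp y y.
  rewrite /dotp !mulr_sumr -big_split; apply: ler_sum => i _; rewrite !mxE/=.
  by have := sqr_ge0 (x 0 i - y 0 i); nra.
by rewrite exprMn; lra.
Qed.

(** The constant of the quasi-triangle inequality for |x|^(1/s), a power that is not subadditive
    when s < 1. *)
Definition qtri : R := 2 `^ s^-1.

Lemma qtri_gt0 : 0 < qtri.
Proof. exact: powR_gt0. Qed.

Lemma enormpD n (x y : 'rV[R]_n) : enormp (x + y) <= qtri * (enormp x + enormp y).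
Proof.
have si : 0 <= s^-1 by rewrite invr_ge0 ltW.
have M0 : 0 <= Num.max (enorm x) (enorm y) by rewrite le_max enorm_ge0.
rewrite (le_trans (ge0_ler_powR si _ _ (enormD_max x y))) ?nnegrE ?enorm_ge0 ?mulr_ge0//.
rewrite powRM// ler_wpM2l ?powR_ge0//.
by rewrite maxEle; case: ifP => _; [rewrite lerDr|rewrite lerDl]; exact: powR_ge0.
Qed.

Lemma enormpB n (x y : 'rV[R]_n) : enormp y <= qtri * (enormp x + enormp (y - x)).
Proof. by rewrite (le_trans _ (enormpD _ _))// addrC subrK. Qed.

Lemma enormpB_sym n (x y : 'rV[R]_n) : enormp x <= qtri * (enormp y + enormp (y - x)).
Proof.
apply: le_trans (enormpB y x) _; apply: ler_wpM2l; first exact: ltW qtri_gt0.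
by apply: lerD; [exact: lexx|rewrite /enormp -enormN opprB].
Qed.

Lemma coord_le_enorm n (x : 'rV[R]_n) i : `|x 0 i| <= enorm x.
Proof.
rewrite -sqrtr_sqr ler_wsqrtr// /dotp (bigD1 i)//= -expr2 lerDl.
by apply: sumr_ge0 => j _; rewrite -expr2 sqr_ge0.
Qed.

(** The coordinate of largest modulus is taken; the first alternative covers dimension 0, where
    there is none. *)
Lemma enorm_le_coord n (x : 'rV[R]_n) : enorm x = 0 \/ exists j, enorm x <= n.+1%:R * `|x 0 j|.
Proof.
case: n x => [|n] x; first by left; rewrite /enorm /dotp big_ord0 sqrtr0.
right; case: (@arg_maxP _ _ _ ord0 xpredT (fun j => `|x 0 j|) isT) => j _ jP; exists j.
have nn : 0 <= n.+2%:R * `|x 0 j| by rewrite mulr_ge0.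
rewrite enorm_le_sqr// exprMn.
apply: (@le_trans _ _ (\sum_(i < n.+1) `|x 0 j| ^+ 2)).
  apply: ler_sum => i _; rewrite -expr2 -real_normK ?num_real// lerXn2r ?nnegrE//.
  exact: jP.
rewrite sumr_const card_ord -[leLHS]mulr_natl ler_wpM2r ?exprn_ge0//.
by rewrite -natrX ler_nat -mulnn (leq_trans (leqnSn _))// leq_pmulr.
Qed.

(* The decay rate in |x|^(1/s) produced by bounds [e^k k!^s] on all [|x_j|^k F]. *)
Definition drate n (e : R) : R := s / expR 1 * (n.+1%:R * e)^-1 `^ s^-1.

Lemma drate_gt0 n e : 0 < e -> 0 < drate n e.
Proof.
by move=> e0; rewrite mulr_gt0 ?divr_gt0 ?expR_gt0// powR_gt0// invr_gt0 mulr_gt0.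
Qed.

(** Converts a prescribed decay rate into the base of the factorial bounds that produce it; large
    rates correspond to small bases. *)
Lemma drate_surj n r : 0 < r -> exists2 e, 0 < e & drate n e = r.
Proof.
move=> r0; pose q := (expR 1 / s * r) `^ s.
have q0 : 0 < q by rewrite powR_gt0// mulr_gt0// divr_gt0// expR_gt0.
exists (n.+1%:R^-1 * q^-1); first by rewrite mulr_gt0 ?invr_gt0.
rewrite /drate mulVKf// invrK /q -powRrM mulfV ?gt_eqF// powRr1.
  by rewrite mulrA mulrA divfK ?gt_eqF ?expR_gt0// divff ?mul1r// gt_eqF.
by rewrite mulr_ge0 ?divr_ge0 ?expR_ge0// ltW.
Qed.

(** One-dimensional decay in the largest coordinate, which is comparable to |x|. The bound [F <= C0]
    settles |x| = 0. *)
Lemma enormp_decay n (x : 'rV[R]_n) (F C0 e : R) : 0 < e -> 0 <= C0 -> F <= C0 ->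
  (forall j k, F * `|x 0 j| ^+ k <= C0 * (e ^+ k * (k`!)%:R `^ s)) ->
  F <= C0 * expR s * expR (- (drate n e * enormp x)).
Proof.
move=> e0 C00 F0 H; have [x0|[j xj]] := enorm_le_coord x.
  rewrite /enormp x0 powR0 ?invr_eq0 ?gt_eqF// mulr0 oppr0 expR0 mulr1.
  by rewrite (le_trans F0)// ler_peMr// -expR0 ler_expR ltW.
apply: le_trans (exp_decay_of_factorial (normr_ge0 (x 0 j)) e0 C00 (H j)) _.
rewrite ler_wpM2l ?mulr_ge0 ?expR_ge0// ler_expR lerN2 /drate -mulrA.
rewrite ler_wpM2l ?divr_ge0 ?expR_ge0 ?(ltW s0)//.
have ie : 0 <= (n.+1%:R * e)^-1 by rewrite invr_ge0 mulr_ge0// ltW.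
rewrite /enormp -powRM ?enorm_ge0// ge0_ler_powR ?nnegrE ?invr_ge0 ?(ltW s0)//.
- by rewrite mulr_ge0 ?enorm_ge0.
- by rewrite divr_ge0// ltW.
- by rewrite invfM mulrAC ler_wpM2r ?invr_ge0 ?(ltW e0)// ler_pdivrMl.
Qed.

Lemma enorm_factorial n (x : 'rV[R]_n) a k : 0 < a ->
  enorm x ^+ k * expR (- (a * enormp x)) <= ((s / a) `^ s) ^+ k * (k`!)%:R `^ s.
Proof. by move=> a0; apply: factorial_of_exp_decay => //; exact: enorm_ge0. Qed.

(** The inverse weight is at most 2^n (1 + |x|^(2n)), and the power of |x| is absorbed by the
    exponential through [enorm_factorial]. *)
Lemma enormp_weight n r : 0 < r -> exists2 c : R, 0 < c &
  forall x : 'rV[R]_n, expR (- (r * enormp x)) <= c * weight x.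
Proof.
move=> r0; pose b := ((s / r) `^ s) ^+ (2 * n) * ((2 * n)`!)%:R `^ s.
have b0 : 0 <= b by rewrite mulr_ge0 ?exprn_ge0 ?powR_ge0.
exists (2 ^+ n * (1 + b)); first by rewrite mulr_gt0 ?exprn_gt0// ltr_wpDr.
move=> x; rewrite -ler_pdivrMr ?weight_gt0//.
have wE : (weight x)^-1 <= 2 ^+ n * (1 + enorm x ^+ (2 * n)).
  rewrite /weight prodfV invrK.
  have : \prod_i (1 + x 0 i ^+ 2) <= (1 + enorm x ^+ 2) ^+ n.
    rewrite -[X in _ ^+ X](card_ord n) -prodr_const; apply: ler_prod => i _.
    rewrite addr_ge0 ?sqr_ge0// lerD2l -real_normK ?num_real// lerXn2r ?nnegrE ?enorm_ge0//.
    exact: coord_le_enorm.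
  move=> /le_trans; apply; rewrite exprM; set a := enorm x ^+ 2.
  have a0 : 0 <= a by rewrite exprn_ge0// enorm_ge0.
  clearbody a.
  have [a1|a1] := leP a 1.
    apply: (@le_trans _ _ (2 ^+ n)); first by rewrite lerXn2r ?nnegrE ?addr_ge0//; lra.
    by rewrite ler_peMr ?exprn_ge0// lerDl exprn_ge0.
  apply: (@le_trans _ _ ((2 * a) ^+ n)); first by rewrite lerXn2r ?nnegrE ?addr_ge0 ?mulr_ge0//; lra.
  by rewrite exprMn ler_wpM2l ?exprn_ge0// lerDr.
rewrite (le_trans (ler_wpM2l (expR_ge0 _) wE))// mulrCA ler_wpM2l ?exprn_ge0//.
rewrite mulrDr mulr1 lerD//.
  by rewrite -expR0 ler_expR oppr_le0 mulr_ge0 ?enormp_ge0// ltW.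
by rewrite mulrC; exact: enorm_factorial.
Qed.

End growth.

(** * Decay of functions of S_{1/2} and Sigma_s, for s > 1/2 *)

Section decay.
Context {R : realType}.
Local Notation C := R[i].
Variable s : R.
Hypothesis hs : 2^-1 < s.
Let s0 : 0 < s. Proof. by apply: lt_trans hs; rewrite invr_gt0. Qed.

Lemma sqfactD_le a b : sqfact (a + b) <= 2 ^+ (a + b) * (sqfact a * sqfact b) :> R.
Proof.
have h : (sqfact (a + b) : R) ^+ 2 <= (2 ^+ (a + b) * (sqfact a * sqfact b)) ^+ 2.
  rewrite !exprMn !sqr_sqrtr// -!natrX -!natrM ler_nat (leq_trans (factD_le _ _))//.
  by rewrite leq_mul2r -mulnn leq_pmulr ?orbT// expn_gt0.
by rewrite -(@ler_pXn2r _ 2)// nnegrE ?mulr_ge0 ?exprn_ge0 ?sqfact_ge0.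
Qed.

(** Here s > 1/2 enters: (h / e)^k is at most a constant times k!^(s - 1/2), however small e is. *)
Lemma sqfact_powR (h e : R) : 0 <= h -> 0 < e ->
  exists2 A : R, 1 <= A & forall k, h ^+ k * sqfact k <= A * (e ^+ k * (k`!)%:R `^ s).
Proof.
move=> h0 e0; have t0 : 0 < s - 2^-1 by rewrite subr_gt0.
have [A A0 HA] := pow_le_factorial t0 (divr_ge0 h0 (ltW e0)).
exists A; first by have := HA 0%N; rewrite expr0 fact0 powR1 mulr1.
move=> k; have f0 : (k`!)%:R != 0 :> R by rewrite pnatr_eq0 -lt0n fact_gt0.
have := HA k; rewrite expr_div_n ler_pdivrMr ?exprn_gt0// => H.
apply: le_trans (ler_wpM2r (sqfact_ge0 _) H) _; apply: eq_ler.
have -> : (k`!)%:R `^ s = (k`!)%:R `^ (s - 2^-1) * sqfact k :> R.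
  by rewrite /sqfact -powR12_sqrt// -powRD ?subrK ?f0 ?implybT.
by rewrite mulrA mulrA mulrAC [A * e ^+ k * _]mulrAC mulrAC.
Qed.

Lemma wop_nseq n k (i : 'I_n) (w : seq (letter n)) (f : 'rV[R]_n -> C) x :
  wop (nseq k (true, i) ++ w) f x = (x 0 i ^+ k)%:C * wop w f x.
Proof.
elim: k => [|k IH]; first by rewrite expr0 [1%:C]/(1 : C) mul1r.
by rewrite exprS rmorphM/= -mulrA -IH.
Qed.

(** The S_{1/2} bound for the word x_j^k w is a factorial bound on |x_j|^k |w f|. By [sqfact_powR]
    its base may be chosen at will, hence so may the rate r. *)
Lemma GS_decay n (f : 'rV[R]_n -> C) r : GS f -> 0 < r -> exists c h : R,
  [/\ 0 <= c, 1 <= h & forall w x,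
   normc (wop w f x) <= c * h ^+ size w * sqfact (size w) * expR (- (r * enormp s x))].
Proof.
move=> [sf [c [h [c0 h1 H]]]] r0.
have [e e0 <-] := drate_surj s0 n r0.
have h20 : 0 <= 2 * h by rewrite mulr_ge0// (le_trans _ h1).
have [A A1 HA] := sqfact_powR h20 e0.
exists (c * A * expR s), (2 * h); split; first by rewrite mulr_ge0 ?expR_ge0// mulr_ge0// (le_trans _ A1).
  by lra.
move=> w x; set m := size w.
pose C0 := c * (2 * h) ^+ m * sqfact m * A.
have C00 : 0 <= C0 by rewrite /C0 !mulr_ge0 ?exprn_ge0 ?sqfact_ge0// (le_trans _ A1).
have key j k : normc (wop w f x) * `|x 0 j| ^+ k <= C0 * (e ^+ k * (k`!)%:R `^ s).
  have := H (nseq k (true, j) ++ w) x.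
  rewrite wop_nseq normcM normc_real normrX mulrC size_cat size_nseq -/m => /le_trans; apply.
  rewrite (le_trans (ler_wpM2l _ (sqfactD_le _ _))) ?mulr_ge0 ?exprn_ge0 ?(le_trans _ h1)//.
  have -> : c * h ^+ (k + m) * (2 ^+ (k + m) * (sqfact k * sqfact m)) =
     c * (2 * h) ^+ m * sqfact m * ((2 * h) ^+ k * sqfact k) by rewrite !exprMn !exprD; ring.
  by rewrite /C0 -[leRHS]mulrA ler_wpM2l ?mulr_ge0 ?exprn_ge0 ?sqfact_ge0.
have F0 : normc (wop w f x) <= C0.
  apply: le_trans (H w x) _; rewrite -/m /C0.
  apply: (@le_trans _ _ (c * (2 * h) ^+ m * sqfact m)).
    rewrite ler_wpM2r ?sqfact_ge0// ler_wpM2l// lerXn2r ?nnegrE//; lra.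
  by rewrite ler_peMr// !mulr_ge0 ?exprn_ge0 ?sqfact_ge0.
apply: le_trans (enormp_decay s0 e0 C00 F0 key) _; apply: eq_ler.
by rewrite /C0 -/m; ring.
Qed.

Lemma enum_iter_single (n : nat) (j : 'I_n) k (f : 'rV[R]_n -> C) (r : seq 'I_n) : uniq r ->
  foldr (fun i g => iter ([ffun i => if i == j then k else 0%N] i) (partial i) g) f r =
  if j \in r then iter k (partial j) f else f.
Proof.
elim: r => //= i r IH /andP[ir ur]; rewrite IH// ffunE in_cons.
by have [ij|//] := eqVneq i j; rewrite ij in ir *; rewrite (negbTE ir).
Qed.

Definition mono_index n (j : 'I_n) k : multi_index n := [ffun i => if i == j then k else 0%N].

Lemma mderiv_mono_index n (j : 'I_n) k (f : 'rV[R]_n -> C) :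
  mderiv (mono_index j k) f = iter k (partial j) f.
Proof. by rewrite /mderiv enum_iter_single ?enum_uniq// mem_enum. Qed.

Lemma mlen_mono_index n (j : 'I_n) k : mlen (mono_index j k) = k.
Proof.
rewrite /mlen (bigD1 j)//= ffunE eqxx big1 ?addn0// => i ij.
by rewrite ffunE (negbTE ij).
Qed.

Lemma mfact_mono_index n (j : 'I_n) k : mfact (mono_index j k) = k`!.
Proof.
rewrite /mfact (bigD1 j)//= ffunE eqxx big1 ?muln1// => i ij.
by rewrite ffunE (negbTE ij).
Qed.

Lemma mpow_mono_index n (x : 'rV[R]_n) (j : 'I_n) k : mpow x (mono_index j k) = x 0 j ^+ k.
Proof.
rewrite /mpow (bigD1 j)//= ffunE eqxx big1 ?mulr1// => i ij.
by rewrite ffunE (negbTE ij) expr0.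
Qed.

Lemma mderiv_zero_index n (f : 'rV[R]_n -> C) : mderiv (zero_index n) f = f.
Proof. by rewrite /mderiv; elim: (enum 'I_n) => //= i r ->; rewrite ffunE. Qed.

(** Monomials give the decay and derivatives give the factor e^|a|. Both bases may be prescribed
    because the defining bounds of Sigma_s hold for every h. *)
Lemma Sigma_decay n (phi : 'rV[R]_n -> C) (e r : R) : gelfand_shilov_proj s phi -> 0 < e -> 0 < r ->
  exists2 c : R, 0 <= c & forall a x,
    normc (mderiv a phi x) <= c * (e ^+ mlen a * (mfact a)%:R `^ s) * expR (- (r * enormp s x)).
Proof.
move=> hphi e0 r0; have [e' e'0 <-] := drate_surj s0 n r0.
(* [e] is the base wanted for the derivatives, [e'] the base that yields decay at rate r. *)
pose h := Num.min e e'; have h0 : 0 < h by rewrite lt_min e0.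
have [B B0 [_ HB]] := hphi h h0.
have he k : h ^+ k <= e ^+ k by rewrite lerXn2r ?nnegrE ?(ltW h0) ?(ltW e0)// ge_min lexx.
have he' k : h ^+ k <= e' ^+ k by rewrite lerXn2r ?nnegrE ?(ltW h0) ?(ltW e'0)// ge_min lexx orbT.
exists (B * expR s); first by rewrite mulr_ge0 ?expR_ge0// ltW.
move=> a x; set C0 := B * (e ^+ mlen a * (mfact a)%:R `^ s).
have C00 : 0 <= C0 by rewrite !mulr_ge0 ?exprn_ge0 ?powR_ge0// ltW.
have key b : normc ((mpow x b)%:C * mderiv a phi x) <= C0 * (e' ^+ mlen b * (mfact b)%:R `^ s).
  apply: le_trans (HB a b x) _.
  rewrite -[leRHS]mulrA ler_wpM2l ?(ltW B0)// exprD natrM powRM// mulrACA.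
  by rewrite ler_pM ?mulr_ge0 ?exprn_ge0 ?powR_ge0 ?(ltW h0)// ler_wpM2r ?powR_ge0.
have F0 : normc (mderiv a phi x) <= C0.
  have := key (zero_index n).
  by rewrite mpow0 mlen0 mfact0 expr0 powR1 [1%:C]/(1 : C) !mul1r mulr1.
have F1 l m : normc (mderiv a phi x) * `|x 0 l| ^+ m <= C0 * (e' ^+ m * (m`!)%:R `^ s).
  have := key (mono_index l m).
  by rewrite mpow_mono_index mlen_mono_index mfact_mono_index normcM normc_real normrX mulrC.
have := enormp_decay s0 e'0 C00 F0 F1.
by move=> /le_trans; apply; apply: eq_ler; rewrite /C0 [B * _ * expR s]mulrAC.
Qed.

Lemma GS_exp_decay n (f : 'rV[R]_n -> C) r : GS f -> 0 < r -> exists2 c : R, 0 <= c &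
  forall x, normc (f x) <= c * expR (- (r * enormp s x)).
Proof.
move=> gf r0; have [c [h [c0 h1 H]]] := GS_decay gf r0.
by exists c => // x; have := H [::] x; rewrite /= expr0 sqfact0 !mulr1.
Qed.

(** Origin of the rate (h + 1) K. For p = |y|^(1/s), q = |x|^(1/s), v = |y - x|^(1/s), decay at this
    rate in v trades growth h p for growth in q and leaves exp(-p), which is integrable in y. *)
Lemma exp_shift (K h p q v : R) : 0 <= h -> p <= K * (q + v) ->
  expR (h * p) * expR (- ((h + 1) * K * v)) <= expR ((h + 1) * K * q) * expR (- p).
Proof.
move=> h0 H; rewrite -!expRD ler_expR.
have h1 : 0 <= h + 1 by rewrite addr_ge0.
by have := ler_wpM2l h1 H; lra.
Qed.

End decay.

(** * The short-time Fourier transform of a symbol *)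

Section forward.
Context {R : realType} (d : nat).
Local Notation C := R[i].
Variables (s : R) (phi : 'rV[R]_d -> C).
Hypothesis hs : 2^-1 < s.
Hypothesis hphi : gelfand_shilov_proj s phi.
Let s0 : 0 < s. Proof. by apply: lt_trans hs; rewrite invr_gt0. Qed.

Lemma Sigma_smooth : smooth phi.
Proof. by have [r _ []] := hphi ltr01. Qed.

Lemma Sigma_bounded : exists2 B : R, 0 <= B & forall x, normc (phi x) <= B.
Proof.
have [r r0 [_ H]] := hphi ltr01; exists r; first exact: ltW.
move=> x; have := H (zero_index d) (zero_index d) x; rewrite expr1n mfact0 powR1 !mulr1.
by have /(congr1 (fun f => f x)) := monoder0 phi; rewrite /monoder => ->.
Qed.

Variables (g : 'rV[R]_d -> C) (e h c : R).
Hypotheses (sg : smooth g) (e0 : 0 < e) (h0 : 0 < h) (c0 : 0 <= c).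
Hypothesis hg : symbol_bound s e h c g.

(** The derivative in y_j of such a term is a sum of two of the same kind with total order a + b +
    1, so repeated integration by parts stays in the family. *)
Definition leibniz_term (j : 'I_d) a b (x y : 'rV[R]_d) : C :=
  iter a (partial j) g y * conjc (iter b (partial j) phi (y - x)).

Lemma smooth_iter_partial (j : 'I_d) k (f : 'rV[R]_d -> C) : smooth f -> smooth (iter k (partial j) f).
Proof. by move=> sf; elim: k => [|k IH]; [exact: sf|exact: smooth_partial]. Qed.

Lemma has_partial_leibniz_term j a b x y : has_partial j (leibniz_term j a b x) y
  (leibniz_term j a.+1 b x y + leibniz_term j a b.+1 x y).
Proof.
have s1 := smooth_iter_partial j a sg; have s2 := smooth_iter_partial j b Sigma_smooth.
apply: has_partialM; first exact: smooth_has_partial.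
apply: has_partial_conj.
have := @has_partial_chain _ _ _ j j (fun y => y - x) 1 _ y _ _ (smooth_has_partial j (y - x) s2).
rewrite [1%:C]/(1 : C) mul1r; apply => t; by rewrite mul1r addrAC.
Qed.

Lemma cmeasurable_leibniz_term j a b x : cmeasurable (leibniz_term j a b x).
Proof.
apply: cmeasurableM.
  exact: ccontinuous_cmeasurable (smooth_cont (smooth_iter_partial j a sg)).
apply: cmeasurable_conj.
have := cmeasurable_affine 1 (- x) (ccontinuous_cmeasurable (smooth_cont (smooth_iter_partial j b Sigma_smooth))).
by congr cmeasurable; apply/funext => y; rewrite scale1r.
Qed.

Let h' : R := (h + 1) * qtri s.

(** The window is estimated at the rate h', which depends only on h and s; the growth in x is
    therefore the same for every e. *)
Lemma window_product_bound : exists2 M : R, 0 <= M & forall a b x y,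
  normc (mderiv a g y * conjc (mderiv b phi (y - x))) <=
  M * (e ^+ (mlen a + mlen b) * ((mfact a)%:R `^ s * (mfact b)%:R `^ s)) *
  (expR (h' * enormp s x) * expR (- enormp s y)).
Proof.
have h'0 : 0 < h' by rewrite mulr_gt0 ?addr_gt0// qtri_gt0.
have [c1 c10 H1] := Sigma_decay hs hphi e0 h'0.
exists (c * c1); first by rewrite !mulr_ge0// ltW.
move=> a b x y; rewrite normcM normc_conj.
apply: le_trans (ler_pM (normc_ge0 _) (normc_ge0 _) (hg a y) (H1 b (y - x))) _.
have sh := exp_shift (ltW h0) (enormpB s0 x y); rewrite -/h' in sh.
have rgL (p q A B X Y U V : R) :
  p * (A * X * U) * (q * (B * Y) * V) = p * q * ((A * B) * (X * Y)) * (U * V) by ring.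
rewrite [leLHS]rgL -exprD ler_wpM2l//.
by rewrite !mulr_ge0 ?powR_ge0 ?exprn_ge0// ltW.
Qed.

Lemma leibniz_term_bound : exists2 M : R, 0 <= M & forall j a b x y,
  normc (leibniz_term j a b x y) <=
  M * (e ^+ (a + b) * ((a + b)`!)%:R `^ s) * expR (h' * enormp s x) * weight y.
Proof.
have [M M0 H] := window_product_bound.
have [c2 c20 H2] := enormp_weight s0 d ltr01.
exists (M * c2); first by rewrite mulr_ge0// ltW.
move=> j a b x y.
have := H (mono_index j a) (mono_index j b) x y.
rewrite !mderiv_mono_index !mlen_mono_index !mfact_mono_index => /le_trans; apply.
have w := H2 y; rewrite mul1r in w.
have f := powR_fact_le s0 a b.
have rgR (p q A X U V : R) : p * q * (A * X) * U * V = p * (A * X) * (U * (q * V)) by ring.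
rewrite [leRHS]rgR; apply: ler_pM.
- by rewrite !mulr_ge0 ?powR_ge0 ?exprn_ge0// ltW.
- by rewrite mulr_ge0// expR_ge0.
- by rewrite ler_wpM2l// ler_wpM2l// exprn_ge0// ltW.
- by rewrite ler_wpM2l ?expR_ge0.
Qed.

Let phase (y xi : 'rV[R]_d) : C := cis (- dotp y xi).

Lemma rmeas_dotpl n (xi : 'rV[R]_n) : rmeas (fun y : 'rV[R]_n => - dotp y xi).
Proof.
by apply: measurable_funN; apply: (@rmeas_dotp _ _ _ id (fun=> xi)) => i; [exact: rmeas_coord|exact: rmeas_cst].
Qed.

Definition leibniz_integral j a b x xi := cintegral (fun y => leibniz_term j a b x y * phase y xi).

(* Integration by parts: multiplication by xi_j becomes d/dy_j. *)
Lemma leibniz_parts j a b x xi :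
  normc (leibniz_integral j a b x xi) * `|xi 0 j| <=
  normc (leibniz_integral j a.+1 b x xi) + normc (leibniz_integral j a b.+1 x xi).
Proof.
have [M M0 HM] := leibniz_term_bound.
have dm a' b' : exists m, cdom (fun y => leibniz_term j a' b' x y * phase y xi) m.
  eexists; apply: cdom_cis; first exact: rmeas_dotpl.
  by split; [exact: cmeasurable_leibniz_term|exact: HM].
have [m0 d0] := dm a b; have [m1 d1] := dm a.+1 b; have [m2 d2] := dm a b.+1.
pose k : C := 0 +i* (- xi 0 j).
have n0 : 0 <= m0 := dominated_coef_ge0 d0.2.
have n12 : 0 <= m1 + m2 := dominated_coef_ge0 (cdomD d1 d2).2.
have d12 := cdomD (cdomD d1 d2) (cdomZ k d0).
have := @cintegral_partial0 R d j (fun y => leibniz_term j a b x y * phase y xi)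
  (fun y => (leibniz_term j a.+1 b x y * phase y xi + leibniz_term j a b.+1 x y * phase y xi) +
    k * (leibniz_term j a b x y * phase y xi)) (m0 + (m1 + m2 + normc k * m0)).
move=> H; have {}H := H (cdomW _ d0) _ _.
rewrite cintegralD in H; last 2 first.
- exact: cdom_integrable (cdomD d1 d2).
- exact: cdom_integrable (cdomZ k d0).
rewrite cintegralD in H; last 2 first.
- exact: cdom_integrable d1.
- exact: cdom_integrable d2.
rewrite (cintegralZ k (cdom_integrable d0)) in H.
have {}H := H _ _ _.
have nk : normc k = `|xi 0 j| by rewrite normc_imag normrN.
rewrite mulrC -nk -normcM.
have -> : k * leibniz_integral j a b x xi = - (leibniz_integral j a.+1 b x xi + leibniz_integral j a b.+1 x xi).
  apply/eqP; rewrite -addr_eq0 addrC; apply/eqP; apply: H.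
  - by rewrite lerDl addr_ge0// mulr_ge0// normc_ge0.
  - move=> y; apply: has_partial_eq (has_partialM (has_partial_leibniz_term j a b x y)
      (has_partial_cis (rpartN (rpart_dotp j xi y)))).
    by rewrite /phase /k; ring.
  - by move=> y; apply: le_trans (d12.2 y) _; rewrite ler_wpM2r ?weight_ge0// lerDr.
by rewrite normcN le_normcD.
Qed.


(** Each integration by parts doubles the number of terms and raises the total order by one, hence
    2^k and the order a + b + k. *)
Lemma leibniz_integral_decay : exists2 M : R, 0 <= M & forall j k a b x xi,
  normc (leibniz_integral j a b x xi) * `|xi 0 j| ^+ k <=
  2 ^+ k * (M * (e ^+ (a + b + k) * ((a + b + k)`!)%:R `^ s) * expR (h' * enormp s x)).
Proof.
have [M M0 HM] := leibniz_term_bound.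
exists (M * wint d); first by rewrite mulr_ge0// wint_ge0.
move=> j k; elim: k => [|k IH] a b x xi.
  rewrite !expr0 mulr1 mul1r addn0.
  have di : cdom (fun y => leibniz_term j a b x y * phase y xi)
      (M * (e ^+ (a + b) * ((a + b)`!)%:R `^ s) * expR (h' * enormp s x)).
    apply: cdom_cis; first exact: rmeas_dotpl.
    by split; [exact: cmeasurable_leibniz_term|exact: HM].
  by apply: le_trans (normc_cintegral di) _; apply: eq_ler; ring.
rewrite exprS [leLHS]mulrA.
apply: le_trans (ler_wpM2r _ (leibniz_parts j a b x xi)) _; first by rewrite exprn_ge0.
rewrite mulrDl.
have := lerD (IH a.+1 b x xi) (IH a b.+1 x xi).
have -> : (a.+1 + b + k = a + b + k.+1)%N by rewrite addSn addSn addnS.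
have -> : (a + b.+1 + k = a + b + k.+1)%N by rewrite addnS addSn addnS.
by move=> /le_trans; apply; rewrite exprS -[leRHS]mulrA -[leLHS]mulr2n -[leLHS]mulr_natl.
Qed.

Definition stft_const : R := (2 * pi) `^ (- (d%:R / 2)).

Definition stft_fun (z : 'rV[R]_(d + d)) : C := stft_const%:C *
  cintegral (fun y => g y * conjc (phi (y - lsubmx z)) * cis (- dotp y (rsubmx z))).

Lemma stft_const_gt0 : 0 < stft_const.
Proof. by rewrite powR_gt0// mulr_gt0// pi_gt0. Qed.

Lemma window_product_cdom : exists2 M : R, 0 <= M & forall x,
  cdom (fun y => g y * conjc (phi (y - x))) (M * expR (h' * enormp s x)).
Proof.
have [M M0 H] := window_product_bound.
have [c2 c20 H2] := enormp_weight s0 d ltr01.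
exists (M * c2); first by rewrite mulr_ge0// ltW.
move=> x; split.
  apply: cmeasurableM; first exact: ccontinuous_cmeasurable (smooth_cont sg).
  apply: cmeasurable_conj.
  have := cmeasurable_affine 1 (- x) (ccontinuous_cmeasurable (smooth_cont Sigma_smooth)).
  by congr cmeasurable; apply/funext => y; rewrite scale1r.
move=> y; have := H (zero_index d) (zero_index d) x y.
rewrite !mderiv_zero_index mlen0 mfact0 expr0 powR1 !mulr1 => /le_trans; apply.
have rg (p q A B : R) : p * q * A * B = p * (A * (q * B)) by ring.
rewrite rg ler_wpM2l// ler_wpM2l ?expR_ge0//.
by have := H2 y; rewrite mul1r.
Qed.

(** The 2^k of the integrations by parts joins e^k, so the decay rate is that of the base 2 e. *)
Lemma stft_fun_bound : exists2 M : R, 0 < M & stft_bound s h' (drate s d (2 * e)) M stft_fun.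
Proof.
have [M M0 HM] := leibniz_integral_decay.
have [M' M'0 H'] := window_product_cdom.
pose N := M + M' * wint d; have w0 : 0 <= wint d :> R := wint_ge0 _.
have M'2 : 0 <= M' * wint d := mulr_ge0 M'0 w0.
have N0 : 0 <= N := addr_ge0 M0 M'2.
have k0 := ltW stft_const_gt0.
exists (stft_const * N * expR s + 1).
  by rewrite ltr_wpDl// !mulr_ge0 ?expR_ge0.
move=> x xi; rewrite /stft_fun row_mxKl row_mxKr normcM normc_real ger0_norm//.
set I := cintegral _.
have C00 : 0 <= N * expR (h' * enormp s x) by rewrite mulr_ge0 ?expR_ge0.
have e20 : 0 < 2 * e by rewrite mulr_gt0.

have I0 : normc I <= N * expR (h' * enormp s x).
  have di : cdom (fun y => g y * conjc (phi (y - x)) * phase y xi) (M' * expR (h' * enormp s x)).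
    by apply: cdom_cis; [exact: rmeas_dotpl|exact: H'].
  apply: le_trans (normc_cintegral di) _.
  by rewrite mulrAC /N mulrDl lerDr mulr_ge0 ?expR_ge0.
have I1 j k : normc I * `|xi 0 j| ^+ k <= N * expR (h' * enormp s x) * ((2 * e) ^+ k * (k`!)%:R `^ s).
  have := HM j k 0%N 0%N x xi; rewrite addn0 add0n => /le_trans; apply.
  have rg (p A B X U : R) : A * (p * (B * X) * U) = p * U * ((A * B) * X) by ring.
  rewrite rg -exprMn ler_wpM2r ?mulr_ge0 ?powR_ge0 ?exprn_ge0 ?(ltW e20)//.
  by rewrite ler_wpM2r ?expR_ge0// /N lerDl.
have := enormp_decay s0 e20 C00 I0 I1.
move=> /(ler_wpM2l k0) /le_trans; apply.
have rg (p q A B S : R) : p * (q * A * S * B) = p * q * S * (A * B) by ring.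
by rewrite rg -expRD ler_wpM2r ?expR_ge0// lerDl.
Qed.

End forward.

(** * Identification of the distribution V_phi f with an integral *)

Section stft_is_function.
Context {R : realType} (d : nat).
Local Notation C := R[i].
Variables (s : R) (phi : 'rV[R]_d -> C).
Hypothesis hs : 2^-1 < s.
Hypothesis hphi : gelfand_shilov_proj s phi.
Let s0 : 0 < s. Proof. by apply: lt_trans hs; rewrite invr_gt0. Qed.

Lemma dotp_row_mx m n (x x' : 'rV[R]_m) (y y' : 'rV[R]_n) :
  dotp (row_mx x y) (row_mx x' y') = dotp x x' + dotp y y'.
Proof.
rewrite /dotp big_split_ord/=; congr (_ + _); apply: eq_bigr => i _.
  by rewrite !row_mxEl.
by rewrite !row_mxEr.
Qed.

Lemma enormp_row_mxl m n (x : 'rV[R]_m) (y : 'rV[R]_n) : enormp s x <= enormp s (row_mx x y).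
Proof.
rewrite ge0_ler_powR ?nnegrE ?enorm_ge0 ?invr_ge0 ?(ltW s0)//.
by rewrite ler_wsqrtr// dotp_row_mx lerDl dotp_ge0.
Qed.

Lemma GS_partial_fourier (psi : 'rV[R]_(d + d) -> C) : GS psi -> GS (partial_fourier psi).
Proof.
move=> gpsi; have := GSZ ((2 * pi) `^ (- (d%:R / 2)))%:C (GS_pfourier (sg := -1) _ gpsi).
rewrite mulrNN mulr1 => /(_ erefl); congr GS.
apply/funext => z; rewrite /partial_fourier /pfourier; congr (_ * _).
by apply: eq_cintegral => xi; rewrite mulN1r.
Qed.

Definition window_integral (P : 'rV[R]_(d + d) -> C) (y : 'rV[R]_d) : C :=
  cintegral (fun x => conjc (phi (y - x)) * P (row_mx x y)).

Lemma cmeasurable_conj_window y : cmeasurable (fun x => conjc (phi (y - x))).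
Proof.
apply: cmeasurable_conj.
have := cmeasurable_affine (-1) y (ccontinuous_cmeasurable (smooth_cont (Sigma_smooth hphi))).
by congr cmeasurable; apply/funext => x; rewrite scaleN1r addrC.
Qed.

(** The substitution x -> y - x moves the dependence on y from the window to P. *)
Lemma window_integral_marginal P : GS P ->
  window_integral P = marginal (fun x => conjc (phi x)) (shear P).
Proof.
move=> gP; apply/funext => y.
have [B B0 HB] := Sigma_bounded hphi; have [c c0 Pc] := GS_dominated gP.
have di : cdom (fun x => conjc (phi (y - x)) * P (row_mx x y)) (B * (c * weight y)).
  apply: cdomM; [exact: B0|exact: cdom_row_mxl (GS_smooth gP) Pc|exact: cmeasurable_conj_window|].
  by move=> x; rewrite normc_conj.
rewrite /window_integral (cintegral_affine (a := -1) y _ (cdom_integrable di)) ?oppr_eq0 ?oner_eq0//.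
rewrite normrN normr1 expr1n [1%:C]/(1 : C) mul1r; apply: eq_cintegral => x.
by rewrite scaleN1r /shear row_mxKl row_mxKr [- x + y]addrC subKr.
Qed.

Lemma GS_window_integral P : GS P -> GS (window_integral P).
Proof.
move=> gP; rewrite window_integral_marginal//.
have [B B0 HB] := Sigma_bounded hphi.
apply: (GS_marginal (B := B)) => //; last exact: GS_shear.
- exact: cmeasurable_conj (ccontinuous_cmeasurable (smooth_cont (Sigma_smooth hphi))).
- by move=> x; rewrite normc_conj.
Qed.

Variables (g : 'rV[R]_d -> C) (e h c : R).
Hypotheses (sg : smooth g) (e0 : 0 < e) (h0 : 0 < h) (c0 : 0 <= c).
Hypothesis hg : symbol_bound s e h c g.

(** An integrand in the variables (x, xi, y). Integrated over y first it pairs V_phi g with psi;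
    over (x, xi) first, it pairs g with the function to which f is applied. *)
Definition stft_kernel (psi : 'rV[R]_(d + d) -> C) (z : 'rV[R]_(d + d + d)) : C :=
  psi (lsubmx z) * (g (rsubmx z) * conjc (phi (rsubmx z - lsubmx (lsubmx z)))) *
  cis (- dotp (rsubmx z) (rsubmx (lsubmx z))).

(** The test function decays at the rate h' + 1: h' absorbs the growth in x and 1 leaves an
    integrable factor in (x, xi). Integrability in y comes from [window_product_bound]. *)
Lemma cdom_stft_kernel psi : GS psi -> exists b, cdom (stft_kernel psi) b.
Proof.
move=> gpsi; have [M M0 HM] := window_product_bound hs hphi e0 h0 c0 hg.
set h' := (h + 1) * qtri s in HM.
have h'0 : 0 < h' + 1 by rewrite addr_gt0// mulr_gt0 ?addr_gt0// qtri_gt0.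
have [A A0 HA] := GS_exp_decay hs gpsi h'0.
have [c1 c10 H1] := enormp_weight s0 (d + d) ltr01.
have [c2 c20 H2] := enormp_weight s0 d ltr01.
exists (A * M * (c1 * c2)); apply: cdom_cis.
  apply: measurable_funN; apply: (@rmeas_dotp _ _ _ (fun z => rsubmx z) (fun z => rsubmx (lsubmx z))) => i.
    exact: rmeas_rsubmx.
  exact: rmeas_rlsubmx.
split.
  apply: cmeasurableM.
    by apply: (ccontinuous_cmeasurable_comp (smooth_cont (GS_smooth gpsi))) => i; exact: rmeas_lsubmx.
  apply: cmeasurableM.
    by apply: (ccontinuous_cmeasurable_comp (smooth_cont sg)) => i; exact: rmeas_rsubmx.
  apply: cmeasurable_conj.
  apply: (ccontinuous_cmeasurable_comp (smooth_cont (Sigma_smooth hphi))) => i.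
  rewrite (_ : (fun z : 'rV[R]_(d + d + d) => _) = (fun z => rsubmx z 0 i - lsubmx (lsubmx z) 0 i)).
    exact: (rmeasB (rmeas_rsubmx _) (rmeas_llsubmx _)).
  by apply/funext => z; rewrite [LHS]mxE; congr (_ + _); rewrite mxE.
move=> z; set w := lsubmx z; set y := rsubmx z; set x := lsubmx w.
have -> : weight z = weight w * weight y by rewrite -weight_row_mx hsubmxK.
rewrite normcM.
have h1 := HA w.
have h2 : normc (g y * conjc (phi (y - x))) <= M * (expR (h' * enormp s x) * expR (- enormp s y)).
  have := HM (zero_index d) (zero_index d) x y.
  by rewrite !mderiv_zero_index mlen0 mfact0 expr0 powR1 !mulr1.
apply: le_trans (ler_pM (normc_ge0 _) (normc_ge0 _) h1 h2) _.
have rg (p q U V W : R) : p * U * (q * (V * W)) = p * q * (U * V * W) by ring.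
rewrite rg -[leRHS]mulrA ler_wpM2l ?mulr_ge0//.
rewrite [leRHS]mulrACA ler_pM ?mulr_ge0 ?expR_ge0//; last by have := H2 y; rewrite mul1r.
apply: le_trans (H1 w); rewrite mul1r -expRD ler_expR mulrDl mul1r opprD addrAC.
have : h' * enormp s x <= h' * enormp s w.
  rewrite ler_wpM2l ?mulr_ge0 ?addr_ge0 ?(ltW h0) ?(ltW (qtri_gt0 s))//.
  by rewrite -[w in leRHS]hsubmxK; exact: enormp_row_mxl.
by rewrite -[X in _ -> _ <= X]add0r lerD2r addrC subr_le0.
Qed.

Lemma stft_kernel_integral1 psi z :
  cintegral (fun y => stft_kernel (fun z => (stft_const d)%:C * psi z) (row_mx z y)) =
  stft_fun phi g z * psi z.
Proof.
have [M M0 H] := window_product_cdom hs hphi sg e0 h0 c0 hg.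
have di : cdom (fun y => g y * conjc (phi (y - lsubmx z)) * cis (- dotp y (rsubmx z))) _ :=
  cdom_cis (rmeas_dotpl (rsubmx z)) (H (lsubmx z)).
rewrite /stft_fun -mulrA [cintegral _ * _]mulrC mulrA -(cintegralZ _ (cdom_integrable di)).
apply: eq_cintegral => y; rewrite /stft_kernel row_mxKl row_mxKr.
by rewrite [RHS]mulrA.
Qed.

Lemma stft_kernel_integral2 psi y : GS psi ->
  cintegral (fun z => stft_kernel (fun z => (stft_const d)%:C * psi z) (row_mx z y)) =
  g y * window_integral (partial_fourier psi) y.
Proof.
move=> gpsi; set K := stft_kernel _.
have [b db] := cdom_stft_kernel (GSZ (stft_const d)%:C gpsi); rewrite -/K in db.
have dK : cdom (fun z => K (row_mx z y)) (b * weight y) := cdom_section2 y db.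
rewrite (cintegral_fubini1 dK).
have [B B0 HB] := Sigma_bounded hphi.
have gP := GS_partial_fourier gpsi; have [c' c'0 Pc] := GS_dominated gP.
have di : cdom (fun x => conjc (phi (y - x)) * partial_fourier psi (row_mx x y)) (B * (c' * weight y)).
  apply: cdomM; [exact: B0|exact: cdom_row_mxl (GS_smooth gP) Pc|exact: cmeasurable_conj_window|].
  by move=> x; rewrite normc_conj.
rewrite /window_integral -(cintegralZ _ (cdom_integrable di)); apply: eq_cintegral => x.
rewrite /partial_fourier row_mxKl row_mxKr -/(stft_const d).
have [c1 c10 psic] := GS_dominated gpsi.
have dx : cdom (fun xi => psi (row_mx x xi) * cis (- dotp y xi)) (c1 * weight x).
  apply: cdom_cis; last exact: cdom_row_mxr (GS_smooth gpsi) psic.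
  by apply: measurable_funN; apply: (@rmeas_dotp _ _ _ (fun=> y) id) => i; [exact: rmeas_cst|exact: rmeas_coord].
rewrite mulrA mulrA -(cintegralZ _ (cdom_integrable dx)); apply: eq_cintegral => xi.
by rewrite /K /stft_kernel !row_mxKl !row_mxKr; ring.
Qed.

Lemma is_function_stft f : is_function 2^-1 f g -> is_function 2^-1 (stft f phi) (stft_fun phi g).
Proof.
move=> [mg fg].
have key psi : GS psi -> [/\ cmeasurable (fun z => stft_fun phi g z * psi z),
    cintegrable (fun z => stft_fun phi g z * psi z) &
    stft f phi psi = cintegral (fun z => stft_fun phi g z * psi z)].
  move=> gpsi; have [b db] := cdom_stft_kernel (GSZ (stft_const d)%:C gpsi).
  have E : (fun z => stft_fun phi g z * psi z) =
      (fun z => cintegral (fun y => stft_kernel (fun z => (stft_const d)%:C * psi z) (row_mx z y))).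
    by apply/funext => z; rewrite stft_kernel_integral1.
  have dF := cdom_cintegral1 db; rewrite -E in dF.
  split; [exact: dF.1|exact: cdom_integrable dF|].
  rewrite E -(cintegral_fubini1 db) (cintegral_fubini2 db).
  have gw := GS_gelfand_shilov (GS_window_integral (GS_partial_fourier gpsi)).
  rewrite (_ : stft f phi psi = f (window_integral (partial_fourier psi)))// (fg _ gw).2.
  by apply: eq_cintegral => y; rewrite stft_kernel_integral2.
split; last by move=> psi /gelfand_shilov_GS/key[].
(* Measurability of the function itself: its product with a Gaussian test function is measurable,
   and the Gaussian does not vanish. *)
have a0 : 0 < 2^-1 :> R by rewrite invr_gt0.
have [m _ _] := key _ (GS_gauss (0 : 'rV[R]_(d + d)) a0).
have mi : cmeasurable (fun z : 'rV[R]_(d + d) => ((gauss 2^-1 0 z)^-1)%:C : C).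
  split; last exact: measurable_cst.
  rewrite (_ : (fun t => _) = expR \o (fun t => 2^-1 * dotp (row_of_tuple t) (row_of_tuple t))).
    apply: measurableT_comp; first exact: measurable_expR.
    apply: (@rmeasM _ _ (fun=> 2^-1) (fun z => dotp z z)); first exact: rmeas_cst.
    by apply: (@rmeas_dotp _ _ _ id id) => i; exact: rmeas_coord.
  by apply/funext => t; rewrite /gauss subr0 expRN invrK.
have := cmeasurableM m mi; congr cmeasurable; apply/funext => z.
rewrite -mulrA -rmorphM/= mulfV ?[1%:C]/(1 : C) ?mulr1// gt_eqF//.
exact: expR_gt0.
Qed.

End stft_is_function.

(** * Synthesis of a symbol from its short-time Fourier transform *)

Section synthesis.
Context {R : realType} (d : nat).
Local Notation C := R[i].
Variables (s : R) (F : 'rV[R]_(d + d) -> C) (chi : 'rV[R]_d -> C) (e h c : R).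
Hypotheses (hs : 2^-1 < s) (e0 : 0 < e) (h0 : 0 < h) (c0 : 0 <= c).
Hypotheses (mF : cmeasurable F) (hF : stft_bound s h e c F) (gchi : GS chi).
Let s0 : 0 < s. Proof. by apply: lt_trans hs; rewrite invr_gt0. Qed.
Let h' : R := (h + 1) * qtri s.
Let A : R := (s / (e / 2)) `^ s.

Let h'0 : 0 < h'. Proof. by rewrite mulr_gt0 ?addr_gt0// qtri_gt0. Qed.
Let e20 : 0 < e / 2. Proof. by rewrite divr_gt0. Qed.
Let A0 : 0 < A. Proof. by rewrite powR_gt0// divr_gt0. Qed.

Definition freq_pow (l : seq 'I_d) (xi : 'rV[R]_d) : C := \prod_(i <- l) (0 +i* xi 0 i).

(* Differentiating in [t] produces factors i xi_j, recorded in [l], and derivatives of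
   the window, recorded in [w]. *)
Definition synth_kernel (l w : seq 'I_d) (t : 'rV[R]_d) (z : 'rV[R]_(d + d)) : C :=
  F z * freq_pow l (rsubmx z) * foldr (@partial R d) chi w (t - lsubmx z) * cis (dotp t (rsubmx z)).

Definition synth l w t := cintegral (synth_kernel l w t).

Lemma normc_freq_pow l xi : normc (freq_pow l xi) <= enorm xi ^+ size l.
Proof.
rewrite /freq_pow; elim: l => [|i l IH]; first by rewrite big_nil normc1 expr0.
by rewrite big_cons normcM normc_imag exprS ler_pM ?normc_ge0// coord_le_enorm.
Qed.

(** Half of the decay of F in xi pays for |xi|^k, whence e / 2 in [A], and the other half is
    integrable. The decay of the window at rate h' trades the growth in x for growth in t. *)
Lemma synth_kernel_bound : exists2 M : R, 0 <= M & forall l w t z,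
  normc (synth_kernel l w t z) <=
  M * (A ^+ (size l + size w) * ((size l + size w)`!)%:R `^ s) * expR (h' * enormp s t) * weight z.
Proof.
have [c1 [h1 [c10 h11 H1]]] := GS_decay hs gchi h'0.
(* The derivatives of chi are brought to the same base A as the powers of xi, so that the two
   factorial bounds multiply into one. *)
have [B B1 HB] := sqfact_powR hs (le_trans ler01 h11) A0.
have [c2 c20 H2] := enormp_weight s0 d ltr01.
have [c3 c30 H3] := enormp_weight s0 d e20.
exists (c * c1 * B * (c2 * c3)).
  by rewrite !mulr_ge0 ?(le_trans ler01 B1)// ltW.
move=> l w t z; set x := lsubmx z; set xi := rsubmx z; set k := size l; set m := size w.
have zE : z = row_mx x xi by rewrite hsubmxK.
have -> : weight z = weight x * weight xi by rewrite zE weight_row_mx.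
have b1 : normc (F z) <= c * (expR (h * enormp s x) * (expR (- (e / 2 * enormp s xi)) * expR (- (e / 2 * enormp s xi)))).
  rewrite zE (le_trans (hF x xi))// -!expRD; apply: eq_ler; congr (_ * expR _).
  by rewrite /enormp; field.
have b2 := normc_freq_pow l xi; rewrite -/k in b2.
have b3 : normc (foldr (@partial R d) chi w (t - x)) <= c1 * B * (A ^+ m * (m`!)%:R `^ s) * expR (- (h' * enormp s (t - x))).
  have wE : foldr (@partial R d) chi w = wop [seq (false, i) | i <- w] chi by elim: w {m} => //= i w ->.
  rewrite wE (le_trans (H1 _ _))// size_map -/m ler_wpM2r ?expR_ge0// -[leLHS]mulrA -[leRHS]mulrA.
  by rewrite ler_wpM2l.
have sh := exp_shift (ltW h0) (enormpB_sym s0 x t); rewrite -/h' in sh.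
have f := powR_fact_le s0 k m.
have ff := enorm_factorial s0 xi k e20; rewrite -/A in ff.
have w2 := H2 x; rewrite mul1r in w2; have w3 := H3 xi.
rewrite normcM normc_cis mulr1 2!normcM.
apply: le_trans (ler_pM _ (normc_ge0 _) (ler_pM (normc_ge0 _) (normc_ge0 _) b1 b2) b3) _.
  by rewrite mulr_ge0 ?normc_ge0.
set E1 := expR (h * _) in sh *; set E2 := expR (- (e / 2 * _)) in ff w3 *.
set E3 := expR (- (h' * _)) in sh *; set E4 := expR (h' * _) in sh *; set E5 := expR (- _) in sh w2.
have E20 : 0 <= E2 := expR_ge0 _.
have E40 : 0 <= E4 := expR_ge0 _.
have E50 : 0 <= E5 := expR_ge0 _.
have rgL (p q X U V Y W : R) : p * (U * (V * V)) * X * (q * Y * W) = p * q * ((X * V) * Y) * ((U * W) * V) by ring.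
have rgR (p q1 q2 Y U V W : R) : p * (q1 * q2) * Y * U * (V * W) = p * Y * (U * (q1 * V) * (q2 * W)) by ring.
rewrite rgL rgR [c * (c1 * B)]mulrA.
have Ak r : 0 <= A ^+ r * (r`!)%:R `^ s.
  by rewrite mulr_ge0 ?powR_ge0//; apply: exprn_ge0; exact: ltW.
have p0 : 0 <= c * c1 * B by rewrite !mulr_ge0// (le_trans ler01 B1).
apply: ler_pM.
- by apply: (mulr_ge0 p0 (mulr_ge0 (mulr_ge0 _ E20) (Ak m))); rewrite exprn_ge0// enorm_ge0.
- by apply: mulr_ge0 E20; apply: mulr_ge0; exact: expR_ge0.
- apply: (ler_wpM2l p0).
  apply: le_trans (ler_wpM2r (Ak m) ff) _.
  by rewrite mulrACA -exprD ler_wpM2l// exprn_ge0// ltW.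
- apply: ler_pM E20 _ w3; first by apply: mulr_ge0; exact: expR_ge0.
  by apply: le_trans sh _; rewrite ler_wpM2l.
Qed.

Lemma cmeasurable_freq_pow l : cmeasurable (fun z : 'rV[R]_(d + d) => freq_pow l (rsubmx z)).
Proof.
rewrite /freq_pow; elim: l => [|i l IH].
  by under eq_fun do rewrite big_nil; exact: cmeasurable_cst.
under eq_fun do rewrite big_cons; apply: cmeasurableM IH.
by split; [exact: measurable_cst|exact: rmeas_rsubmx].
Qed.

Lemma smooth_foldr_chi w : smooth (foldr (@partial R d) chi w).
Proof. exact: smooth_foldr_partial (GS_smooth gchi). Qed.

Lemma cmeasurable_synth_kernel l w t : cmeasurable (synth_kernel l w t).
Proof.
apply: cmeasurableM; first apply: cmeasurableM; first apply: cmeasurableM.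
- exact: mF.
- exact: cmeasurable_freq_pow.
- apply: (ccontinuous_cmeasurable_comp (smooth_cont (smooth_foldr_chi w))) => i.
  rewrite (_ : (fun z : 'rV[R]_(d + d) => _) = (fun z => t 0 i - lsubmx z 0 i)).
    exact: (rmeasB (rmeas_cst _) (rmeas_lsubmx _)).
  by apply/funext => z; rewrite [LHS]mxE; congr (_ + _); rewrite mxE.
- apply: cmeasurable_cis; apply: (@rmeas_dotp _ _ _ (fun=> t) (fun z => rsubmx z)) => i.
    exact: rmeas_cst.
  exact: rmeas_rsubmx.
Qed.

Lemma cdom_synth_kernel l w t : exists b, cdom (synth_kernel l w t) b.
Proof.
have [M M0 H] := synth_kernel_bound.
by eexists; split; [exact: cmeasurable_synth_kernel|exact: H].
Qed.

Lemma enormp_local (t : 'rV[R]_d) : exists L : R, forall y : 'rV[R]_d,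
  (forall j, `|y 0 j - t 0 j| <= 1) -> expR (h' * enormp s y) <= L.
Proof.
exists (expR (h' * (qtri s * (enormp s t + d.+1%:R `^ s^-1)))) => y yt.
rewrite ler_expR ler_wpM2l ?(ltW h'0)// (le_trans (enormpB s0 t y))//.
rewrite ler_wpM2l ?(ltW (qtri_gt0 s))// lerD2l ge0_ler_powR ?nnegrE ?enorm_ge0 ?invr_ge0 ?(ltW s0)//.
have [->//|[j /le_trans]] := enorm_le_coord (y - t); apply.
by rewrite ler_piMr// !mxE.
Qed.

Lemma has_partial_synth j l w t :
  has_partial j (synth l w) t (synth (j :: l) w t + synth l (j :: w) t).
Proof.
have [M M0 H] := synth_kernel_bound; have [L HL] := enormp_local t.
have [b1 d1] := cdom_synth_kernel (j :: l) w t; have [b2 d2] := cdom_synth_kernel l (j :: w) t.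
rewrite /synth -(cintegralD (cdom_integrable d1) (cdom_integrable d2)).
pose B k := M * (A ^+ k * (k`!)%:R `^ s) * L.
have L0 : 0 <= L by apply: le_trans (HL t _); rewrite ?expR_ge0// => i; rewrite subrr normr0.
have Bk k : 0 <= B k by rewrite /B !mulr_ge0 ?powR_ge0 ?exprn_ge0// ltW.
have near_dir (r : R) : `|r| < 1 -> forall i, `|(t + r *: dir R j) 0 i - t 0 i| <= 1.
  move=> r1 i; rewrite !mxE addrAC subrr add0r normrM.
  by rewrite (le_trans _ (ltW r1))// ler_piMr// normr_nat lern1 leq_b1.
have bd l' w' r z : `|r| < 1 -> normc (synth_kernel l' w' (t + r *: dir R j) z) <= B (size l' + size w')%N * weight z.
  move=> r1; apply: le_trans (H _ _ _ _) _; rewrite ler_wpM2r ?weight_ge0// ler_wpM2l//.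
    by rewrite !mulr_ge0 ?powR_ge0 ?exprn_ge0// ltW.
  exact: HL (near_dir r r1).
apply: (has_partial_cintegral (u := synth_kernel l w)
  (u' := fun t z => synth_kernel (j :: l) w t z + synth_kernel l (j :: w) t z)
  (c := B (size l + size w)%N + (B (size (j :: l) + size w)%N + B (size l + size (j :: w))%N))).
- by move=> y; exact: cmeasurable_synth_kernel.
- move=> y z; rewrite /synth_kernel.
  have hc := @has_partial_chain _ _ _ j j (fun y => y - lsubmx z) 1 _ y _ _
    (smooth_has_partial j (y - lsubmx z) (smooth_foldr_chi w)).
  have {}hc := hc (fun r => _).
  apply: has_partial_eq (has_partialM (has_partialZ (F z * freq_pow l (rsubmx z)) (hc _))
    (has_partial_cis (rpart_dotp j (rsubmx z) y))).
    by rewrite [1%:C]/(1 : C) /freq_pow big_cons/=; ring.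
  by move=> r; rewrite mul1r addrAC.
- move=> r z r1; apply: le_trans (bd l w r z r1) _; rewrite ler_wpM2r ?weight_ge0// lerDl addr_ge0//.
- move=> r z r1; apply: le_trans (le_normcD _ _) _.
  apply: le_trans (lerD (bd (j :: l) w r z r1) (bd l (j :: w) r z r1)) _.
  by rewrite -mulrDl ler_wpM2r ?weight_ge0// lerDr.
Qed.

Lemma synth_bound : exists2 M : R, 0 <= M & forall l w t, normc (synth l w t) <=
  M * (A ^+ (size l + size w) * ((size l + size w)`!)%:R `^ s) * expR (h' * enormp s t).
Proof.
have [M M0 H] := synth_kernel_bound; exists (M * wint (d + d)); first by rewrite mulr_ge0// wint_ge0.
move=> l w t.
have di : cdom (synth_kernel l w t) _ := conj (cmeasurable_synth_kernel l w t) (H l w t).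
apply: le_trans (normc_cintegral di) _; apply: eq_ler.
have rg (p q X U : R) : p * X * U * q = p * q * X * U by ring.
exact: rg.
Qed.

(** The derivative of one integral is a sum of two, so finite sums are the smallest convenient
    family closed under differentiation. *)
Definition synth_sum (r : seq (seq 'I_d * seq 'I_d)) t : C := \sum_(p <- r) synth p.1 p.2 t.

Lemma clocbdd_synth_sum r : clocbdd (synth_sum r).
Proof.
have [M M0 H] := synth_bound.
move=> t; have [L HL] := enormp_local t.
elim: r => [|p r [L' IH]].
  by exists 0 => y _; rewrite /synth_sum big_nil normc0.
exists (M * (A ^+ (size p.1 + size p.2) * ((size p.1 + size p.2)`!)%:R `^ s) * L + L') => y yt.
rewrite /synth_sum big_cons (le_trans (le_normcD _ _))//; apply: lerD (IH y yt).
apply: le_trans (H _ _ _) _; apply: ler_wpM2l (HL y yt).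
by apply: (mulr_ge0 M0); rewrite mulr_ge0 ?powR_ge0//; apply: exprn_ge0; exact: ltW.
Qed.

Lemma has_partial_synth_sum j r t : has_partial j (synth_sum r) t
  (synth_sum ([seq (j :: p.1, p.2) | p <- r] ++ [seq (p.1, j :: p.2) | p <- r]) t).
Proof.
have E p r' : synth_sum (p :: r') = (fun t => synth p.1 p.2 t + synth_sum r' t).
  by apply/funext => y; rewrite /synth_sum big_cons.
have Ec r1 r2 : synth_sum (r1 ++ r2) t = synth_sum r1 t + synth_sum r2 t by rewrite /synth_sum big_cat.
elim: r => [|p r IH].
  rewrite (_ : synth_sum [::] = fun=> 0); last by apply/funext => y; rewrite /synth_sum big_nil.
  exact: has_partial_cst.
rewrite E; apply: has_partial_eq (has_partialD (has_partial_synth j p.1 p.2 t) IH).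
by rewrite !Ec !map_cons !E /= addrACA.
Qed.

Lemma smooth_synth l w : smooth (synth l w).
Proof.
rewrite (_ : synth l w = synth_sum [:: (l, w)]).
  apply: (@smooth_coind_bdd _ _ (fun f => exists r, f = synth_sum r)); last by eexists.
    by move=> _ [r ->]; exact: clocbdd_synth_sum.
  move=> _ j [r ->]; eexists; last by eexists.
  by move=> t; exact: has_partial_synth_sum.
by apply/funext => t; rewrite /synth_sum big_seq1.
Qed.

Lemma partial_synth j l w : partial j (synth l w) = (fun t => synth (j :: l) w t + synth l (j :: w) t).
Proof. by apply: has_partialE => t; exact: has_partial_synth. Qed.

Lemma foldr_partialD (u v : 'rV[R]_d -> C) L : smooth u -> smooth v ->
  foldr (@partial R d) (fun t => u t + v t) L =
  (fun t => foldr (@partial R d) u L t + foldr (@partial R d) v L t).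
Proof.
move=> su sv; elim: L => //= i L ->; apply: has_partialE => t.
by apply: has_partialD; apply: smooth_has_partial; exact: smooth_foldr_partial.
Qed.

(** Each derivative falls either on the phase or on the window, hence 2^|L| terms, all of the same
    total order. *)
Lemma foldr_partial_synth_bound : exists2 M : R, 0 <= M & forall L l w t,
  normc (foldr (@partial R d) (synth l w) L t) <= 2 ^+ size L *
   (M * (A ^+ (size l + size w + size L) * ((size l + size w + size L)`!)%:R `^ s) * expR (h' * enormp s t)).
Proof.
have [M M0 H] := synth_bound; exists M => //.
elim/last_ind => [|L j IH] l w t; first by rewrite expr0 mul1r addn0; exact: H.
rewrite foldr_rcons partial_synth (foldr_partialD _ (smooth_synth _ _) (smooth_synth _ _)).
apply: le_trans (le_normcD _ _) _.
have := lerD (IH (j :: l) w t) (IH l (j :: w) t).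
have -> : (size (j :: l) + size w + size L = size l + size w + size (rcons L j))%N.
  by rewrite size_rcons /= addSn addSn addnS.
have -> : (size l + size (j :: w) + size L = size l + size w + size (rcons L j))%N.
  by rewrite size_rcons /= addnS addSn addnS.
move=> /le_trans; apply.
set N := (_ + size (rcons L j))%N; rewrite size_rcons exprS.
by rewrite -[leRHS]mulrA -[leLHS]mulr2n -[leLHS]mulr_natl.
Qed.

(** In the base, 2 counts the two terms produced by a derivative, A comes from the kernel, and
    (2^d)^s from replacing |a|! by a!. Only A depends on e, and h' does not. *)
Lemma symbol_bound_synth : exists2 M : R, 0 < M &
  symbol_bound s (2 * A * (2 ^+ d) `^ s) h' M (synth [::] [::]).
Proof.
have [M M0 H] := foldr_partial_synth_bound.
exists (M + 1); first by rewrite ltr_wpDl.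
move=> a t; rewrite mderivE.
have := H (dirs a) [::] [::] t; rewrite size_dirs !add0n => /le_trans; apply.
set n := mlen a.
have f : (n`!)%:R `^ s <= ((2 ^+ d) `^ s) ^+ n * (mfact a)%:R `^ s :> R.
  rewrite -powR_Xn ?exprn_ge0// -powRM ?exprn_ge0// ge0_ler_powR ?nnegrE ?(ltW s0)//.
  by rewrite -!natrX -natrM ler_nat fact_mlen_le.
have rgL (p U X V W : R) : U * (p * (V * X) * W) = p * (U * V * X) * W by ring.
rewrite rgL -mulrA; apply: ler_pM => //.
- by rewrite mulr_ge0 ?expR_ge0// mulr_ge0 ?powR_ge0// -exprMn exprn_ge0// mulr_ge0// ltW.
- by rewrite lerDl.
- rewrite ler_wpM2r ?expR_ge0// !exprMn -[leRHS]mulrA ler_wpM2l// -exprMn exprn_ge0// mulr_ge0// ltW//.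
Qed.

End synthesis.

(** * The reconstruction formula by duality *)

Section reconstruction.
Context {R : realType} (d : nat).
Local Notation C := R[i].
Variables (s : R) (phi : 'rV[R]_d -> C).
Hypothesis hs : 2^-1 < s.
Hypothesis hphi : gelfand_shilov_proj s phi.
Let s0 : 0 < s. Proof. by apply: lt_trans hs; rewrite invr_gt0. Qed.

Lemma stft_const_gaussmass : stft_const d * gaussmass d = 1 :> R.
Proof.
have p0 : 0 < 2 * pi :> R by rewrite mulr_gt0// pi_gt0.
rewrite /stft_const /gaussmass -powR12_sqrt ?(ltW p0)// -powR_mulrn ?powR_ge0// -powRrM.
rewrite -powRD; last by rewrite (gt_eqF p0) implybT.
by rewrite [2^-1 * _]mulrC addNr powRr0.
Qed.

Lemma dotpC n (x y : 'rV[R]_n) : dotp x y = dotp y x.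
Proof. by rewrite /dotp; apply: eq_bigr => i _; rewrite mulrC. Qed.

Variable chi : 'rV[R]_d -> C.
Hypothesis gchi : GS chi.

Definition window_pairing : C := cintegral (fun x => conjc (phi x) * chi x).

(** The conjugate of the short-time Fourier transform of conj(psi) with window chi: a test function
    in (x, xi) from which psi is recovered. *)
Definition gabor (psi : 'rV[R]_d -> C) : 'rV[R]_(d + d) -> C :=
  fun z => (stft_const d)%:C * pfourier 1 (shear (tensor chi psi)) z.

Lemma GS_gabor psi : GS psi -> GS (gabor psi).
Proof.
by move=> gpsi; apply/GSZ/GS_pfourier; [rewrite mulr1|apply/GS_shear/GS_tensor].
Qed.

Lemma shear_tensorE psi x t : shear (tensor chi psi) (row_mx x t) = chi (t - x) * psi t.
Proof. by rewrite /shear /tensor !row_mxKl !row_mxKr. Qed.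

(* Fourier inversion in the second variable. *)
Lemma partial_fourier_gabor psi : GS psi ->
  partial_fourier (gabor psi) = shear (tensor chi psi).
Proof.
move=> gpsi; have gX := GS_shear (GS_tensor gchi gpsi).
set X := shear _ in gX *.
apply/funext => z; rewrite -[z in RHS]hsubmxK; set x := lsubmx z; set y := rsubmx z.
have [c c0 Xc] := GS_dominated gX.
have dX := cdom_row_mxr x (GS_smooth gX) Xc.
have cX : ccontinuous (fun t => X (row_mx x t)).
  rewrite (_ : (fun t => _) = (fun t => chi (t - x) * psi t)); last by apply/funext => t; rewrite /X shear_tensorE.
  have ct : continuous (fun t : 'rV[R]_d => t - x) by move=> t; exact: (@cvgB R 'rV[R]_d _ (nbhs t) _ id (fun=> x) t x cvg_id (cvg_cst x)).
  have [c1 c2] := smooth_cont (GS_smooth gchi).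
  apply: ccontinuousM (smooth_cont (GS_smooth gpsi)); split=> t.
    exact: (@continuous_comp _ _ _ (fun t : 'rV[R]_d => t - x) (fun u => complex.Re (chi u)) t (ct t) (c1 _)).
  exact: (@continuous_comp _ _ _ (fun t : 'rV[R]_d => t - x) (fun u => complex.Im (chi u)) t (ct t) (c2 _)).
have gP : GS (pfourier 1 X) by apply: GS_pfourier => //; rewrite mulr1.
have [c' c'0 Pc] := GS_dominated gP.
have dP := cdom_row_mxr x (GS_smooth gP) Pc.
have E xi : pfourier 1 X (row_mx x xi) = cintegral (fun t => X (row_mx x t) * cis (dotp t xi)).
  by rewrite /pfourier row_mxKl row_mxKr; apply: eq_cintegral => t; rewrite mul1r dotpC.
have EF : (fun xi => pfourier 1 X (row_mx x xi)) = (fun xi => cintegral (fun t => X (row_mx x t) * cis (dotp t xi))).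
  by apply/funext => xi; exact: E.
rewrite EF in dP.
have dPc : cdom (fun xi => cintegral (fun t => X (row_mx x t) * cis (dotp t xi)) * cis (- dotp y xi)) (c' * weight x).
  apply: cdom_cis => //.
  by apply: measurable_funN; apply: (@rmeas_dotp _ _ _ (fun=> y) id) => i; [exact: rmeas_cst|exact: rmeas_coord].
rewrite /partial_fourier -/(stft_const d) -/x -/y.
transitivity ((stft_const d)%:C * ((stft_const d)%:C *
    cintegral (fun xi => cintegral (fun t => X (row_mx x t) * cis (dotp t xi)) * cis (- dotp y xi)))).
  congr (_ * _); rewrite -(cintegralZ _ (cdom_integrable dPc)); apply: eq_cintegral => xi.
  by rewrite /gabor -/X E mulrA.
rewrite (fourier_inversion y cX dX dP) 2!mulrA -2!rmorphM/=.
have -> : stft_const d * stft_const d * (gaussmass d * gaussmass d) = 1 :> R.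
  by rewrite mulrACA stft_const_gaussmass mulr1.
by rewrite [1%:C]/(1 : C) mul1r.
Qed.

(** After inversion the integrand is conj(phi(y - x)) chi(y - x) psi(y), and by invariance its
    integral in x is the pairing of the two windows times psi(y). *)
Lemma window_integral_gabor psi : GS psi ->
  window_integral phi (partial_fourier (gabor psi)) = (fun y => window_pairing * psi y).
Proof.
move=> gpsi; rewrite partial_fourier_gabor//; apply/funext => y.
have [B B0 HB] := Sigma_bounded hphi; have [c dc] := GS_cdom gchi.
move=> d1.
have di : cdom (fun x => conjc (phi x) * chi x) (B * c).
  apply: cdomM => //; last by move=> x; rewrite normc_conj.
  exact: cmeasurable_conj (ccontinuous_cmeasurable (smooth_cont (Sigma_smooth hphi))).
have d2 := cdomZ (psi y) di.
rewrite /window_pairing mulrC -(cintegralZ _ (cdom_integrable di)).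
rewrite (cintegral_affine (a := -1) y _ (cdom_integrable d2)) ?oppr_eq0 ?oner_eq0//.
rewrite normrN normr1 expr1n [1%:C]/(1 : C) mul1r; apply: eq_cintegral => x.
by rewrite shear_tensorE scaleN1r [- x + y]addrC; ring.
Qed.

Section synthesis_formula.
Variables (f : ('rV[R]_d -> C) -> C) (F : 'rV[R]_(d + d) -> C) (h e c : R).
Hypotheses (hf : gs_dual 2^-1 f) (fF : is_function 2^-1 (stft f phi) F).
Hypotheses (h0 : 0 < h) (e0 : 0 < e) (c0 : 0 <= c) (bF : stft_bound s h e c F).
Hypothesis chi0 : window_pairing != 0.

(** Collects the two constants of the reconstruction formula: the inverse pairing of the windows and
    the normalisation inside [gabor]. *)
Definition normalized_stft z : C := window_pairing^-1 * (stft_const d)%:C * F z.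

Lemma cmeasurable_normalized_stft : cmeasurable normalized_stft.
Proof. by apply: cmeasurableM fF.1; exact: cmeasurable_cst. Qed.

Lemma normalized_stft_bound :
  stft_bound s h e (normc (window_pairing^-1 * (stft_const d)%:C) * c) normalized_stft.
Proof. by move=> x xi; rewrite normcM -mulrA ler_wpM2l ?normc_ge0. Qed.

Let c'0 : 0 <= normc (window_pairing^-1 * (stft_const d)%:C) * c.
Proof. by rewrite mulr_ge0 ?normc_ge0. Qed.

(** Linearity with second term 0 gives homogeneity up to the value of f at 0; taking k = 1 and psi =
    0 shows that this value is 0. *)
Lemma dual_scale psi k : GS psi -> f (fun y => k * psi y) = k * f psi.
Proof.
move=> gpsi; have z : gelfand_shilov 2^-1 (fun _ : 'rV[R]_d => 0 : C).
  have := GS_gelfand_shilov (GSZ 0 gpsi).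
  by congr (gelfand_shilov _ _); apply/funext => x; rewrite mul0r.
have E k' psi' : gelfand_shilov 2^-1 psi' -> f (fun y => k' * psi' y) = k' * f psi' + f (fun=> 0).
  move=> gp; rewrite -(hf.1 _ _ k' gp z); congr f; apply/funext => y; by rewrite addr0.
have f0 : f (fun=> 0) = 0.
  have E1 : (fun _ : 'rV[R]_d => 1 * 0 : C) = (fun=> 0) by apply/funext => y; rewrite mulr0.
  by have := E 1 _ z; rewrite E1 mul1r => /eqP; rewrite -subr_eq subrr => /eqP <-.
by rewrite E ?f0 ?addr0//; exact: GS_gelfand_shilov.
Qed.

Definition pairing_kernel (psi : 'rV[R]_d -> C) (w : 'rV[R]_(d + d + d)) : C :=
  normalized_stft (lsubmx w) * chi (rsubmx w - lsubmx (lsubmx w)) *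
  cis (dotp (rsubmx w) (rsubmx (lsubmx w))) * psi (rsubmx w).

Lemma pairing_kernelE psi z t : pairing_kernel psi (row_mx z t) =
  synth_kernel normalized_stft chi [::] [::] t z * psi t.
Proof.
by rewrite /pairing_kernel /synth_kernel /freq_pow big_nil mulr1 row_mxKl row_mxKr.
Qed.

(** [synth_kernel_bound] settles (x, xi), and the decay of psi at rate h' + 1 absorbs the growth in
    t with an integrable factor to spare. *)
Lemma cdom_pairing_kernel psi : GS psi -> exists b, cdom (pairing_kernel psi) b.
Proof.
move=> gpsi.
have [M M0 HM] := synth_kernel_bound hs e0 h0 c'0 normalized_stft_bound gchi.
set h' := (h + 1) * qtri s in HM.
have h'0 : 0 < h' + 1 by rewrite addr_gt0// mulr_gt0 ?addr_gt0// qtri_gt0.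
have [A A0 HA] := GS_exp_decay hs gpsi h'0.
have [c2 c20 H2] := enormp_weight s0 d ltr01.
exists (M * A * c2); split.
  apply: cmeasurableM; first apply: cmeasurableM; first apply: cmeasurableM.
  - by apply: (cmeasurable_comp cmeasurable_normalized_stft) => i; exact: rmeas_lsubmx.
  - apply: (ccontinuous_cmeasurable_comp (smooth_cont (GS_smooth gchi))) => i.
    rewrite (_ : (fun z : 'rV[R]_(d + d + d) => _) = (fun z => rsubmx z 0 i - lsubmx (lsubmx z) 0 i)).
      exact: (rmeasB (rmeas_rsubmx _) (rmeas_llsubmx _)).
    by apply/funext => z; rewrite [LHS]mxE; congr (_ + _); rewrite mxE.
  - apply: cmeasurable_cis; apply: (@rmeas_dotp _ _ _ (fun z => rsubmx z) (fun z => rsubmx (lsubmx z))) => i.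
      exact: rmeas_rsubmx.
    exact: rmeas_rlsubmx.
  - by apply: (ccontinuous_cmeasurable_comp (smooth_cont (GS_smooth gpsi))) => i; exact: rmeas_rsubmx.
move=> w; rewrite -[w]hsubmxK; set z := lsubmx w; set t := rsubmx w.
rewrite pairing_kernelE weight_row_mx normcM.
have b1 := HM [::] [::] t z; rewrite addn0 expr0 fact0 powR1 !mulr1 in b1.
apply: le_trans (ler_pM (normc_ge0 _) (normc_ge0 _) b1 (HA t)) _.
have w2 := H2 t; rewrite mul1r in w2.
have E : expR (h' * enormp s t) * expR (- ((h' + 1) * enormp s t)) = expR (- enormp s t).
  by rewrite -expRD; congr expR; ring.
have rg (p U W q V : R) : p * U * W * (q * V) = p * q * W * (U * V) by ring.
have rg' (p q k W V : R) : p * q * k * (W * V) = p * q * W * (k * V) by ring.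
rewrite [leLHS]rg [leRHS]rg' E; apply: ler_wpM2l w2.
by rewrite mulr_ge0 ?weight_ge0// mulr_ge0.
Qed.

Lemma pairing_kernel_integral1 psi z : GS psi ->
  cintegral (fun t => pairing_kernel psi (row_mx z t)) = window_pairing^-1 * (F z * gabor psi z).
Proof.
move=> gpsi; have gX := GS_shear (GS_tensor gchi gpsi).
have [b b0 Xb] := GS_dominated gX.
have di := cdom_pfourier 1 z (GS_smooth gX) Xb.
rewrite /gabor /pfourier.
transitivity (window_pairing^-1 * (stft_const d)%:C * F z *
  cintegral (fun t => shear (tensor chi psi) (row_mx (lsubmx z) t) * cis (1 * dotp (rsubmx z) t))).
  rewrite -(cintegralZ _ (cdom_integrable di)); apply: eq_cintegral => t.
  rewrite /pairing_kernel /normalized_stft !row_mxKl !row_mxKr shear_tensorE mul1r dotpC; ring.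
by ring.
Qed.

Lemma is_function_synth : is_function 2^-1 f (synth normalized_stft chi [::] [::]).
Proof.
have sg := smooth_synth hs e0 h0 c'0 cmeasurable_normalized_stft normalized_stft_bound gchi [::] [::].
split; first exact: ccontinuous_cmeasurable (smooth_cont sg).
move=> psi /gelfand_shilov_GS gpsi; have [b db] := cdom_pairing_kernel gpsi.
have Ez : (fun t => cintegral (fun z => pairing_kernel psi (row_mx z t))) =
    (fun t => synth normalized_stft chi [::] [::] t * psi t).
  apply/funext => t.
  have [b' db'] := cdom_synth_kernel hs e0 h0 c'0 cmeasurable_normalized_stft normalized_stft_bound gchi [::] [::] t.
  rewrite mulrC /synth -(cintegralZ _ (cdom_integrable db')); apply: eq_cintegral => z.
  by rewrite pairing_kernelE mulrC.
have dt := cdom_cintegral2 db; rewrite Ez in dt; split; first exact: cdom_integrable dt.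
have gP := GS_gelfand_shilov (GS_gabor gpsi).
have [iF EF] := fF.2 _ gP.
rewrite -Ez -(cintegral_fubini2 db) (cintegral_fubini1 db).
rewrite (eq_cintegral (fun z => pairing_kernel_integral1 z gpsi)) (cintegralZ _ iF) -EF.
rewrite (_ : stft f phi (gabor psi) = f (window_integral phi (partial_fourier (gabor psi))))//.
by rewrite window_integral_gabor// dual_scale// mulKf.
Qed.

End synthesis_formula.

End reconstruction.

(** * Matching of the constants and the equivalence *)

Section equivalence.
Context {R : realType} (d : nat).
Local Notation C := R[i].
Variables (s : R) (phi : 'rV[R]_d -> C) (f : ('rV[R]_d -> C) -> C).
Hypothesis hs : 2^-1 < s.
Hypothesis hphi : gelfand_shilov_proj s phi.
Let s0 : 0 < s. Proof. by apply: lt_trans hs; rewrite invr_gt0. Qed.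

(** The base eta / 2 anticipates the factor 2 lost in the integrations by parts. *)
Lemma symbol_stft_bound g h e c eta : smooth g -> 0 < h -> 0 < e -> 0 <= c -> 0 < eta ->
  drate s d eta = e -> symbol_bound s (eta / 2) h c g ->
  exists2 M : R, 0 < M & stft_bound s ((h + 1) * qtri s) e M (stft_fun phi g).
Proof.
move=> sg h0 e0 c0 eta0 <- hg; have eta2 : 0 < eta / 2 by rewrite divr_gt0.
have := stft_fun_bound hs hphi sg eta2 h0 c0 hg.
by rewrite (_ : 2 * (eta / 2) = eta)// mulrC divfK.
Qed.

(** A narrow Gaussian centred at a point where phi does not vanish. *)
Lemma exists_dual_window : (exists x, phi x != 0) ->
  exists2 chi : 'rV[R]_d -> C, GS chi & window_pairing phi chi != 0.
Proof.
move=> [x0 x0P]; have [B B0 HB] := Sigma_bounded hphi.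
have cc : ccontinuous (fun x => conjc (phi x)).
  have [c1 c2] := smooth_cont (Sigma_smooth hphi).
  have eR : (fun x => complex.Re (conjc (phi x))) = (fun x => complex.Re (phi x)).
    by apply/funext => x; case: (phi x).
  have eI : (fun x => complex.Im (conjc (phi x))) = (fun x => - complex.Im (phi x)).
    by apply/funext => x; case: (phi x).
  rewrite /ccontinuous eR eI; split=> // x.
  exact: (@cvgN R R^o 'rV[R]_d (nbhs x) _ _ _ (c2 x)).
have cB x : normc (conjc (phi x)) <= B by rewrite normc_conj.
have x0P' : conjc (phi x0) != 0 by rewrite conjc_eq0.
have [a a0 Ha] := gauss_test_nonzero cc cB x0P'.
by exists (fun x => (gauss a x0 x)%:C) => //; exact: GS_gauss.
Qed.

(** Solves for e the base found in [symbol_bound_synth]; a small base requires fast decay in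
    frequency, that is a large e. *)
Lemma synth_rate_surj (q : R) : 0 < q ->
  exists2 e : R, 0 < e & 2 * (s / (e / 2)) `^ s * (2 ^+ d) `^ s = q.
Proof.
move=> q0; pose k := (2 ^+ d) `^ s : R.
have k0 : 0 < k by rewrite powR_gt0// exprn_gt0.
pose r := (q / (2 * k)) `^ s^-1; have qk : 0 < q / (2 * k) by rewrite divr_gt0// mulr_gt0.
have r0 : 0 < r by rewrite powR_gt0.
exists (2 * s / r); first by rewrite divr_gt0// mulr_gt0.
have -> : s / (2 * s / r / 2) = r by field; rewrite !gt_eqF.
rewrite /r (powRVK s0 (ltW qk)) -/k; field.
by rewrite gt_eqF.
Qed.

Lemma smooth_reconstruction F chi h e c (hF : is_function 2^-1 (stft f phi) F) :
  GS chi -> 0 < h -> 0 < e -> 0 < c -> stft_bound s h e c F ->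
  smooth (synth (normalized_stft phi chi F) chi [::] [::]) /\
  exists2 M : R, 0 < M & symbol_bound s (2 * (s / (e / 2)) `^ s * (2 ^+ d) `^ s) ((h + 1) * qtri s) M
    (synth (normalized_stft phi chi F) chi [::] [::]).
Proof.
move=> gchi h0 e0 c0 bF.
have c'0 : 0 <= normc ((window_pairing phi chi)^-1 * (stft_const d)%:C) * c.
  by rewrite mulr_ge0 ?normc_ge0// ltW.
have mF := cmeasurable_normalized_stft chi hF; have nF := normalized_stft_bound phi chi bF.
split; first exact: smooth_synth hs e0 h0 c'0 mF nF gchi [::] [::].
exact: symbol_bound_synth hs e0 h0 c'0 mF nF gchi.
Qed.

End equivalence.

Theorem proposition3p2 (R : realType) (d : nat) (s : R)
    (phi : 'rV[R]_d -> R[i]) (f : ('rV[R]_d -> R[i]) -> R[i])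
    (hs : 2^-1 < s)
    (hphi : gelfand_shilov_proj s phi) (phi0 : exists x, phi x != 0)
    (hf : gs_dual 2^-1 f) :
  ((exists2 g, is_function 2^-1 f g & Gamma0 s g) <->
   (exists2 F, is_function 2^-1 (stft f phi) F &
     exists2 h, 0 < h & forall e, 0 < e ->
       exists2 c, 0 < c & stft_bound s h e c F)) /\
  ((exists2 g, is_function 2^-1 f g & Gamma1 s g) <->
   (exists2 F, is_function 2^-1 (stft f phi) F &
     exists2 h, 0 < h & exists2 e, 0 < e &
       exists2 c, 0 < c & stft_bound s h e c F)).
Proof.
have s0 : 0 < s by apply: lt_trans hs; rewrite invr_gt0.
have K0 (h : R) : 0 < h -> 0 < (h + 1) * qtri s.
  by move=> h0; rewrite mulr_gt0 ?addr_gt0// qtri_gt0.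
have [chi gchi chi0] := exists_dual_window hphi phi0.
split; split.
- move=> [g fg [sg [h h0 H]]].
  (* A single bound, here with value 1, is enough to represent V_phi f by a function; the other
     values of e only sharpen its decay. *)
  have [c1 c10 H1] := H 1 ltr01.
  exists (stft_fun phi g); first exact: (is_function_stft hs hphi sg ltr01 h0 (ltW c10) H1 fg).
  exists ((h + 1) * qtri s); first exact: K0.
  move=> e e0; have [eta eta0 etaE] := drate_surj s0 d e0.
  have eta2 : 0 < eta / 2 by rewrite divr_gt0.
  have [c c0 Hc] := H _ eta2.
  exact: (symbol_stft_bound hs hphi sg h0 e0 (ltW c0) eta0 etaE Hc).
- move=> [F fF [h h0 H]].
  have [c1 c10 H1] := H 1 ltr01.
  exists (synth (normalized_stft phi chi F) chi [::] [::]).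
    exact: (is_function_synth hs hphi gchi hf fF h0 ltr01 (ltW c10) H1 chi0).
  split; first by have [] := smooth_reconstruction hs fF gchi h0 ltr01 c10 H1.
  exists ((h + 1) * qtri s); first exact: K0.
  (* The synthesised function does not depend on e: each decay rate of F yields another bound on the
     same function. *)
  move=> q q0; have [e e0 <-] := synth_rate_surj d hs q0.
  have [c c0 Hc] := H e e0.
  by have [_] := smooth_reconstruction hs fF gchi h0 e0 c0 Hc.
- move=> [g fg [sg [h h0 [e e0 [c c0 H]]]]].
  exists (stft_fun phi g); first exact: (is_function_stft hs hphi sg e0 h0 (ltW c0) H fg).
  exists ((h + 1) * qtri s); first exact: K0.
  exists (drate s d (2 * e)); first by apply: drate_gt0 => //; rewrite mulr_gt0.
  exact: (stft_fun_bound hs hphi sg e0 h0 (ltW c0) H).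
- move=> [F fF [h h0 [e e0 [c c0 H]]]].
  exists (synth (normalized_stft phi chi F) chi [::] [::]).
    exact: (is_function_synth hs hphi gchi hf fF h0 e0 (ltW c0) H chi0).
  have [sg [M M0 HM]] := smooth_reconstruction hs fF gchi h0 e0 c0 H.
  split=> //; exists ((h + 1) * qtri s); first exact: K0.
  exists (2 * (s / (e / 2)) `^ s * (2 ^+ d) `^ s); last by exists M.
  by rewrite !mulr_gt0 ?powR_gt0 ?exprn_gt0// divr_gt0// divr_gt0.
Qed.
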